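(* Let $m,n\geq 2$ and $k\in[0,n-1]$. If the Structural Property $\mathcal{P}(n,1,k)$ holds (i.e. for the group $C_n\oplus C_n$ and this $k$), then the Structural Property $\mathcal{P}(n,m,k)$ holds (i.e. for the group $C_n\oplus C_{mn}$ and the same $k$).
   Context: For $n\geq 1$, $C_n$ denotes a cyclic group of order $n$. For $x,y\in\mathbb Z$, $[x,y]=\{z\in\mathbb Z: x\le z\le y\}$. A basis of $G=C_n\oplus C_{mn}$ ($n\ge 2$) is an ordered pair $(e_1,e_2)$ with $G=\langle e_1\rangle\oplus\langle e_2\rangle$. A sequence over an abelian group $G$ is a finite unordered list of elements (a multiset), written multiplicatively $S=g_1\cdot\ldots\cdot g_\ell$; $|S|=\ell$ is its length; $g^{[t]}$ denotes $g$ repeated $t$ times and $\prod^\bullet$ denotes concatenation of sequences; $\sigma(S)=g_1+\dots+g_\ell$; $\Sigma_{\le N}(S)$ is the set of sums $\sigma(T)$ over all subsequences $T$ of $S$ with $1\le |T|\le N$. $\mathrm{ord}(g)$ is the order of $g$. Structural Property $\mathcal P(n,m,k)$ (for $n\ge 2$, $m\ge1$, $G=C_n\oplus C_{mn}$, $k\in[0,n-1]$): for every sequence $S$ over $G$ with $|S|=mn+n-2+k$ and $0\notin\Sigma_{\le mn+n-1-k}(S)$, there exists either a basis $(e_1,e_2)$ of $G$ with $\mathrm{ord}(e_2)=mn$, or a generating set $\{g_1,g_2\}$ of $G$ with $\mathrm{ord}(g_1+g_2)=mn$, such that: 1. If $k=0$, then the sequence $S\cdot g$, where $g=-\sigma(S)$,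 has one of the forms (a)–(d) listed in item 2. 2. If $k=1$, then $S$ has one of the forms: (a) $e_1^{[n-1]}\cdot\prod^\bullet_{i\in[1,mn]}(x_ie_1+e_2)$ with $x_i\in[0,n-1]$, $x_1+\dots+x_{mn}\equiv1\pmod n$; (b) $e_2^{[mn-1]}\cdot\prod^\bullet_{i\in[1,n]}(x_ie_2+e_1)$ with $x_i\in[0,mn-1]$, $x_1+\dots+x_n\equiv 1\pmod{mn}$; (c) $g_1^{[sn-1]}\cdot(g_1+g_2)^{[(m-s)n+1]}\cdot\prod^\bullet_{i\in[1,n-1]}(-x_ig_1+g_2)$ for some $s\in[1,m-1]$, $x_i\in[-1,n-2]$ with $x_1+\dots+x_{n-1}=0$ and $ng_2=0$; (d) $g_1^{[n-1]}\cdot(g_1+g_2)^{[(m-1)n+1]}\cdot\prod^\bullet_{i\in[1,n-1]}(-x_ig_1+g_2)$ with $x_i\in[-1,n-2]$, $x_1+\dots+x_{n-1}=0$. 3. If $k\in[2,n-2]$, then either (a) $S=e_1^{[n-1]}\cdot e_2^{[sn-1]}\cdot(e_1+e_2)^{[(m-s)n+k]}$ for some $s\in[1,m]$, or (b) $S=g_1^{[n-1]}\cdot g_2^{[n-1]}\cdot(g_1+g_2)^{[(m-1)n+k]}$. 4. If $k=n-1$, then either (a) $S=e_1^{[n-1]}\cdot e_2^{[sn-1]}\cdot(xe_1+e_2)^{[(m-s)n+n-1]}$ for some $s\in[1,m]$ and $x\in[1,n-1]$ with $\gcd(x,n)=1$, or (b) $S=g_1^{[n-1]}\cdot g_2^{[n-1]}\cdot(g_1+g_2)^{[(m-1)n+n-1]}$.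 Moreover, if $m=1$, then alternative (a) holds in each applicable item. *)

(* Defs.v *)
From HB Require Import structures.
From mathcomp Require Import all_boot all_order all_algebra.
Set Implicit Arguments. Unset Strict Implicit. Unset Printing Implicit Defensive.
Import Order.TTheory GRing.Theory Num.Theory.
Local Open Scope ring_scope.

(* The group G = C_n (+) C_(mn), modelled concretely as 'Z_n * 'Z_(m*n)
   (faithful when n >= 2, which is always assumed). *)
Definition grp (n m : nat) : zmodType := ('Z_n * 'Z_(m * n))%type.

Section Gen.
Variable V : zmodType.

Definition has_order (g : V) (d : nat) : Prop :=
  [/\ (0 < d)%N, g *+ d = 0 & forall t, (0 < t < d)%N -> g *+ t <> 0].

Definition is_basis (e1 e2 : V) : Prop :=
  (forall g : V, exists a b : nat, g = e1 *+ a + e2 *+ b) /\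
  (forall a b : nat, e1 *+ a + e2 *+ b = 0 -> e1 *+ a = 0 /\ e2 *+ b = 0).

Definition generates (g1 g2 : V) : Prop :=
  forall g : V, exists a b : nat, g = g1 *+ a + g2 *+ b.

Definition in_sigma_le (N : nat) (S : seq V) (g : V) : Prop :=
  exists b : bitseq, [/\ (0 < size (mask b S))%N, (size (mask b S) <= N)%N
                      & \sum_(x <- mask b S) x = g].

(* Forms of item 2 (k = 1); sequences are multisets, compared up to perm_eq *)
Definition form2a (n m : nat) (e1 e2 : V) (S : seq V) : Prop :=
  exists x : seq nat, [/\ size x = (m * n)%N, all (fun xi => xi < n)%N x,
     sumn x = 1 %[mod n] &
     perm_eq S (nseq n.-1 e1 ++ [seq e1 *+ xi + e2 | xi <- x])].

Definition form2b (n m : nat) (e1 e2 : V) (S : seq V) : Prop :=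
  exists x : seq nat, [/\ size x = n, all (fun xi => xi < m * n)%N x,
     sumn x = 1 %[mod m * n] &
     perm_eq S (nseq (m * n).-1 e2 ++ [seq e2 *+ xi + e1 | xi <- x])].

Definition form2c (n m : nat) (g1 g2 : V) (S : seq V) : Prop :=
  exists (s : nat) (x : seq int), (1 <= s <= m.-1)%N /\ [/\ size x = n.-1,
     all (fun xi => (-1 <= xi) && (xi <= (n%:Z - 2))) x,
     \sum_(xi <- x) xi = 0, g2 *+ n = 0 &
     perm_eq S (nseq (s * n).-1 g1 ++ nseq ((m - s) * n + 1) (g1 + g2)
                ++ [seq g1 *~ (- xi) + g2 | xi <- x])].

Definition form2d (n m : nat) (g1 g2 : V) (S : seq V) : Prop :=
  exists x : seq int, [/\ size x = n.-1,
     all (fun xi => (-1 <= xi) && (xi <= (n%:Z - 2))) x,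
     \sum_(xi <- x) xi = 0 &
     perm_eq S (nseq n.-1 g1 ++ nseq ((m - 1) * n + 1) (g1 + g2)
                ++ [seq g1 *~ (- xi) + g2 | xi <- x])].

Definition form3a (n m k : nat) (e1 e2 : V) (S : seq V) : Prop :=
  exists s : nat, (1 <= s <= m)%N /\
    perm_eq S (nseq n.-1 e1 ++ nseq (s * n).-1 e2 ++ nseq ((m - s) * n + k) (e1 + e2)).

Definition form3b (n m k : nat) (g1 g2 : V) (S : seq V) : Prop :=
  perm_eq S (nseq n.-1 g1 ++ nseq n.-1 g2 ++ nseq ((m - 1) * n + k) (g1 + g2)).

Definition form4a (n m : nat) (e1 e2 : V) (S : seq V) : Prop :=
  exists s x : nat, [/\ (1 <= s <= m)%N, (1 <= x <= n.-1)%N, coprime x n &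
    perm_eq S (nseq n.-1 e1 ++ nseq (s * n).-1 e2
               ++ nseq ((m - s) * n + n.-1) (e1 *+ x + e2))].

Definition form4b (n m : nat) (g1 g2 : V) (S : seq V) : Prop :=
  perm_eq S (nseq n.-1 g1 ++ nseq n.-1 g2 ++ nseq ((m - 1) * n + n.-1) (g1 + g2)).

Definition altA (m n : nat) (FA : V -> V -> seq V -> Prop) (T : seq V) : Prop :=
  exists e1 e2 : V, [/\ is_basis e1 e2, has_order e2 (m * n) & FA e1 e2 T].

Definition altG (m n : nat) (FG : V -> V -> seq V -> Prop) (T : seq V) : Prop :=
  exists g1 g2 : V, [/\ generates g1 g2, has_order (g1 + g2) (m * n) & FG g1 g2 T].

Definition item2 (n m : nat) (T : seq V) : Prop :=
  (altA m n (fun e1 e2 T => form2a n m e1 e2 T \/ form2b n m e1 e2 T) T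
   \/ altG m n (fun g1 g2 T => form2c n m g1 g2 T \/ form2d n m g1 g2 T) T)
  /\ (m = 1%N -> altA m n (form2a n m) T).

Definition item3 (n m k : nat) (T : seq V) : Prop :=
  (altA m n (form3a n m k) T \/ altG m n (form3b n m k) T)
  /\ (m = 1%N -> altA m n (form3a n m k) T).

Definition item4 (n m : nat) (T : seq V) : Prop :=
  (altA m n (form4a n m) T \/ altG m n (form4b n m) T)
  /\ (m = 1%N -> altA m n (form4a n m) T).

End Gen.

Definition StructuralProperty (n m k : nat) : Prop :=
  forall S : seq (grp n m),
    size S = (m * n + n - 2 + k)%N ->
    ~ in_sigma_le (m * n + n - 1 - k) S 0 ->
    [/\ k = 0%N -> item2 n m (rcons S (- \sum_(x <- S) x)),
        k = 1%N -> item2 n m S,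
        (2 <= k <= n - 2)%N -> item3 n m k S &
        k = n.-1 -> item4 n m S].

(* Main.v *)
Require Import Defs.
From HB Require Import structures.
From mathcomp Require Import all_boot all_order all_algebra finfield.
From mathcomp Require Import zify ring.
Set Implicit Arguments. Unset Strict Implicit. Unset Printing Implicit Defensive.
Import Order.TTheory GRing.Theory Num.Theory.
Local Open Scope ring_scope.

(** Reduce modulo [n]: [phi : C_n + C_(mn) -> C_n + C_n] has a cyclic kernel of order [m].
    Since any [3 n - 2] elements of [C_n + C_n] contain a zero-sum subsequence of length at
    most [n] (proved with the polynomial method over [F_p] and multiplicativity), an extremal
    [S] splits as [W] followed by [m - 1] blocks of length [n] whose sums lie in the kernel,
    where [phi(W)] is extremal in [C_n + C_n]. The block sums form a zero-sum free sequence of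
    maximal length over a cyclic group, so they all equal one generator [g], and every
    zero-sum exchange between [W] and a block again produces [g]. These exchanges lift the
    structure of [phi(W)] given by P(n,1,k) to [W], and pin down the elements of the blocks.
    For [k >= 2] all blocks are constant. For [k = 1], [W] consists of [n - 1] copies of some
    [eps] and [n] elements [f_i]: all blocks equal to [eps^n] gives form (b), [n eps = 0] gives
    form (a), and otherwise one writes [f_i = F + X_i eps] with integers [X_i] of sum [1] and
    block elements as [z F + C eps], shows [C = 1], and reads off forms (a), (c) and (d). The
    case [k = 0] is the case [k = 1] for the minimal zero-sum sequence [S . (-sigma(S))]. *)

(** * Permutations and zero-sum-free sequences of residues *)

(** All lengths are tight. Reserving [k] elements of [S] and removing [m - 2] blocks of length [n]
    leaves exactly [3 n - 2], so a last block still exists; this is why up to [k] prescribed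
    elements can be kept in [W]. Conversely, [m - 2] blocks and a zero-sum exchange of length at
    most [3 n - 1 - k] stay within the forbidden length [m n + n - 1 - k]. That no block is shorter
    than [n] rests on the maximal length [2 n - 2 + k] of an admissible sequence over [C_n + C_n].
    This bound is not part of P(n,1,k) and has to be derived: for [k >= 2] from the structure given
    by P(n,1,k), for [k = 1] from the Davenport constant [2 n - 1]. The obstacle for [k = 1] is that
    [n eps] need not vanish, so residues modulo [n] do not determine multiples of [eps]. Integer
    coordinates are used instead, and every comparison is arranged so that two candidates differ by
    less than [2 n]; when [n eps <> 0], such a difference annihilates [eps] only if it is [0]. *)

Ltac slia :=
  repeat match goal with H : context [size _] |- _ => progress simpl in H end;
  simpl; lia.

Ltac perm_count :=
  let pr := fresh "pr" in apply/permP => pr;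
  repeat match goal with
    H : is_true (perm_eq _ _) |- _ => move/permP/(_ pr): H end;
  do 4 rewrite /= ?(count_cat, count_nseq, flatten_cat);
  repeat match goal with |- context [(nat_of_bool ?b * ?i)%N] =>
    move: (nat_of_bool b * i)%N => ? end;
  clear; intros; lia.

Lemma perm_map_lift (A B : eqType) (f : A -> B) (s : seq A) (t : seq B) :
  perm_eq (map f s) t -> exists2 s', perm_eq s s' & map f s' = t.
Proof.
case: s => [|x0 s0]; first by rewrite perm_sym => /perm_nilP ->; exists [::].
set s := x0 :: s0; rewrite perm_sym => /(perm_iotaP (f x0)) [Is pIs ->].
rewrite size_map in pIs; exists (map (nth x0 s) Is).
  by rewrite -{1}[s](mkseq_nth x0) perm_sym perm_map.
rewrite -map_comp; apply/eq_in_map => i.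
by rewrite (perm_mem pIs) mem_iota add0n => /andP[_ lt_i]; exact/esym/nth_map.
Qed.

Lemma perm_map_cat_lift (A B : eqType) (f : A -> B) (s : seq A) (t r : seq B) :
  perm_eq (map f s) (t ++ r) ->
  exists T R, [/\ perm_eq s (T ++ R), map f T = t & map f R = r].
Proof.
move=> /perm_map_lift [s' ps' es'].
exists (take (size t) s'), (drop (size t) s'); rewrite cat_take_drop; split=> //.
  by rewrite map_take es' take_size_cat.
by rewrite map_drop es' drop_size_cat.
Qed.

Lemma mem_perm_cons (A : eqType) (x : A) (s : seq A) :
  x \in s -> exists r, perm_eq s (x :: r).
Proof. by move=> xs; exists (rem x s); exact: perm_to_rem. Qed.

Lemma nseq_of_all (A : eqType) (x : A) (s : seq A) (n : nat) :
  size s = n -> (forall y, y \in s -> y = x) -> s = nseq n x.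
Proof.
move=> <- h; apply/all_pred1P/allP => y ys; apply/eqP; exact: h.
Qed.

Lemma size_flatten_const (A : eqType) (n : nat) (Bs : seq (seq A)) :
  (forall B, B \in Bs -> size B = n) -> size (flatten Bs) = (n * size Bs)%N.
Proof.
elim: Bs => [|B Bs IH] h /=; first by rewrite muln0.
rewrite size_cat h ?mem_head // IH ?mulnS // => C CB; apply: h.
by rewrite in_cons CB orbT.
Qed.

Lemma size_flatten_le (A : eqType) (n : nat) (Bs : seq (seq A)) :
  (forall B, B \in Bs -> size B <= n)%N -> (size (flatten Bs) <= n * size Bs)%N.
Proof.
elim: Bs => [|B Bs IH] h //=.
rewrite size_cat mulnS leq_add // ?h ?mem_head // IH // => C CB; apply: h.
by rewrite in_cons CB orbT.
Qed.

Lemma big_flatten_map (A : eqType) (V : zmodType) (f : A -> V) (Bs : seq (seq A)) :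
  \sum_(x <- flatten Bs) f x = \sum_(B <- Bs) \sum_(x <- B) f x.
Proof.
elim: Bs => [|B Bs IH] /=; first by rewrite !big_nil.
by rewrite big_cat big_cons IH.
Qed.

(** Greedy extraction. The last of the [j] blocks needs only [N] remaining elements, so
    [(j - 1) L + N] elements suffice; [L] is added on both sides to avoid subtraction. *)
Lemma extract_blocks (A : eqType) (P : seq A -> Prop) (N L : nat) :
  (forall s, (N <= size s)%N ->
     exists T R, [/\ perm_eq s (T ++ R), P T & (size T <= L)%N]) ->
  forall j s, (j * L + N <= size s + L)%N ->
  exists Bs R, [/\ perm_eq s (R ++ flatten Bs), size Bs = j &
                   forall B, B \in Bs -> P B /\ (size B <= L)%N].
Proof.
move=> h; elim=> [|j IH] s hs.
  by exists [::], s; split=> //; rewrite cats0.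
have [|T [R [p pT sT]]] := h s; first by lia.
have [|Bs [R' [p' sB hB]]] := IH R.
  by move: (perm_size p); rewrite size_cat; lia.
exists (T :: Bs), R'; split=> /=.
- rewrite (permPl p) perm_sym perm_catCA perm_cat2l perm_sym //.
- by rewrite sB.
- by move=> B; rewrite in_cons => /orP[/eqP-> //|]; exact: hB.
Qed.

Definition nat_zsfree (m : nat) (s : seq nat) : Prop :=
  forall t r, perm_eq s (t ++ r) -> (0 < size t)%N -> ~~ (m %| sumn t)%N.

Lemma nat_zsfree_perm m s s' : perm_eq s s' -> nat_zsfree m s -> nat_zsfree m s'.
Proof. by move=> p h t r p'; apply: (h t r); rewrite (permPl p). Qed.

Lemma nat_zsfree_catl m s s' : nat_zsfree m (s ++ s') -> nat_zsfree m s.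
Proof.
move=> h t r p; apply: (h t (r ++ s')).
by rewrite catA perm_cat2r.
Qed.

(** The nonempty prefix sums are nonzero and pairwise incongruent, because a difference of two of
    them is again a subsequence sum; [m - 1] of them exhaust the nonzero residues. *)
Lemma prefix_sums_cover m s : (0 < m)%N -> nat_zsfree m s -> size s = m.-1 ->
  forall r, (0 < r < m)%N ->
  exists2 k, (0 < k <= size s)%N & sumn (take k s) = r %[mod m].
Proof.
move=> m0 h sz r hr.
pose L := [seq (sumn (take k s) %% m)%N | k <- iota 1 (size s)].
have diff k l : (k < l)%N -> (l <= size s)%N ->
    (sumn (take k s) %% m)%N != (sumn (take l s) %% m)%N.
  move=> kl ls; apply/eqP => e.
  have : (m %| sumn (drop k (take l s)))%N.
    have := congr1 sumn (cat_take_drop k (take l s)).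
    rewrite take_takel 1?ltnW // sumn_cat => e'.
    have /eqP : (sumn (take k s) + sumn (drop k (take l s)) = sumn (take k s) + 0 %[mod m])%N.
      by rewrite e' addn0 e.
    by rewrite eqn_modDl mod0n.
  apply/negP; apply: (h _ (take k s ++ drop l s)); last first.
    by rewrite size_drop size_takel // subn_gt0.
  rewrite -{1}(cat_take_drop l s) -{1}(cat_take_drop k (take l s)) take_takel 1?ltnW //.
  by rewrite catA perm_cat2r perm_catC.
have uL : uniq L.
  rewrite map_inj_in_uniq ?iota_uniq // => k l; rewrite !mem_iota => hk hl e.
  by case: (ltngtP k l) => // kl; [have := @diff k l kl|have := @diff l k kl]; rewrite e eqxx; lia.
have sL : {subset L <= iota 1 m.-1}.
  move=> x /mapP [k]; rewrite mem_iota => hk ->; rewrite mem_iota.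
  have := @diff 0 k; rewrite take0 /= mod0n eq_sym.
  have := ltn_pmod (sumn (take k s)) m0; lia.
have szL : (size (iota 1 m.-1) <= size L)%N by rewrite size_map !size_iota sz.
have [_ eqL] := uniq_min_size uL sL szL.
have : r \in L by rewrite eqL mem_iota; lia.
case/mapP => k; rewrite mem_iota => hk er; exists k; first by lia.
by rewrite [RHS]modn_small; [rewrite er|lia].
Qed.

(** In a longer sequence [x :: s] the prefix sums of [m - 1] elements of [s] would reach [-x]. *)
Lemma nat_zsfree_small m s : (0 < m)%N -> nat_zsfree m s -> (size s < m)%N.
Proof.
move=> m0 h; rewrite ltnNge; apply/negP => le.
case: s h le => [|x s] h le; first by move: le => /=; lia.
have x0 : ~~ (m %| x)%N.
  by have := h [:: x] s (perm_refl _) isT; rewrite /= addn0.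
have le' : (m.-1 <= size s)%N by move: le => /=; lia.
have h' : nat_zsfree m (take m.-1 s).
  apply: (@nat_zsfree_catl _ _ (x :: drop m.-1 s)); apply: nat_zsfree_perm h.
  by rewrite perm_sym perm_catC /= perm_cons perm_catC cat_take_drop.
have [||k hk ek] := prefix_sums_cover m0 h' _ (r := (m - x %% m)%N).
- by rewrite size_takel.
- have := ltn_pmod x m0; move: x0; rewrite /dvdn; lia.
rewrite size_takel // in hk; rewrite take_takel in ek; last by lia.
have := h (x :: take k s) (drop k s) _ isT.
rewrite /= perm_cons cat_take_drop perm_refl => /(_ isT) /negP; apply.
rewrite /dvdn -modnDmr ek modnDmr.
rewrite {1}(divn_eq x m) -addnA subnKC; last by rewrite ltnW // ltn_pmod.
by rewrite modnMDl modnn.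
Qed.

(** List the sequence as [a, b, ...]: some prefix sum is congruent to [b]. A prefix containing [b]
    would become a nonempty zero-sum once [b] is deleted, so the prefix is [a] alone. *)
Lemma nat_zsfree_congr m s a b : (0 < m)%N -> nat_zsfree m s -> size s = m.-1 ->
  a \in s -> b \in s -> a = b %[mod m].
Proof.
move=> m0 h sz ha hb; case: (boolP (a == b)) => [eab|nab]; first by rewrite (eqP eab).
have [r p] := mem_perm_cons ha.
have : b \in r by move: hb; rewrite (perm_mem p) in_cons eq_sym (negbTE nab).
case/mem_perm_cons => r' p'.
have ps : perm_eq s [:: b, a & r'].
  rewrite (permPl p) -cat1s (permPr (_ : perm_eq _ ([:: a] ++ b :: r'))) ?perm_cat2l //.
  by rewrite -[[:: b, a & r']]/([:: b] ++ [:: a] ++ r') perm_catCA.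
have {}ps : perm_eq s [:: a, b & r'].
  by rewrite (permPl p) perm_cons.
have hs := nat_zsfree_perm ps h.
have b0 : ~~ (m %| b)%N.
  have /= := hs [:: b] (a :: r') _ isT; rewrite addn0; apply.
  by rewrite -[[:: a, b & r']]/([:: a] ++ [:: b] ++ r') perm_catCA.
have := @prefix_sums_cover m _ m0 hs _ (b %% m)%N.
rewrite -(perm_size ps) => /(_ sz); case.
  by rewrite ltn_pmod // andbT lt0n.
move=> [|[|k]] //= _; rewrite modn_mod ?take0 ?addn0 // => /eqP.
rewrite addnCA -{2}[b]addn0 eqn_modDl mod0n => e.
have /= := hs (a :: take k r') (b :: drop k r') _ isT.
rewrite /dvdn e; case/(_ _)/negP => //.
by rewrite perm_cons perm_sym perm_catC /= perm_cons perm_catC cat_take_drop.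
Qed.

(** * Linear identities in abelian groups by reflection *)

Inductive zexp := ZVar of nat | ZAdd of zexp & zexp | ZOpp of zexp | ZZero.

Fixpoint zeval (V : zmodType) (env : seq V) (e : zexp) : V :=
  match e with
  | ZVar i => nth 0 env i
  | ZAdd e1 e2 => zeval env e1 + zeval env e2
  | ZOpp e1 => - zeval env e1
  | ZZero => 0
  end.

Fixpoint zcoef (e : zexp) (i : nat) : int :=
  match e with
  | ZVar j => (i == j)%:Z
  | ZAdd e1 e2 => zcoef e1 i + zcoef e2 i
  | ZOpp e1 => - zcoef e1 i
  | ZZero => 0
  end.

Lemma zevalE (V : zmodType) (env : seq V) e :
  zeval env e = \sum_(i < size env) nth 0 env i *~ zcoef e i.
Proof.
elim: e => [j|e1 IH1 e2 IH2|e1 IH1|] /=.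
- have [lj|gj] := ltnP j (size env).
    rewrite (bigD1 (Ordinal lj)) //= eqxx big1 ?addr0 // => i ni.
    by rewrite (_ : (i == j :> nat) = false) //; apply: negbTE; apply: contra ni => /eqP e; apply/eqP/val_inj.
  rewrite nth_default // big1 // => i _.
  by rewrite (_ : (i == j :> nat) = false) //; apply/negbTE; have := ltn_ord i; lia.
- by rewrite IH1 IH2 -big_split /=; apply: eq_bigr => i _; rewrite mulrzDr.
- by rewrite IH1 -sumrN; apply: eq_bigr => i _; rewrite mulrNz.
- by rewrite big1 // => i _; rewrite mulr0z.
Qed.

Lemma zeval_eq (V : zmodType) (env : seq V) e1 e2 :
  all (fun i => zcoef e1 i == zcoef e2 i) (iota 0 (size env)) ->
  zeval env e1 = zeval env e2.
Proof.
move/allP=> h; rewrite !zevalE; apply: eq_bigr => i _.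
have hi : (i : nat) \in iota 0 (size env) by rewrite mem_iota /=.
by rewrite (eqP (h _ hi)).
Qed.

Ltac zfind x l :=
  lazymatch l with
  | cons ?y ?l' => match goal with
      | _ => let _ := match goal with _ => unify x y end in constr:(0%N)
      | _ => let i := zfind x l' in constr:(S i) end
  end.
Ltac zatoms e l :=
  lazymatch e with
  | (?a + ?b)%R => let l1 := zatoms a l in zatoms b l1
  | (- ?a)%R => zatoms a l
  | 0%R => l
  | _ => match goal with
         | _ => let _ := zfind e l in l
         | _ => constr:(cons e l) end
  end.
Ltac zreify e l :=
  lazymatch e with
  | (?a + ?b)%R => let x := zreify a l in let y := zreify b l in constr:(ZAdd x y)
  | (- ?a)%R => let x := zreify a l in constr:(ZOpp x)
  | 0%R => constr:(ZZero)
  | _ => let i := zfind e l in constr:(ZVar i)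
  end.
(** Proves equalities built from [+], [-] and [0] by comparing integer coefficients; every other
    term, such as [x *+ n], is an atom. *)
Ltac zmodule :=
  lazymatch goal with
  | |- @eq _ ?a ?b =>
    let T := match type of a with ?T => T end in
    let l0 := zatoms a (@nil T) in
    let l := zatoms b l0 in
    let ea := zreify a l in let eb := zreify b l in
    exact (@zeval_eq _ l ea eb (erefl true))
  end.

(** * Zero-sum subsequences over [C_n + C_n] by the polynomial method *)

Section DifferenceOperators.
Variables (A : zmodType) (F : comNzRingType).
Implicit Types (f g : A -> F) (s : seq A).

(** Functions of degree less than [k], expressed by the vanishing of all [k]-fold differences; no
    polynomial and no coordinates on [A] are involved. *)
Fixpoint deg_lt (k : nat) f : Prop :=
  if k is k'.+1 then forall v, deg_lt k' (fun a => f a - f (a + v))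
  else forall a, f a = 0.

Lemma deg_lt_ext k f g : f =1 g -> deg_lt k f -> deg_lt k g.
Proof.
elim: k f g => [|k IH] f g e /=; first by move=> h a; rewrite -e.
by move=> h v; apply: IH (h v) => a; rewrite !e.
Qed.

Lemma deg_ltD k f g : deg_lt k f -> deg_lt k g -> deg_lt k (fun a => f a + g a).
Proof.
elim: k f g => [|k IH] f g /= hf hg; first by move=> a; rewrite hf hg addr0.
move=> v; apply: (deg_lt_ext _ (IH _ _ (hf v) (hg v))) => a /=; ring.
Qed.

Lemma deg_lt_shift k f u : deg_lt k f -> deg_lt k (fun a => f (a + u)).
Proof.
elim: k f => [|k IH] f /= h; first by move=> a.
by move=> v; apply: (deg_lt_ext _ (IH _ (h v))) => a /=; rewrite addrAC.
Qed.

Lemma deg_lt0M k f g : deg_lt 0 f -> deg_lt k (fun a => f a * g a).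
Proof.
elim: k f g => [|k IH] f g h /=; first by move=> a; rewrite h mul0r.
by move=> v; apply: (deg_lt_ext _ (IH f g h)) => a /=; rewrite !h !mul0r subr0.
Qed.

(** Leibniz rule: the difference of [f g] is [(f a - f (a + v)) g a + f (a + v) (g a - g (a + v))],
    and each summand has smaller total degree. *)
Lemma deg_ltM k l f g :
  deg_lt k.+1 f -> deg_lt l.+1 g -> deg_lt (k + l).+1 (fun a => f a * g a).
Proof.
elim: {k l}(k + l)%N {-2}k {-2}l (leqnn (k + l)) f g => [|N IH] k l le f g hf hg.
  move: le; rewrite leqn0 addn_eq0 => /andP[/eqP ? /eqP ?]; subst k l => v a /=.
  have := hf v a; have := hg v a; rewrite /= => /subr0_eq <- /subr0_eq <-.
  by rewrite subrr.
have dl v : deg_lt (k + l) (fun a => (f a - f (a + v)) * g a).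
  case: k le hf => [|k] le hf; first exact: deg_lt0M (hf v).
  by rewrite addSn; apply: IH; [lia | exact: hf v | ].
have dr v : deg_lt (k + l) (fun a => f (a + v) * (g a - g (a + v))).
  case: l le hg {dl} => [|l] le hg.
    apply: (@deg_lt_ext _ (fun a => (g a - g (a + v)) * f (a + v))).
      by move=> a; rewrite mulrC.
    exact: deg_lt0M (hg v).
  by rewrite addnS; apply: IH; [lia | exact: deg_lt_shift | exact: hg v].
move=> v; apply: (deg_lt_ext _ (deg_ltD (dl v) (dr v))) => a /=; ring.
Qed.

Lemma deg_lt_cst c : deg_lt 1 (fun=> c).
Proof. by move=> v a; rewrite subrr. Qed.

Lemma deg_lt_additive (f : {additive A -> F}) : deg_lt 2 f.
Proof. by move=> v w a; rewrite !raddfD /=; ring. Qed.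

Lemma deg_ltX k f e : deg_lt k.+1 f -> deg_lt (k * e).+1 (fun a => f a ^+ e).
Proof.
move=> hf; elim: e => [|e IH].
  rewrite muln0; apply: (deg_lt_ext _ (deg_lt_cst 1)) => a.
  by rewrite expr0.
rewrite mulnS; apply: (deg_lt_ext _ (deg_ltM hf IH)) => a.
by rewrite exprS.
Qed.

Lemma deg_ltB1 k f : deg_lt k.+1 f -> deg_lt k.+1 (fun a => 1 - f a).
Proof.
move=> h v.
have hn : deg_lt 1 (fun=> -1 : F) by exact: deg_lt_cst.
have h' : deg_lt k (fun a => -1 * f a - -1 * f (a + v)) := deg_ltM hn h v.
by apply: deg_lt_ext h' => a; ring.
Qed.

(** The sum of [(-1)^|t| f(sigma(t))] over all subsequences [t] of [s], that is, the iterated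
    difference of [f] at [0] in the directions of [s]. *)
Fixpoint alt_sum s f : F :=
  if s is v :: s' then alt_sum s' f - alt_sum s' (fun a => f (a + v)) else f 0.

Lemma alt_sum_ext s f g : f =1 g -> alt_sum s f = alt_sum s g.
Proof.
elim: s f g => [|v s IH] f g e /=; first by rewrite e.
congr (_ - _); apply: IH => // a; exact: e.
Qed.

Lemma alt_sumB s f g : alt_sum s (fun a => f a - g a) = alt_sum s f - alt_sum s g.
Proof. by elim: s f g => [|v s IH] f g //=; rewrite !IH; ring. Qed.

Lemma alt_sum_deg k s f : (k <= size s)%N -> deg_lt k f -> alt_sum s f = 0.
Proof.
have z0 s' g : deg_lt 0 g -> alt_sum s' g = 0.
  elim: s' g => [|v s' IH] g h /=; first exact: h.
  by rewrite !IH ?subr0 // => a; exact: h.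
elim: k s f => [|k IH] s f; first by move=> _; exact: z0.
case: s => // v s /= le h; rewrite -alt_sumB; apply: IH => //; exact: h.
Qed.

Lemma alt_sum0 s f b : (forall t, subseq t s -> f (b + \sum_(x <- t) x) = 0) ->
  alt_sum s (fun a => f (b + a)) = 0.
Proof.
elim: s b => [|v s IH] b h /=.
  by have := h [::] isT; rewrite big_nil.
rewrite IH; last by move=> t ts; apply: h; apply: subseq_trans ts (subseq_cons _ _).
rewrite (@alt_sum_ext _ _ (fun a => f ((b + v) + a))); last by move=> a; rewrite addrA addrAC.
rewrite IH ?subr0 // => t ts.
have := h (v :: t); rewrite /= eqxx big_cons addrA; exact.
Qed.

Lemma alt_sum_single s f b :
  (forall t, subseq t s -> (0 < size t)%N -> f (b + \sum_(x <- t) x) = 0) ->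
  alt_sum s (fun a => f (b + a)) = f b.
Proof.
elim: s b => [|v s IH] b h /=; first by rewrite addr0.
rewrite IH; last first.
  by move=> t ts; apply: h; apply: subseq_trans ts (subseq_cons _ _).
rewrite (@alt_sum_ext _ _ (fun a => f ((b + v) + a))); last by move=> a; rewrite addrA addrAC.
rewrite alt_sum0 ?subr0 // => t ts.
have := h (v :: t); rewrite /= eqxx big_cons addrA; exact.
Qed.

(** If no nonempty subsequence had sum [0], only the empty one would contribute to [alt_sum], which
    would equal [f 0 = 1]; but [alt_sum] vanishes as soon as [s] has at least [k] entries. *)
Lemma zero_sum_of_deg k s f : f 0 = 1 -> (forall a, a != 0 -> f a = 0) ->
  (k <= size s)%N -> deg_lt k f ->
  exists t, [/\ subseq t s, (0 < size t)%N & \sum_(x <- t) x = 0].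
Proof.
move=> f0 f1 le hd.
(* Ranging over the finitely many masks makes the existence decidable, which permits arguing by
   contradiction. *)
have [/existsP [b /and3P[b0 b1 /eqP b2]]|no] :=
  boolP [exists b : (size s).-tuple bool, [&& subseq (mask b s) s,
     (0 < size (mask b s))%N & \sum_(x <- mask b s) x == 0]].
  by exists (mask b s).
exfalso.
have : alt_sum s (fun a => f (0 + a)) = f 0.
  apply: alt_sum_single => t ts t0; rewrite add0r; apply: f1; apply/eqP => e.
  move: no => /negP; apply; apply/existsP.
  have /subseqP [b sb et] := ts.
  exists (tcast sb (in_tuple b)); rewrite val_tcast /= -et ts t0 /=; exact/eqP.
rewrite (@alt_sum_ext _ _ f) => [|a]; last by rewrite add0r.
rewrite (alt_sum_deg le hd) f0 => /esym/eqP; apply/negP; exact: oner_neq0.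
Qed.

End DifferenceOperators.

Section PrimeZeroSums.
Variables (p : nat) (p_pr : prime p).
Let Fp := 'F_p.

(** By Fermat's little theorem this is the indicator of [0], of degree [p - 1]. *)
Let ind (x : Fp) : Fp := 1 - x ^+ p.-1.

Let ind0 : ind 0 = 1.
Proof.
rewrite /ind expr0n (_ : (p.-1 == 0)%N = false) ?subr0 //.
by have := prime_gt1 p_pr; lia.
Qed.

Let ind1 (x : Fp) : x != 0 -> ind x = 0.
Proof.
move=> x0; apply/eqP; rewrite subr_eq0 eq_sym; apply/eqP.
have e : x ^+ p = x.
  by have := expf_card x; rewrite card_Fp.
apply: (mulfI x0); rewrite -exprS prednK ?prime_gt0 // e mulr1 //.
Qed.

Let deg_ind (A : zmodType) (f : {additive A -> Fp}) : deg_lt p (fun a => ind (f a)).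
Proof.
by have := deg_ltB1 (deg_ltX p.-1 (deg_lt_additive f)); rewrite mul1n prednK ?prime_gt0.
Qed.

(** The indicator of the origin is a product of two factors [ind], of degree [2 (p - 1)];
    [zero_sum_Fp3] has three factors. *)
Lemma zero_sum_Fp2 (s : seq (Fp * Fp)) : (2 * p - 1 <= size s)%N ->
  exists t, [/\ subseq t s, (0 < size t)%N & \sum_(x <- t) x = 0].
Proof.
have p0 := prime_gt0 p_pr.
move=> le; pose f (a : Fp * Fp) := ind a.1 * ind a.2.
apply: (@zero_sum_of_deg _ _ (2 * p - 1) s f) => //.
- by rewrite /f ind0 mulr1.
- move=> [a b]; rewrite /f /= xpair_eqE negb_and => /orP[] h.
    by rewrite ind1 // mul0r.
  by rewrite (ind1 h) mulr0.
- have := @deg_ltM _ _ p.-1 p.-1 (fun a : Fp * Fp => ind a.1) (fun a => ind a.2).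
  rewrite !prednK // (_ : (p.-1 + p.-1).+1 = 2 * p - 1)%N; last by lia.
  by apply; [exact: (deg_ind fst) | exact: (deg_ind snd)].
Qed.

Lemma zero_sum_Fp3 (s : seq (Fp * Fp * Fp)) : (3 * p - 2 <= size s)%N ->
  exists t, [/\ subseq t s, (0 < size t)%N & \sum_(x <- t) x = 0].
Proof.
have p0 := prime_gt0 p_pr.
move=> le; pose f (a : Fp * Fp * Fp) := ind a.1.1 * ind a.1.2 * ind a.2.
apply: (@zero_sum_of_deg _ _ (3 * p - 2) s f) => //.
- by rewrite /f ind0 !mulr1.
- move=> [[a b] c]; rewrite /f /= !xpair_eqE !negb_and => /orP[/orP[]|] h.
  + by rewrite (ind1 h) !mul0r.
  + by rewrite (ind1 h) mulr0 mul0r.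
  + by rewrite (ind1 h) mulr0.
- have h1 := @deg_ltM _ _ p.-1 p.-1 (fun a : Fp * Fp * Fp => ind a.1.1) (fun a => ind a.1.2).
  rewrite !prednK // in h1.
  have := @deg_ltM _ _ (p.-1 + p.-1) p.-1 (fun a : Fp * Fp * Fp => ind a.1.1 * ind a.1.2) (fun a => ind a.2).
  rewrite !prednK // (_ : (p.-1 + p.-1 + p.-1).+1 = 3 * p - 2)%N; last by lia.
  apply; last exact: (deg_ind snd).
  by apply: h1; [exact: (deg_ind (fst \o fst)) | exact: (deg_ind (snd \o fst))].
Qed.

End PrimeZeroSums.

(** * Short zero-sums in rank two: primes, then multiplicativity *)

Lemma natr_Fp_eq0 p k : prime p -> (k%:R == 0 :> 'F_p) = (p %| k)%N.
Proof. by move=> pp; rewrite -(dvdn_pcharf (pchar_Fp pp)). Qed.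

(** The coordinates are functions on an arbitrary [A] because the induction on [n] reuses the
    statements with blocks, elements of [seq A], in place of elements of [A]. *)
Definition zs2 (A : eqType) (f1 f2 : A -> nat) (n : nat) (T : seq A) : Prop :=
  [/\ (0 < size T)%N, (n %| \sum_(x <- T) f1 x)%N & (n %| \sum_(x <- T) f2 x)%N].

Section ZeroSumPairs.
Variables (A : eqType) (f1 f2 : A -> nat).
Local Notation zs := (zs2 f1 f2).

Lemma zs2_catr n T T' : zs n (T ++ T') -> zs n T -> (0 < size T')%N -> zs n T'.
Proof.
rewrite /zs2 !big_cat /= => -[_ h1 h2] [_ h3 h4] ->.
by move: h1 h2; rewrite !dvdn_addr.
Qed.

Lemma zs2_perm n T T' : perm_eq T T' -> zs n T -> zs n T'.
Proof. by move=> p []; rewrite /zs2 -!(perm_big _ p) -(perm_size p). Qed.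

Lemma davenport_prime p (s : seq A) : prime p -> (2 * p - 1 <= size s)%N ->
  exists T R, perm_eq s (T ++ R) /\ zs p T.
Proof.
move=> pp le; pose f (x : A) : 'F_p * 'F_p := ((f1 x)%:R, (f2 x)%:R).
have [|t [ts t0 e]] := @zero_sum_Fp2 p pp (map f s); first by rewrite size_map.
have [r pr] := perm_to_subseq ts.
have [T [R [pT eT _]]] := perm_map_cat_lift pr.
exists T, R; split=> //; split; first by rewrite -(size_map f) eT.
- have := congr1 fst e; rewrite -eT big_map raddf_sum /= => /eqP.
  by rewrite -natr_sum natr_Fp_eq0.
- have := congr1 snd e; rewrite -eT big_map raddf_sum /= => /eqP.
  by rewrite -natr_sum natr_Fp_eq0.
Qed.

(** A third coordinate equal to [1] makes the length of the zero-sum a multiple of [p]. Among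
    [3 p - 2] elements this length is [p] or [2 p], and a zero-sum of length [2 p] splits into two,
    one of them of length at most [p]. *)
Lemma eta_prime p (s : seq A) : prime p -> (3 * p - 2 <= size s)%N ->
  exists T R, [/\ perm_eq s (T ++ R), zs p T & (size T <= p)%N].
Proof.
move=> pp le; have p0 := prime_gt0 pp.
pose f (x : A) : 'F_p * 'F_p * 'F_p := ((f1 x)%:R, (f2 x)%:R, 1).
have [|t [ts t0 e]] := @zero_sum_Fp3 p pp (map f (take (3 * p - 2) s)).
  by rewrite size_map size_takel.
have [r pr] := perm_to_subseq ts.
have [T [R [pT eT _]]] := perm_map_cat_lift pr.
have {}pT : perm_eq s (T ++ (R ++ drop (3 * p - 2) s)).
  by rewrite -{1}(cat_take_drop (3 * p - 2) s) catA perm_cat2r.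
have zT : zs p T.
  split; first by rewrite -(size_map f) eT.
  - have := congr1 (fst \o fst) e; rewrite -eT big_map raddf_sum /= => /eqP.
    by rewrite -natr_sum natr_Fp_eq0.
  - have := congr1 (snd \o fst) e; rewrite -eT big_map raddf_sum /= => /eqP.
    by rewrite -natr_sum natr_Fp_eq0.
have dT : (p %| size T)%N.
  have := congr1 snd e; rewrite -eT big_map raddf_sum /= big_const_seq count_predT.
  by rewrite iter_addr_0 => /eqP; rewrite natr_Fp_eq0.
have sT : (size T <= 3 * p - 2)%N.
  rewrite -(size_map f) eT -(size_takel le) -(size_map f (take _ _)); exact: size_subseq ts.
have [q eq] := dvdnP dT.
have [le1|gt1] := leqP (size T) p; first by exists T, (R ++ drop (3 * p - 2) s).
have sT2 : size T = (2 * p)%N.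
  have q1 : (1 < q)%N by rewrite -(ltn_pmul2r p0) mul1n -eq.
  have q2 : (q < 3)%N by rewrite -(ltn_pmul2r p0) -eq; lia.
  by rewrite eq; congr muln; lia.
clear - pp p0 pT zT sT2.
(* Setting [x] aside guarantees that the zero-sum [T1], found among the other [2 p - 1] elements,
   has a nonempty complement. *)
case: T zT sT2 pT => [|x T] zT sT2 pT; first by case: zT.
have [|T1 [T2 [p12 z1]]] := @davenport_prime p T pp; first by move: sT2 => /=; lia.
have p12' : perm_eq (x :: T) (T1 ++ x :: T2) by clear pT; perm_count.
have z2 : zs p (x :: T2).
  by apply: (@zs2_catr p T1) => //; apply: zs2_perm zT.
have sz := perm_size p12'; rewrite size_cat in sz.
have [l1|l1] := leqP (size T1) p.
  by exists T1, ((x :: T2) ++ R ++ drop (3 * p - 2) s); split=> //; perm_count.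
by exists (x :: T2), (T1 ++ R ++ drop (3 * p - 2) s); split=> //; [perm_count | lia].
Qed.

End ZeroSumPairs.

Definition quot_sum (A : eqType) (f : A -> nat) (p : nat) (B : seq A) : nat :=
  ((\sum_(x <- B) f x) %/ p)%N.

Lemma zs2_flatten (A : eqType) (f1 f2 : A -> nat) p q (Bs : seq (seq A)) :
  (forall B, B \in Bs -> zs2 f1 f2 p B) ->
  zs2 (quot_sum f1 p) (quot_sum f2 p) q Bs -> zs2 f1 f2 (q * p) (flatten Bs).
Proof.
move=> h [s0 h1 h2]; split.
- case: Bs s0 h {h1 h2} => //= B Bs _ h; rewrite size_cat.
  by have [B0 _ _] := h B (mem_head _ _); rewrite addn_gt0 B0.
- rewrite big_flatten /= (_ : \sum_(B <- Bs) _ = (\sum_(B <- Bs) quot_sum f1 p B) * p)%N.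
    by rewrite dvdn_mul.
  rewrite big_distrl /= !big_seq; apply: eq_bigr => B BB.
  by have [_ d _] := h B BB; rewrite divnK.
- rewrite big_flatten /= (_ : \sum_(B <- Bs) _ = (\sum_(B <- Bs) quot_sum f2 p B) * p)%N.
    by rewrite dvdn_mul.
  rewrite big_distrl /= !big_seq; apply: eq_bigr => B BB.
  by have [_ _ d] := h B BB; rewrite divnK.
Qed.

(** For [n = q p], extract [3 q - 2] short blocks with sums divisible by [p] and apply the bound for
    [q] to the quotients of these sums. The lengths fit exactly:
    [(3 q - 3) p + 3 p - 2 = 3 n - 2]. *)
Lemma eta_rank2 n (A : eqType) (f1 f2 : A -> nat) (s : seq A) :
  (0 < n)%N -> (3 * n - 2 <= size s)%N ->
  exists T R, [/\ perm_eq s (T ++ R), zs2 f1 f2 n T & (size T <= n)%N].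
Proof.
elim/ltn_ind: n A f1 f2 s => n IH A f1 f2 s n0 le.
have [n1|n1] := leqP n 1.
  have {IH n1 n0} en : n = 1%N by lia.
  rewrite en in le *.
  by case: s le => [|x s] // _; exists [:: x], s; split=> //; split; rewrite ?dvd1n.
move: (pdiv_prime n1) (pdiv_dvd n); move: (pdiv n) => p pp /dvdnP [q eq].
have p1 := prime_gt1 pp.
have q0 : (0 < q)%N by case: q eq => //; lia.
have h := leq_pmull p q0; rewrite -eq in h.
have [|Bs [R [ps sB hB]]] := extract_blocks (fun s => @eta_prime _ f1 f2 p s pp) (j := (3 * q - 2)%N) (s := s).
  have -> : ((3 * q - 2) * p = 3 * n - 2 * p)%N by rewrite mulnBl -mulnA -eq.
  by lia.
have [||T [R' [pB zT sT]]] := @IH q _ _ (quot_sum f1 p) (quot_sum f2 p) Bs q0.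
- by rewrite eq ltn_Pmulr.
- by rewrite sB.
exists (flatten T), (R ++ flatten R'); split.
- have := perm_flatten pB; rewrite flatten_cat => pf; perm_count.
- rewrite eq; apply: zs2_flatten => // B BT.
  by have [] := hB B; rewrite // (perm_mem pB) mem_cat BT.
- rewrite eq mulnC; apply: leq_trans (_ : (p * size T <= _)%N); last by rewrite leq_mul.
  apply: size_flatten_le => B BT.
  by have [] := hB B; rewrite // (perm_mem pB) mem_cat BT.
Qed.

(** Here [2 q - 2] blocks are short; the remaining elements, at least [2 p - 1], yield one more
    block whose length does not matter, and [2 q - 1] blocks suffice for [q]. *)
Lemma davenport_rank2 n (A : eqType) (f1 f2 : A -> nat) (s : seq A) :
  (0 < n)%N -> (2 * n - 1 <= size s)%N ->
  exists T R, perm_eq s (T ++ R) /\ zs2 f1 f2 n T.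
Proof.
elim/ltn_ind: n A f1 f2 s => n IH A f1 f2 s n0 le.
have [n1|n1] := leqP n 1.
  have {IH n1 n0} en : n = 1%N by lia.
  rewrite en in le *.
  by case: s le => [|x s] // _; exists [:: x], s; split=> //; split; rewrite ?dvd1n.
move: (pdiv_prime n1) (pdiv_dvd n); move: (pdiv n) => p pp /dvdnP [q eq].
have p1 := prime_gt1 pp.
have q0 : (0 < q)%N by case: q eq => //; lia.
have h := leq_pmull p q0; rewrite -eq in h.
have [|Bs [R [ps sB hB]]] := extract_blocks (fun s => @eta_prime _ f1 f2 p s pp) (j := (2 * q - 2)%N) (s := s).
  have -> : ((2 * q - 2) * p = 2 * n - 2 * p)%N by rewrite mulnBl -mulnA -eq.
  by lia.
have szR : (2 * p - 1 <= size R)%N.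
  have := perm_size ps; rewrite size_cat.
  have := @size_flatten_le _ p Bs (fun B h => (hB B h).2).
  have -> : (p * size Bs = 2 * n - 2 * p)%N by rewrite sB mulnC mulnBl -mulnA -eq.
  by lia.
have [T0 [R0 [pR z0]]] := davenport_prime f1 f2 pp szR.
have {}ps : perm_eq s (R0 ++ flatten (T0 :: Bs)) by perm_count.
have hB' B : B \in T0 :: Bs -> zs2 f1 f2 p B.
  by rewrite in_cons => /orP[/eqP->//|/hB []].
have [||T [R' [pB zT]]] := @IH q _ _ (quot_sum f1 p) (quot_sum f2 p) (T0 :: Bs) q0.
- by rewrite eq ltn_Pmulr.
- by move: sB => /= ->; lia.
exists (flatten T), (R0 ++ flatten R'); split.
- by have := perm_flatten pB; rewrite flatten_cat => pf; clear pB; perm_count.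
- rewrite eq; apply: zs2_flatten => // B BT.
  by apply: hB'; rewrite (perm_mem pB) mem_cat BT.
Qed.

(** * Decomposition of an extremal sequence into blocks *)

Notation sg s := (\sum_(x <- s) x).

Definition zsfree (V : zmodType) (N : nat) (S : seq V) : Prop :=
  forall T R, perm_eq S (T ++ R) -> (0 < size T <= N)%N -> sg T <> 0.

Lemma zsfreeP (V : zmodType) N (S : seq V) : ~ in_sigma_le N S 0 <-> zsfree N S.
Proof.
split=> [h T R p /andP[T0 TN] e|h [b [b0 bN e]]].
  have /count_subseqP [s' ss' ps'] : forall x, (count_mem x T <= count_mem x S)%N.
    by move=> x; rewrite (permP p) count_cat leq_addr.
  have /subseqP [b _ eb] := ss'.
  by apply: h; exists b; rewrite -eb -(perm_size ps') -(perm_big _ ps').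
have [r p] := perm_to_subseq (mask_subseq b S).
by apply: (h _ _ p) => //; rewrite b0.
Qed.

Lemma sg_cat (V : zmodType) (s t : seq V) : sg (s ++ t) = sg s + sg t.
Proof. exact: big_cat. Qed.

Lemma sg_cons (V : zmodType) x (s : seq V) : sg (x :: s) = x + sg s.
Proof. exact: big_cons. Qed.

Lemma sg_perm (V : zmodType) (s t : seq V) : perm_eq s t -> sg s = sg t.
Proof. exact: perm_big. Qed.

Lemma sg_nseq (V : zmodType) n (x : V) : sg (nseq n x) = x *+ n.
Proof. by rewrite big_nseq -Monoid.iteropE. Qed.

(* Abstracts the reduction [C_n + C_(mn) -> C_n + C_n] modulo [n], whose kernel [<w>] is
   cyclic of order [m]; [red_eta] is the bound [eta(C_n + C_n) <= 3 n - 2]. *)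
Record reduction (V U : zmodType) (phi : {additive V -> U}) (n m : nat) (w : V) : Prop :=
  Reduction {
    red_n : (1 < n)%N;
    red_m : (1 < m)%N;
    red_ker : phi w = 0;
    red_kerE : forall v, phi v = 0 -> exists i, v = w *+ i;
    red_ord : forall i, (w *+ i == 0) = (m %| i)%N;
    red_exp : forall u : U, u *+ n = 0;
    red_indep : forall a b : U, generates a b ->
      forall i j, a *+ i + b *+ j = 0 -> (n %| i)%N /\ (n %| j)%N;
    red_eta : forall s : seq U, (3 * n - 2 <= size s)%N ->
      exists T R, [/\ perm_eq s (T ++ R), (0 < size T <= n)%N & sg T = 0]
  }.

Section Reduction.
Variables (V U : zmodType) (phi : {additive V -> U}) (n m : nat) (w : V).
Hypothesis red : reduction phi n m w.
Let n1 := red_n red.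
Let m1 := red_m red.
Let w_ker := red_ker red.
Let kerE := red_kerE red.
Let w_ord := red_ord red.
Let U_eta := red_eta red.

Definition ker_gen (g : V) : Prop :=
  [/\ phi g = 0, forall i, (g *+ i == 0) = (m %| i)%N
    & forall v, phi v = 0 -> exists i, v = g *+ i].

Lemma ker_lift (s : seq V) : (forall v, v \in s -> phi v = 0) ->
  exists ks : seq nat, s = [seq w *+ i | i <- ks].
Proof.
elim: s => [|v s IH] h; first by exists [::].
have [|ks ->] := IH; first by move=> u us; apply: h; rewrite in_cons us orbT.
have [i ->] := kerE (h v (mem_head _ _)).
by exists (i :: ks).
Qed.

Lemma sum_mulrn_w (ks : seq nat) : sg [seq w *+ i | i <- ks] = w *+ sumn ks.
Proof. by elim: ks => [|a ks IH] /=; rewrite ?big_nil // big_cons IH mulrnDr. Qed.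

Lemma ker_zsfree_lift (ks : seq nat) :
  (forall T R, perm_eq [seq w *+ i | i <- ks] (T ++ R) -> (0 < size T)%N -> sg T <> 0) ->
  nat_zsfree m ks.
Proof.
move=> h t r p t0; rewrite -w_ord -sum_mulrn_w; apply/eqP.
apply: (h _ [seq w *+ i | i <- r]); last by rewrite size_map.
by rewrite -map_cat; apply: perm_map.
Qed.

Lemma ker_zsfree_size (s : seq V) : (forall v, v \in s -> phi v = 0) ->
  (forall T R, perm_eq s (T ++ R) -> (0 < size T)%N -> sg T <> 0) -> (size s < m)%N.
Proof.
move=> /ker_lift [ks ->] /ker_zsfree_lift h; rewrite size_map.
by apply: nat_zsfree_small => //; apply: ltnW.
Qed.

(** By [nat_zsfree_congr] all elements equal one [k0 w]. The multiples [j k0] with [0 < j < m] are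
    subsequence sums, hence nonzero modulo [m]; so [k0] is invertible modulo [m] and [k0 w]
    generates the kernel. *)
Lemma ker_zsfree_const (s : seq V) : (forall v, v \in s -> phi v = 0) ->
  size s = m.-1 ->
  (forall T R, perm_eq s (T ++ R) -> (0 < size T)%N -> sg T <> 0) ->
  exists2 g, ker_gen g & forall v, v \in s -> v = g.
Proof.
have m0 := ltnW m1.
move=> /ker_lift [ks ->]; rewrite size_map => sz /ker_zsfree_lift h.
have mod_w i j : i = j %[mod m] -> w *+ i = w *+ j.
  have wm l : w *+ l = w *+ (l %% m).
    rewrite {1}(divn_eq l m) mulrnDr.
    have /eqP -> : w *+ (l %/ m * m) == 0 by rewrite w_ord dvdn_mull.
    by rewrite add0r.
  by move=> e; rewrite (wm i) (wm j) e.
have [k0 k0s] : exists k0, k0 \in ks.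
  by case: ks sz {h} => [|x ks] /= sz; [lia | exists x; rewrite mem_head].
have cong x : x \in ks -> x = k0 %[mod m] by move=> xs; exact: nat_zsfree_congr h sz xs k0s.
have reg i : (m %| k0 * i)%N -> (m %| i)%N.
  move=> d; apply/eqP; apply: contraTeq d => i0.
  have j0 : (0 < i %% m < m)%N by rewrite lt0n i0 ltn_pmod.
  set j := (i %% m)%N in j0; have jk : (j <= size ks)%N by rewrite sz; lia.
  have := h (take j ks) (drop j ks) _; rewrite cat_take_drop size_takel // perm_refl.
  move=> /(_ isT (proj1 (andP j0))).
  suff : sumn (take j ks) = k0 * i %[mod m] by rewrite /dvdn => ->.
  have -> : (k0 * i = k0 * j %[mod m])%N by rewrite /j modnMmr.
  have : forall x, x \in take j ks -> x = k0 %[mod m] by move=> x /mem_take; exact: cong.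
  rewrite (_ : k0 * j = k0 * size (take j ks))%N; last by rewrite size_takel.
  elim: (take j ks) => [|x l IH] hx /=; first by rewrite muln0.
  rewrite mulnS -modnDm (hx x (mem_head _ _)) IH ?modnDm // => y yl.
  by apply: hx; rewrite in_cons yl orbT.
exists (w *+ k0); last by move=> v /mapP [x xs ->]; apply: mod_w; apply: cong.
split; first by rewrite raddfMn w_ker mul0rn.
  move=> i; rewrite -mulrnA w_ord; apply/idP/idP; first exact: reg.
  by move=> d; rewrite dvdn_mull.
move=> v /kerE [l ->].
have k00 : (0 < k0)%N.
  by rewrite lt0n; apply/eqP => e; have := reg 1%N; rewrite e mul0n dvdn0 => /(_ isT); rewrite dvdn1; lia.
have cop : coprime k0 m.
  rewrite /coprime; set d := gcdn k0 m.
  have d0 : (0 < d)%N by rewrite gcdn_gt0 k00.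
  have dm : (d %| m)%N := dvdn_gcdr _ _; have dk : (d %| k0)%N := dvdn_gcdl _ _.
  have : (m %| m %/ d)%N.
    apply: reg; rewrite muln_divA // -divn_mulAC // dvdn_mull //.
  move/dvdn_leq; rewrite divn_gt0 // (dvdn_leq m0 dm) => /(_ isT) le.
  rewrite eqn_leq d0 andbT leqNgt; apply/negP => d1.
  have := ltn_Pdiv d1 m0; lia.
have /(coprimeP _ k00) [[a b] /= e] := cop.
exists (a * l)%N; rewrite -mulrnA; apply: mod_w.
have -> : (k0 * (a * l) = l + b * l * m)%N.
  rewrite mulnA [(k0 * a)%N]mulnC (_ : (a * k0 = 1 + b * m)%N); last by lia.
  by rewrite mulnDl mul1n mulnAC.
by rewrite addnC modnMDl.
Qed.

(** For [m = 2] a decomposition has a single block, so sums cannot be compared through another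
    block; the uniqueness of the generator replaces that comparison. *)
Lemma ker_gen_uniq2 g g' : m = 2%N -> ker_gen g -> ker_gen g' -> g = g'.
Proof.
move=> em [_ h1 h2] [h3 h4 _]; have [i e] := h2 _ h3.
have g2 : g *+ 2 = 0 by apply/eqP; rewrite h1 em.
have ei : g *+ i = g *+ odd i.
  by rewrite -{1}(odd_double_half i) mulrnDr -muln2 mulnC mulrnA g2 mul0rn addr0.
have := h4 1%N; rewrite mulr1n em e ei; case: (odd i) => //.
by rewrite mulr0n eqxx.
Qed.

Lemma phi_sg (T : seq V) : phi (sg T) = sg (map phi T).
Proof. by rewrite raddf_sum big_map. Qed.

Lemma eta_lift (s : seq V) : (3 * n - 2 <= size s)%N ->
  exists T R, [/\ perm_eq s (T ++ R), (0 < size T)%N /\ phi (sg T) = 0 & (size T <= n)%N].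
Proof.
rewrite -(size_map phi) => /U_eta [t [r [p /andP[t0 tn] e]]].
have [T [R [pT eT _]]] := perm_map_cat_lift p.
exists T, R; rewrite -(size_map phi T) eT t0 tn; split=> //; split=> //.
by rewrite phi_sg eT.
Qed.

Lemma blocks_zsfree N (S R : seq V) Bs : zsfree N S -> perm_eq S (R ++ flatten Bs) ->
  (forall B, B \in Bs -> (0 < size B)%N) -> (size (flatten Bs) <= N)%N ->
  forall T' R', perm_eq [seq sg B | B : seq V <- Bs] (T' ++ R') -> (0 < size T')%N -> sg T' <> 0.
Proof.
move=> hS p hB hN T' R' /perm_map_cat_lift [Ts [Rs [pB eT _]]].
rewrite -eT size_map big_map -big_flatten /= => T0.
have pf : perm_eq (flatten Bs) (flatten Ts ++ flatten Rs).
  by rewrite -flatten_cat; apply: perm_flatten.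
apply: (hS _ (R ++ flatten Rs)); first by clear pB; perm_count.
have := perm_size pf; rewrite size_cat => e; apply/andP; split; last by slia.
case: Ts T0 pB {pf e eT} => // B Ts _ pB; rewrite /= size_cat addn_gt0 hB //.
by rewrite (perm_mem pB) mem_head.
Qed.

Lemma size_flatten_eq (A : eqType) (Bs : seq (seq A)) :
  (forall B, B \in Bs -> (size B <= n)%N) -> (n * size Bs <= size (flatten Bs))%N ->
  forall B, B \in Bs -> size B = n.
Proof.
elim: Bs => [|B Bs IH] // h; rewrite /= size_cat mulnS => le C.
have hB := h B (mem_head _ _).
have h' D : D \in Bs -> (size D <= n)%N by move=> DB; apply: h; rewrite in_cons DB orbT.
have := size_flatten_le h' => le2.
rewrite in_cons => /orP[/eqP->|]; first by lia.
by apply: IH => //; lia.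
Qed.

(** * Decompositions of extremal sequences and exchanges *)

Section FixK.
Variable k : nat.
Hypothesis hk : (0 < k < n)%N.
Hypothesis U_bound : forall s : seq U, zsfree (2 * n - 1 - k) s -> (size s < 2 * n - 1 + k)%N.

Definition extremal (S : seq V) : Prop :=
  size S = (m * n + n - 2 + k)%N /\ zsfree (m * n + n - 1 - k) S.

Definition dec (S W : seq V) (Bs : seq (seq V)) : Prop :=
  [/\ perm_eq S (W ++ flatten Bs), size Bs = m.-1,
      forall B, B \in Bs -> size B = n /\ phi (sg B) = 0,
      size W = (2 * n - 2 + k)%N & zsfree (2 * n - 1 - k) (map phi W)].

(** [X] stays in the remainder and [Bs0] among the blocks. A zero-sum of [phi(X ++ W')] of length at
    most [2 n - 1 - k] would, together with the [m - 1] blocks, give [m] kernel elements forming a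
    zero-sum free sequence, which is impossible. Then [U_bound] limits the remainder, which leaves
    no room for a block shorter than [n]. *)
Lemma extend_dec S X R Bs0 : extremal S -> perm_eq S (X ++ R ++ flatten Bs0) ->
  (size X <= k)%N -> (size Bs0 <= m.-1)%N ->
  (forall B, B \in Bs0 -> [/\ (0 < size B)%N, (size B <= n)%N & phi (sg B) = 0]) ->
  exists W' Bs, perm_eq R (W' ++ flatten Bs) /\ dec S (X ++ W') (Bs ++ Bs0).
Proof.
move=> [szS zS] pS szX szB hB0.
have mn : (m * n = m.-1 * n + n)%N by rewrite -{1}(prednK (ltnW m1)) mulSn addnC.
have pz := perm_size pS; rewrite !size_cat in pz.
have fl0 := @size_flatten_le _ n Bs0 (fun B h => let: And3 _ l _ := hB0 B h in l).
pose j := (m.-1 - size Bs0)%N.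
have jn : (j * n + n * size Bs0 = m.-1 * n)%N.
  by rewrite mulnC -mulnDr subnK // mulnC.
have [|Bs [W' [pR sB hB]]] := extract_blocks eta_lift (j := j) (s := R).
  by slia.
exists W', Bs; split=> //.
have hall B : B \in Bs ++ Bs0 -> [/\ (0 < size B)%N, (size B <= n)%N & phi (sg B) = 0].
  by rewrite mem_cat => /orP[/hB [[? ?] ?]|/hB0].
have szall : size (Bs ++ Bs0) = m.-1 by rewrite size_cat sB subnK.
have pall : perm_eq S ((X ++ W') ++ flatten (Bs ++ Bs0)) by perm_count.
have fl := @size_flatten_le _ n (Bs ++ Bs0) (fun B h => let: And3 _ l _ := hall B h in l).
rewrite szall in fl.
have zW : zsfree (2 * n - 1 - k) (map phi (X ++ W')).
  move=> t r /perm_map_cat_lift [T [Rt [pT eT _]]] /andP[t0 tN] et.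
  have e1 : size T = size t by rewrite -eT size_map.
  suff : (size [seq sg B | B : seq V <- T :: (Bs ++ Bs0)] < m)%N.
    by rewrite size_map /= szall; lia.
  apply: ker_zsfree_size.
    move=> v /mapP [B]; rewrite in_cons => /orP[/eqP-> ->|/hall [_ _ ?] -> //].
    by rewrite phi_sg eT.
  apply: (@blocks_zsfree _ S Rt _ zS).
  - by perm_count.
  - by move=> B; rewrite in_cons => /orP[/eqP->|/hall []//]; rewrite e1.
  - by rewrite /= size_cat; slia.
have bW := U_bound zW; rewrite size_map in bW.
have pz2 := perm_size pall; rewrite size_cat in pz2.
have szW : size (X ++ W') = (2 * n - 2 + k)%N by slia.
split=> //.
have hn : forall B, B \in Bs ++ Bs0 -> size B = n.
  by apply: size_flatten_eq => [B /hall []//|]; rewrite szall; slia.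
by move=> B BB; have [_ _ ?] := hall B BB; split=> //; exact: hn.
Qed.

Lemma dec_exists S : extremal S -> exists W Bs, dec S W Bs.
Proof.
move=> hS.
have p0 : perm_eq S ([::] ++ S ++ flatten [::]) by rewrite cats0.
have [//|//|//|W [Bs [_ d]]] := extend_dec hS p0.
by exists W, (Bs ++ [::]).
Qed.

(** [T] and the [m - 2] blocks have total length at most [m n + n - 1 - k], so their sums form a
    zero-sum free sequence of [m - 1] kernel elements and [ker_zsfree_const] applies. *)
Lemma swap_sums S T R Bs : extremal S -> perm_eq S (T ++ R ++ flatten Bs) ->
  size Bs = m.-2 -> (forall B, B \in Bs -> size B = n /\ phi (sg B) = 0) ->
  (0 < size T <= 3 * n - 1 - k)%N -> phi (sg T) = 0 ->
  ker_gen (sg T) /\ forall B, B \in Bs -> sg B = sg T.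
Proof.
move=> [szS zS] pS sB hB hT zT.
have mn : (m * n = n * m.-2 + 2 * n)%N by rewrite mulnC -{1}(subnK m1) mulnDr -subn2 [(2 * n)%N]mulnC.
have [|||g gg hg] := @ker_zsfree_const [seq sg B | B : seq V <- T :: Bs].
- by move=> v /mapP [B]; rewrite in_cons => /orP[/eqP-> -> //|/hB [_ ?] -> //].
- by rewrite size_map /= sB; lia.
- apply: (@blocks_zsfree _ S R _ zS).
  + by perm_count.
  + move=> B; rewrite in_cons => /orP[/eqP->|/hB [-> _]]; lia.
  + rewrite /= size_cat.
    have := size_flatten_const (fun B h => (hB B h).1); rewrite sB => ->.
    by slia.
have eg : sg T = g by apply: hg; rewrite /= mem_head.
rewrite eg; split=> // B BB; apply: hg.
by rewrite /= in_cons (map_f _ BB) orbT.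
Qed.

Lemma dec_gen S W Bs B : extremal S -> dec S W Bs -> B \in Bs -> ker_gen (sg B).
Proof.
move=> hS [pS sB hB szW zW] BB; have [Bs' pB] := mem_perm_cons BB.
have hB' C : C \in B :: Bs' -> size C = n /\ phi (sg C) = 0.
  by rewrite -(perm_mem pB); exact: hB.
have [sn zn] := hB _ BB; have pf := perm_flatten pB.
have [] // := @swap_sums S B W Bs' hS.
- by clear pB; perm_count.
- by have := perm_size pB; rewrite sB /=; lia.
- by move=> C CB; apply: hB'; rewrite in_cons CB orbT.
- by rewrite sn; lia.
Qed.

(** Both [T] and [B] complete the other [m - 2] blocks to a family with constant sums, so any of
    these blocks compares the two. *)
Lemma dec_exchange S W Bs B T R : extremal S -> dec S W Bs -> B \in Bs ->
  perm_eq (W ++ B) (T ++ R) -> (0 < size T <= 3 * n - 1 - k)%N -> phi (sg T) = 0 ->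
  sg T = sg B.
Proof.
move=> hS d BB pT hT zT; have gB := dec_gen hS d BB.
case: d => pS sB hB szW zW; have [Bs' pB] := mem_perm_cons BB.
have hB' C : C \in B :: Bs' -> size C = n /\ phi (sg C) = 0.
  by rewrite -(perm_mem pB); exact: hB.
have [sn zn] := hB _ BB; have pf := perm_flatten pB.
have sB' : size Bs' = m.-2 by have := perm_size pB; rewrite sB /=; lia.
have hB2 C : C \in Bs' -> size C = n /\ phi (sg C) = 0.
  by move=> CB; apply: hB'; rewrite in_cons CB orbT.
have [g1 h1] : ker_gen (sg T) /\ forall B, B \in Bs' -> sg B = sg T.
  by apply: (@swap_sums S T R) => //; clear pB; perm_count.
have [g2 h2] : ker_gen (sg B) /\ forall C, C \in Bs' -> sg C = sg B.
  apply: (@swap_sums S B W) => //; first by clear pB pT; perm_count.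
  by rewrite sn; lia.
case: Bs' sB' h1 h2 {pB hB' pf hB2} => [|C Bs'] sB' h1 h2.
  by apply: ker_gen_uniq2 => //; move: sB' => /=; lia.
by rewrite -(h1 C) ?(h2 C) ?mem_head.
Qed.

Lemma dec_sum_eq S W Bs B B' : extremal S -> dec S W Bs -> B \in Bs -> B' \in Bs ->
  sg B = sg B'.
Proof.
move=> hS d BB BB'; have [->//|ne] := eqVneq B B'.
case: (d) => pS sB hB szW zW; have [Bs' pB] := mem_perm_cons BB.
have [sn zn] := hB _ BB; have pf := perm_flatten pB.
have B'B : B' \in Bs' by move: BB'; rewrite (perm_mem pB) in_cons eq_sym (negbTE ne).
have [_ h] : ker_gen (sg B) /\ forall C, C \in Bs' -> sg C = sg B.
  apply: (@swap_sums S B W) => //.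
  - by clear pB; perm_count.
  - by have := perm_size pB; rewrite sB /=; lia.
  - by move=> C CB; apply: hB; rewrite (perm_mem pB) in_cons CB orbT.
  - by rewrite sn; lia.
by rewrite h.
Qed.

(** Redistributes [W] and [B] with the other blocks fixed, so that up to [k] chosen elements end up
    in the new remainder. *)
Lemma dec_rebuild S W Bs B X Y : extremal S -> dec S W Bs -> B \in Bs ->
  perm_eq (W ++ B) (X ++ Y) -> (size X <= k)%N ->
  exists W' B', [/\ perm_eq Y (W' ++ B'), size B' = n, phi (sg B') = 0,
    size (X ++ W') = (2 * n - 2 + k)%N & zsfree (2 * n - 1 - k) (map phi (X ++ W'))].
Proof.
move=> hS [pS sB hB szW zW] BB pX szX; have [Bs' pB] := mem_perm_cons BB.
have [sn zn] := hB _ BB; have pf := perm_flatten pB.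
have sB' : size Bs' = m.-2 by have := perm_size pB; rewrite sB /=; lia.
have hB2 C : C \in Bs' -> size C = n /\ phi (sg C) = 0.
  by move=> CB; apply: hB; rewrite (perm_mem pB) in_cons CB orbT.
have p0 : perm_eq S (X ++ Y ++ flatten Bs') by clear pB; perm_count.
have [||W' [Bs2 [pY [_ s2 h2 h3 h4]]]] := extend_dec hS p0 szX.
- by rewrite sB'; lia.
- by move=> C /hB2 [-> ->]; split=> //; lia.
have e1 : size Bs2 = 1%N by move: s2; rewrite size_cat sB'; slia.
case: Bs2 e1 pY h2 {s2} => [|B' [|]] //= _ pY h2.
have [h5 h6] := h2 _ (mem_head _ _).
by exists W', B'; split=> //; rewrite cats0 in pY.
Qed.

(* Every short block already has length [n]: otherwise it starts a decomposition
   whose remainder is too long. *)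
Lemma dec_no_short S W Bs B T R : extremal S -> dec S W Bs -> B \in Bs ->
  perm_eq (W ++ B) (T ++ R) -> (0 < size T <= n)%N -> phi (sg T) = 0 -> size T = n.
Proof.
move=> hS [pS sB hB szW zW] BB pT hT zT; have [Bs' pB] := mem_perm_cons BB.
have pf := perm_flatten pB.
have sB' : size Bs' = m.-2 by have := perm_size pB; rewrite sB /=; lia.
have hB2 C : C \in T :: Bs' -> [/\ (0 < size C)%N, (size C <= n)%N & phi (sg C) = 0].
  rewrite in_cons => /orP[/eqP->|CB]; first by split=> //; lia.
  by have [-> ->] : size C = n /\ phi (sg C) = 0; [apply: hB; rewrite (perm_mem pB) in_cons CB orbT | split=> //; lia].
have p0 : perm_eq S ([::] ++ R ++ flatten (T :: Bs')) by clear pB; perm_count.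
have [//||//|W' [Bs2 [_ [_ _ h2 _ _]]]] := extend_dec hS p0.
- by rewrite /= sB'; lia.
- by have [] := h2 T; rewrite // mem_cat mem_head orbT.
Qed.

(** Replacing [v] by [u] in [B] keeps the image of the sum, hence by [dec_exchange] the sum
    itself. *)
Lemma dec_swap S W Bs B u v : extremal S -> dec S W Bs -> B \in Bs ->
  u \in W -> v \in B -> phi u = phi v -> u = v.
Proof.
move=> hS d BB /mem_perm_cons [W1 pW] /mem_perm_cons [B1 pB] e.
case: (d) => _ _ /(_ _ BB) [sB zB] _ _.
have sB1 := perm_size pB; rewrite sB /= in sB1.
have := @dec_exchange S W Bs B (u :: B1) (v :: W1) hS d BB.
rewrite (perm_big _ pB) /= !big_cons => /(_ _ _ _)/addIr; apply.
- by perm_count.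
- by lia.
- move: zB; rewrite (perm_big _ pB) big_cons !raddfD /= e => ->.
  by [].
Qed.

End FixK.
End Reduction.

(** * The case [k >= 2] *)

Definition tri (A : eqType) (n k : nat) (a b c : A) : seq A :=
  nseq n.-1 a ++ nseq n.-1 b ++ nseq k c.

Lemma mem_tri (A : eqType) n k (a b c y : A) : y \in tri n k a b c -> y \in [:: a; b; c].
Proof.
by rewrite !mem_cat !mem_nseq !inE => /or3P[] /andP[_ ->]; rewrite ?orbT.
Qed.

Lemma count_tri (A : eqType) n k (a b c : A) P :
  count P (tri n k a b c) = (P a * n.-1 + (P b * n.-1 + P c * k))%N.
Proof. by rewrite !count_cat !count_nseq. Qed.

Lemma perm_nseq3 (A : eqType) (a b c : A) (s : seq A) :
  uniq [:: a; b; c] -> {subset s <= [:: a; b; c]} ->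
  exists i j l, [/\ perm_eq s (nseq i a ++ nseq j b ++ nseq l c) & size s = (i + (j + l))%N].
Proof.
move=> ua sub; exists (count_mem a s), (count_mem b s), (count_mem c s).
have p : perm_eq s (nseq (count_mem a s) a ++ nseq (count_mem b s) b ++ nseq (count_mem c s) c).
  elim: s sub => [|y s IH] sub //=.
  have {}IH := IH (fun z zs => sub z (@mem_behead _ (y :: s) z zs)).
  have := sub y (mem_head _ _); move: ua; rewrite /= !inE !negb_or andbT.
  case/andP=> /andP[ab ac] bc /or3P[] /eqP ->; rewrite ?eqxx /=.
  - by rewrite (negbTE ab) (negbTE ac) perm_cons.
  - by rewrite [b == a]eq_sym (negbTE ab) (negbTE bc) !add0n; perm_count.
  - by rewrite [c == a]eq_sym [c == b]eq_sym (negbTE ac) (negbTE bc) !add0n; perm_count.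
by split=> //; rewrite {1}(perm_size p) !size_cat !size_nseq.
Qed.

Lemma count_mem2_le (A : eqType) (u v : A) (s : seq A) : u != v ->
  (count_mem u s + count_mem v s <= size s)%N.
Proof.
move=> uv; elim: s => [|y s IH] //=; have [->|yu] := eqVneq y u.
  by rewrite (negbTE uv); lia.
by case: (y == v) => /=; lia.
Qed.

(** Two subsequences of length [r] that differ only in [u] and [v] have equal sums. *)
Lemma const_of_subsums (V : zmodType) (L : seq V) (r : nat) (g : V) :
  (0 < r < size L)%N ->
  (forall T R, perm_eq L (T ++ R) -> size T = r -> sg T = g) ->
  forall u v, u \in L -> v \in L -> u = v.
Proof.
move=> hr h u v uL vL; have [->//|ne] := eqVneq u v.
have [L1 p1] := mem_perm_cons uL.
have : v \in L1 by move: vL; rewrite (perm_mem p1) in_cons eq_sym (negbTE ne).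
case/mem_perm_cons => L2 p2.
have s1 := perm_size p1; have s2 := perm_size p2; rewrite /= in s1 s2.
have pt : perm_eq L2 (take r.-1 L2 ++ drop r.-1 L2) by rewrite cat_take_drop.
have st : size (take r.-1 L2) = r.-1 by rewrite size_takel //; slia.
have e1 : sg (u :: take r.-1 L2) = g.
  by apply: (h _ (v :: drop r.-1 L2)); [perm_count | rewrite /= st; slia].
have e2 : sg (v :: take r.-1 L2) = g.
  by apply: (h _ (u :: drop r.-1 L2)); [perm_count | rewrite /= st; slia].
by move: e1; rewrite -e2 !big_cons => /addIr.
Qed.

Lemma perm_take (A : eqType) (s : seq A) r : perm_eq s (take r s ++ drop r s).
Proof. by rewrite cat_take_drop. Qed.

Lemma gather_nseq3 (A : eqType) n (E F H : A) (Bs : seq (seq A)) :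
  {subset Bs <= [:: nseq n E; nseq n F; nseq n H]} ->
  exists a1 a2 a3, [/\ (a1 + a2 + a3 = size Bs)%N,
    perm_eq (flatten Bs) (nseq (n * a1) E ++ nseq (n * a2) F ++ nseq (n * a3) H),
    (0 < a1)%N -> nseq n E \in Bs, (0 < a2)%N -> nseq n F \in Bs
    & (0 < a3)%N -> nseq n H \in Bs].
Proof.
elim: Bs => [|B Bs IH] sub.
  by exists 0%N, 0%N, 0%N; rewrite muln0.
have [a1 [a2 [a3 [sz p m1 m2 m3]]]] := IH (fun z zs => sub z (@mem_behead _ (B :: Bs) z zs)).
have := sub B (mem_head _ _); rewrite !inE => /or3P[] /eqP ->.
- exists a1.+1, a2, a3; split; rewrite /= ?inE; first by rewrite -sz.
  + by rewrite mulnS nseqD; perm_count.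
  + by rewrite eqxx.
  + by move/m2=> ->; rewrite orbT.
  + by move/m3=> ->; rewrite orbT.
- exists a1, a2.+1, a3; split; rewrite /= ?inE; first by rewrite -sz addnS.
  + by rewrite mulnS nseqD; perm_count.
  + by move/m1=> ->; rewrite orbT.
  + by rewrite eqxx.
  + by move/m3=> ->; rewrite orbT.
- exists a1, a2, a3.+1; split; rewrite /= ?inE; first by rewrite -sz addnS.
  + by rewrite mulnS nseqD; perm_count.
  + by move/m1=> ->; rewrite orbT.
  + by move/m2=> ->; rewrite orbT.
  + by rewrite eqxx.
Qed.

Lemma nseq_of_same (A : eqType) (s : seq A) : (0 < size s)%N ->
  (forall u v, u \in s -> v \in s -> u = v) -> exists E, s = nseq (size s) E.
Proof.
case: s => // E s _ h; exists E; apply: nseq_of_all => // y ys.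
by apply: h => //; exact: mem_head.
Qed.

Section Triples.
Variables (V U : zmodType) (phi : {additive V -> U}) (n m : nat) (w : V).
Hypothesis red : reduction phi n m w.
Let n1 := red_n red.
Let m1 := red_m red.
Let Un := red_exp red.
Let indep := red_indep red.
Variable k : nat.
Hypothesis hk : (0 < k < n)%N.

(** The common shape of items 3(a) and 4(a) for [m = 1]; only for [k = n - 1] may [x] differ from
    [1]. *)
Definition tri_form (s : seq U) : Prop :=
  exists a b x, [/\ generates a b, (0 < x < n)%N, coprime x n,
     (k < n.-1)%N -> x = 1%N & perm_eq s (tri n k a b (a *+ x + b))].

Lemma opp_mulrn_pred (u : U) : u *+ n.-1 = - u.
Proof. by apply/eqP; rewrite -addr_eq0 addrC -mulrS prednK ?Un // ltnW. Qed.

Lemma generates_mulrn0 (a b : U) i : generates a b -> b *+ i = 0 -> (n %| i)%N.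
Proof.
move=> gab e; have [] := indep gab (i := 0%N) (j := i); last by [].
by rewrite mulr0n add0r.
Qed.

Lemma generatesC (A : zmodType) (a b : A) : generates a b -> generates b a.
Proof. by move=> h u; have [i [j ->]] := h u; exists j, i; rewrite addrC. Qed.

Lemma tri_uniq (a b : U) x : generates a b -> (0 < x < n)%N -> uniq [:: a; b; a *+ x + b].
Proof.
move=> gab hx; rewrite /= !inE !negb_or andbT.
have ab i j : a *+ i + b *+ j = 0 -> (n %| i)%N /\ (n %| j)%N := indep gab (i := i) (j := j).
have nd i : (0 < i < n)%N -> (n %| i)%N = false.
  by move=> hi; apply/negbTE; rewrite gtnNdvd //; lia.
apply/andP; split; first (apply/andP; split).
- apply/eqP => e; have [] := ab 1%N n.-1; rewrite ?opp_mulrn_pred ?e ?subrr //.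
  by rewrite nd //; lia.
- apply/eqP => e; have [] := ab (x + n.-1)%N 1%N.
    by rewrite mulrnDr opp_mulrn_pred addrAC mulr1n -e subrr.
  by move=> _; rewrite nd //; lia.
- apply/eqP => e; have [] := ab x 0%N.
    by rewrite mulr0n addr0; apply: (addIr b); rewrite add0r -e.
  by rewrite nd //.
Qed.

Lemma sum_tri a b c : sg (tri n k a b c) = c *+ k - a - b :> U.
Proof. by rewrite !big_cat /= !sg_nseq !opp_mulrn_pred addrC [- b + _]addrC addrAC. Qed.

Section Bound.
Hypothesis k2 : (1 < k)%N.
Hypothesis H_tri : forall s : seq U, size s = (2 * n - 2 + k)%N ->
  zsfree (2 * n - 1 - k) s -> tri_form s.

(** Suppose there is one element [y] too many. If [y] is [a], [b] or [c], its additional copy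
    completes a short zero-sum. Otherwise replace one [c] by [y]: since [k > 1] another [c] remains,
    and the four values [y], [a], [b], [c] contradict [H_tri]. *)
Lemma tri_bound (s : seq U) : zsfree (2 * n - 1 - k) s -> (size s < 2 * n - 1 + k)%N.
Proof.
move=> zs; rewrite ltnNge; apply/negP => le.
case: s zs le => [|y s0] zs le; first by move: le => /=; lia.
pose s := take (2 * n - 2 + k) s0.
have ss : size s = (2 * n - 2 + k)%N by rewrite size_takel //; move: le => /=; lia.
have {}zs : zsfree (2 * n - 1 - k) (y :: s).
  move=> T R p; apply: (zs T (R ++ drop (2 * n - 2 + k) s0)).
  by have pt := perm_take s0 (2 * n - 2 + k); rewrite -/s in pt; perm_count.
have zs' : zsfree (2 * n - 1 - k) s.
  by move=> T R p; apply: (zs T (y :: R)); perm_count.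
have [a [b [x [gab hx cx x1 p]]]] := H_tri ss zs'.
set c := a *+ x + b in p.
have full T R : perm_eq (y :: tri n k a b c) (T ++ R) -> (0 < size T <= 2 * n - 1 - k)%N -> sg T <> 0.
  by move=> p'; apply: (zs T R); perm_count.
have nseqS (u : U) : nseq n u = u :: nseq n.-1 u by rewrite -{1}(prednK (ltnW n1)).
have [ya|nya] := eqVneq y a.
  apply: (full (nseq n a) (nseq n.-1 b ++ nseq k c)); rewrite ?size_nseq ?sg_nseq ?Un //; last by lia.
  by rewrite ya nseqS /tri; perm_count.
have [yb|nyb] := eqVneq y b.
  apply: (full (nseq n b) (nseq n.-1 a ++ nseq k c)); rewrite ?size_nseq ?sg_nseq ?Un //; last by lia.
  by rewrite yb nseqS /tri; perm_count.
have [yc|nyc] := eqVneq y c.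
  (* For [c = a + b], the [k + 1] copies of [c] are completed by [n - k - 1] copies of [a] and of
     [b], of total length [2 n - 1 - k]; for [k = n - 1] only [n] copies of [c] are left. *)
  apply: (full (nseq k.+1 c ++ nseq (n - k.+1) a ++ nseq (n - k.+1) b) (nseq k a ++ nseq k b)).
  - rewrite yc /tri.
    have -> : n.-1 = (n - k.+1 + k)%N by lia.
    rewrite !nseqD /=; perm_count.
  - by rewrite !size_cat !size_nseq; lia.
  - rewrite !sg_cat !sg_nseq.
    have [kn|kn] := leqP n.-1 k.
      have -> : k.+1 = n by lia.
      by rewrite subnn !mulr0n Un !addr0.
    have := x1 kn => ex; rewrite /c ex mulr1n -mulrnDl -mulrnDr subnKC ?Un //; lia.
have ua := tri_uniq gab hx; rewrite -/c in ua.
have cs : c \in s by rewrite (perm_mem p) !mem_cat !mem_nseq eqxx andbT; apply/or3P; constructor 3; lia.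
have [s3 p3] := mem_perm_cons cs.
have s3s := perm_size p3; rewrite ss /= in s3s.
have [||a' [b' [x' [_ _ _ _ p']]]] := @H_tri (y :: s3).
- by slia.
- by move=> T R pT; apply: (zs T (c :: R)); perm_count.
have sub : {subset [:: y; a; b; c] <= [:: a'; b'; a' *+ x' + b']}.
  move=> z zz; apply: (@mem_tri _ n k); rewrite -(perm_mem p').
  have p4 : perm_eq (c :: s3) (tri n k a b c) by rewrite perm_sym; apply: perm_trans p3; rewrite perm_sym.
  have cz : (count_mem z (c :: s3) = count_mem z (tri n k a b c))%N by rewrite (permP p4).
  rewrite count_tri /= in cz; move: zz; rewrite !inE.
  have [//|zy] := eqVneq z y; rewrite ?eqxx //=.
  rewrite -has_pred1 has_count.
  move: ua cz; rewrite /= !inE !negb_or andbT => /andP[/andP[ab ac] bc] cz.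
  case/or3P=> /eqP ez; rewrite ez ?eqxx in cz *.
  - by move: cz; rewrite [b == a]eq_sym [c == a]eq_sym (negbTE ab) (negbTE ac) /=; clear - n1 k2 hk; lia.
  - by move: cz; rewrite [c == b]eq_sym (negbTE ab) (negbTE bc) /=; clear - n1 k2 hk; lia.
  - by move: cz; rewrite (negbTE ac) (negbTE bc) /=; clear - n1 k2 hk; lia.
have := uniq_leq_size _ sub; rewrite cons_uniq ua andbT.
by rewrite !inE (negbTE nya) (negbTE nyb) (negbTE nyc) => /(_ isT).
Qed.

(* If [h] were a fourth value, forcing [h] and [c] into the remainder yields another
   triple with the same total; comparing the two totals is contradictory. *)
Lemma block_support (a b : U) x (B : seq U) : generates a b -> (0 < x < n)%N ->
  ((k < n.-1)%N -> x = 1%N) -> size B = n -> sg B = 0 ->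
  (forall X Y, perm_eq (tri n k a b (a *+ x + b) ++ B) (X ++ Y) -> (size X <= k)%N ->
    exists W' B', [/\ perm_eq Y (W' ++ B'), sg B' = 0 & tri_form (X ++ W')]) ->
  {subset B <= [:: a; b; a *+ x + b]}.
Proof.
move=> gab hx x1 sB zB hX h hB.
set c := a *+ x + b in hX *.
have ua := tri_uniq gab hx; rewrite -/c in ua.
have [//|nh] := boolP (h \in [:: a; b; c]); exfalso.
have [B1 pB] := mem_perm_cons hB.
have [W1 pW] : exists W1, perm_eq (tri n k a b c) (c :: W1).
  apply: mem_perm_cons; rewrite !mem_cat !mem_nseq eqxx andbT; apply/or3P; constructor 3; lia.
have pX : perm_eq (tri n k a b c ++ B) ([:: h; c] ++ (W1 ++ B1)) by perm_count.
have [//|W' [B' [pY zB' [a' [b' [x' [gab' hx' _ x1' pT]]]]]]] := hX _ _ pX.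
have ua' := tri_uniq gab' hx'; set c' := a' *+ x' + b' in pT ua'.
have ptot : perm_eq (tri n k a b c ++ B) (tri n k a' b' c' ++ B') by perm_count.
have tot : c *+ k - a - b = c' *+ k - a' - b'.
  have e : sg (tri n k a b c ++ B) = sg (tri n k a' b' c' ++ B') by apply: perm_big.
  by move: e; rewrite (sg_cat (tri n k a b c)) (sg_cat (tri n k a' b' c')) zB zB' !addr0 !sum_tri.
have cnt z : (count_mem z (tri n k a' b' c') <= count_mem z (tri n k a b c) + count_mem z B)%N.
  by have := permP ptot (pred1 z); rewrite !count_cat => ->; rewrite leq_addr.
have nhc : h != c by move: nh; rewrite !inE !negb_or => /and3P[].
have nha : h != a by move: nh; rewrite !inE !negb_or => /and3P[].
have nhb : h != b by move: nh; rewrite !inE !negb_or => /and3P[].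
have ht : h \in [:: a'; b'; c'].
  by apply: (@mem_tri _ n k); rewrite -(perm_mem pT) mem_head.
have ct : c \in [:: a'; b'; c'].
  by apply: (@mem_tri _ n k); rewrite -(perm_mem pT) in_cons mem_head orbT.
(* A value other than [a], [b], [c] can only come from [B], whose [n < 2 (n - 1)] elements do not
   provide [n - 1] copies of both [E] and [h]. *)
have Eab (E : U) : E != c -> E != h -> (n.-1 <= count_mem E (tri n k a' b' c'))%N ->
    (n.-1 <= count_mem h (tri n k a' b' c'))%N -> E = a \/ E = b.
  move=> Ec Eh cE ch; have [->|Ea] := eqVneq E a; first by left.
  have [->|Eb] := eqVneq E b; first by right.
  exfalso.
  have c0 z : z \notin [:: a; b; c] -> count_mem z (tri n k a b c) = 0%N.
    by move=> zn; apply/count_memPn; apply: contra zn; exact: mem_tri.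
  have := cnt h; rewrite (c0 h nh) => h2.
  have := cnt E; rewrite c0 ?inE ?negb_or ?Ea ?Eb ?Ec // => h1.
  have := count_mem2_le B Eh.
  by rewrite sB; clear - h1 h2 cE ch n1 k2 hk; lia.
have c3' z : z \in [:: a'; b'] \/ k = n.-1 /\ z \in [:: a'; b'; c'] ->
    (n.-1 <= count_mem z (tri n k a' b' c'))%N.
  rewrite count_tri !inE; case=> [/orP[]|[-> /or3P[]]] /eqP -> /=; rewrite eqxx mul1n;
    by rewrite ?leq_addr // ?[(_ + (n.-1 + _))%N]addnCA ?leq_addr // addnA leq_addl.
have fin E : E = a \/ E = b -> h + E = a + b -> False.
  case=> -> e; first by move/eqP: nhb; apply; apply: (addIr a); rewrite e addrC.
  by move/eqP: nha; apply; apply: (addIr b); rewrite e.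
have [ab' [ac' bc']] : a' != b' /\ a' != c' /\ b' != c'.
  by move: ua'; rewrite /= !inE !negb_or andbT => /andP[/andP[-> ->] ->].
(* If [c' = c], the totals give [a + b = a' + b']. One of [a'], [b'] is [h] and the other is [a] or
   [b] by [Eab], which makes [h] one of [a], [b]. *)
have [ecc|ncc] := eqVneq c c'.
  have e : a + b = a' + b'.
    by apply: oppr_inj; apply: (addrI (c *+ k)); rewrite !opprD !addrA tot ecc.
  move: ht; rewrite !inE -ecc (negbTE nhc) orbF => /orP[] /eqP eh.
  - apply: (fin b'); last by rewrite e eh.
    apply: Eab; [by rewrite ecc | by rewrite eh eq_sym | |]; apply: c3'; left.
      by rewrite !inE eqxx orbT.
    by rewrite eh mem_head.
  - apply: (fin a'); last by rewrite e eh addrC.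
    apply: Eab; [by rewrite ecc | by rewrite eh | |]; apply: c3'; left.
      by rewrite mem_head.
    by rewrite eh !inE eqxx orbT.
(* For [k = n - 1] the three values of a triple have equal multiplicity, and the totals become
   [a + b + c = a' + b' + c']. *)
have [kn|kn] := leqP n.-1 k.
  have ek : k = n.-1 by clear - kn hk; lia.
  have tot' : a + b + c = a' + b' + c'.
    have nz (p q r : U) : - r - p - q = - (p + q + r) by rewrite !opprD [RHS]addrC addrA.
    by apply: oppr_inj; move: tot; rewrite ek !opp_mulrn_pred !nz.
  have fin3 E : E \in [:: a'; b'; c'] -> E != c -> E != h -> a' + b' + c' = h + E + c -> False.
    move=> Ein Ec Eh e; apply: (fin E); last by apply: (addIr c); rewrite tot' e.
    by apply: Eab => //; apply: c3'; right.
  move: ht ct; rewrite !inE (negbTE ncc) orbF => /or3P[] /eqP eh /orP[] /eqP ec.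
  - by move/eqP: nhc; rewrite eh ec.
  - apply: (fin3 c'); rewrite ?inE ?eqxx ?orbT ?eh ?ec //; [by rewrite eq_sym | by rewrite eq_sym |].
    by rewrite addrAC.
  - apply: (fin3 c'); rewrite ?inE ?eqxx ?orbT ?eh ?ec //; [by rewrite eq_sym | by rewrite eq_sym |].
    by zmodule.
  - by move/eqP: nhc; rewrite eh ec.
  - apply: (fin3 b'); rewrite ?inE ?eqxx ?orbT ?eh ?ec //; first by rewrite eq_sym.
    by rewrite addrC [a' + b']addrC addrA.
  - apply: (fin3 a'); rewrite ?inE ?eqxx ?orbT ?eh ?ec //.
    by rewrite addrC addrA.
have kS u : u *+ k = u *+ k.-1 + u :> U by rewrite addrC -mulrS prednK //; clear - hk; lia.
(* Here [c = a + b] and [c' = a' + b']. As [c] is [a'] or [b'], the other of the two is annihilated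
   by [k - 1], impossible for [0 < k - 1 < n]. *)
have e : c *+ k.-1 = c' *+ k.-1.
  move: tot; rewrite !kS -!addrA -!opprD /c /c' x1 // x1' // !mulr1n.
  have z (p q : U) : p + (q - (p + q)) = 0 by zmodule.
  by rewrite !z !addr0.
have noy (u v : U) : generates u v -> v *+ k.-1 = 0 -> False.
  by move=> g /(generates_mulrn0 g) /dvdn_leq; clear - hk k2 kn; lia.
move: ct; rewrite !inE (negbTE ncc) orbF => /orP[] /eqP ec; move: e; rewrite ec /c' x1' // mulr1n mulrnDl.
- by rewrite -{1}[a' *+ k.-1]addr0 => /addrI /esym; apply: noy.
- by rewrite -{1}[b' *+ k.-1]add0r => /addIr /esym; apply: noy (generatesC gab').
Qed.
End Bound.

(** With [i], [j], [l] copies of the three values, [n] divides [i + x l] and [j + l], while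
    [i + j + l = n]. So [j + l] is [0] or [n]; in the second case [i = 0] and [n] divides [x l],
    hence [l]. *)
Lemma block_mono (a b : U) x (B : seq U) : generates a b -> (0 < x < n)%N -> coprime x n ->
  size B = n -> sg B = 0 -> {subset B <= [:: a; b; a *+ x + b]} ->
  exists2 u, u \in [:: a; b; a *+ x + b] & B = nseq n u.
Proof.
move=> gab hx cx sB zB sub.
have [i [j [l [p sz]]]] := perm_nseq3 (tri_uniq gab hx) sub.
have mono u : u \in [:: a; b; a *+ x + b] -> perm_eq B (nseq n u) ->
    exists2 u, u \in [:: a; b; a *+ x + b] & B = nseq n u.
  move=> hu pu; exists u => //; apply: nseq_of_all => // y.
  by rewrite (perm_mem pu) mem_nseq => /andP[_ /eqP].
have : a *+ (i + x * l) + b *+ (j + l) = 0.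
  rewrite -zB (sg_perm p) !sg_cat !sg_nseq !mulrnDr mulrnDl -mulrnA.
  by zmodule.
case/(indep gab) => d1 d2; rewrite sB in sz.
have [e0|jl] := posnP (j + l)%N.
  apply: (mono a); rewrite ?mem_head //.
  have [ej [el ei]] : j = 0%N /\ l = 0%N /\ i = n by lia.
  by rewrite ej el ei !cats0 in p.
have ejl : (j + l = n)%N by have := dvdn_leq jl d2; lia.
have ei : i = 0%N by lia.
rewrite ei add0n Gauss_dvdr 1?coprime_sym // in d1.
have [l0|l0] := posnP l.
  apply: (mono b); first by rewrite !inE eqxx orbT.
  have ej : j = n by lia.
  by rewrite ei ej l0 /= cats0 in p.
have el : l = n by have := dvdn_leq l0 d1; lia.
apply: (mono (a *+ x + b)); first by rewrite !inE eqxx !orbT.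
have ej : j = 0%N by lia.
by rewrite ei ej el in p.
Qed.

Section Lift.
Hypothesis U_bound : forall s : seq U, zsfree (2 * n - 1 - k) s -> (size s < 2 * n - 1 + k)%N.
Hypothesis H_tri : forall s : seq U, size s = (2 * n - 2 + k)%N ->
  zsfree (2 * n - 1 - k) s -> tri_form s.
Hypothesis hk2 : (1 < k)%N \/ n = 2%N.

Lemma dec_block_support S W Bs B (a b : U) x : extremal n m k S -> dec phi n m k S W Bs ->
  B \in Bs -> generates a b -> (0 < x < n)%N -> ((k < n.-1)%N -> x = 1%N) ->
  perm_eq (map phi W) (tri n k a b (a *+ x + b)) ->
  {subset map phi B <= [:: a; b; a *+ x + b]}.
Proof.
move=> hS d BB gab hx x1 pW; case: (d) => _ _ /(_ _ BB) [sB zB] _ _.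
case: hk2 => [k2|n2].
  apply: (block_support k2 gab hx x1); rewrite ?size_map -?phi_sg //.
  move=> X Y pX szX.
  have pX' : perm_eq (map phi (W ++ B)) (X ++ Y).
    by rewrite map_cat; apply: perm_trans pX; rewrite perm_cat2r.
  have [X' [Y' [pXY eX eY]]] := perm_map_cat_lift pX'.
  have szX' : (size X' <= k)%N by rewrite -eX size_map in szX.
  have [W' [B' [pY sB' zB' sW' zW']]] := dec_rebuild red hk U_bound hS d BB pXY szX'.
  exists (map phi W'), (map phi B'); split.
  - by rewrite -eY -map_cat; apply: perm_map.
  - by rewrite -phi_sg.
  - by rewrite -eX -map_cat; apply: H_tri; rewrite ?size_map.
(* For [n = 2] the nonzero elements of [U] are [a], [b], [a + b], and a block element with image [0]
   would itself be a kernel sum of length one. *)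
move=> h /mapP [v vB ->].
have v0 : phi v != 0.
  apply/eqP => e; have [B1 pB] := mem_perm_cons vB.
  have := @dec_no_short _ _ _ _ _ _ red k hk U_bound S W Bs B [:: v] (W ++ B1) hS d BB.
  rewrite n2 big_seq1 => /(_ _ isT e) h0; have : 1%N = 2%N by apply: h0; perm_count.
  by [].
have [i [j e]] := gab (phi v).
have red2 u l : u *+ l = u *+ odd l :> U.
  rewrite -{1}(odd_double_half l) mulrnDr -muln2 mulnC mulrnA -n2 Un mul0rn addr0 //.
have ex : x = 1%N by lia.
move: v0; rewrite e (red2 a) (red2 b) ex !inE.
by case: (odd i); case: (odd j); rewrite ?mulr1n ?mulr0n ?addr0 ?add0r ?eqxx ?orbT.
Qed.

(** Taking [x j mod n] elements over [a], [j] over [b] and [n - j] over their combination gives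
    image [0], hence sum [g]. The free choice of these elements within their fibres makes each fibre
    of [W] constant. *)
Lemma tri_lift S : extremal n m k S ->
  exists E F H g x a1 a2 a3,
  [/\ [/\ generates (phi E) (phi F), phi H = phi E *+ x + phi F, (0 < x < n)%N, coprime x n
       & (k < n.-1)%N -> x = 1%N],
     ker_gen phi m g,
     [/\ perm_eq S (nseq (n.-1 + n * a1) E ++ nseq (n.-1 + n * a2) F ++ nseq (k + n * a3) H),
       (a1 + a2 + a3 = m.-1)%N, (0 < a1)%N -> E *+ n = g, (0 < a2)%N -> F *+ n = g
       & (0 < a3)%N -> H *+ n = g]
    & forall j, (0 < j < n)%N -> (n - j <= k)%N ->
        E *+ (x * j %% n) + F *+ j + H *+ (n - j) = g].
Proof.
move=> hS; have [W [Bs d]] := dec_exists red hk U_bound hS.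
case: (d) => pS sBs hBs szW zW.
have [||a [b [x [gab hx cx x1 p]]]] := @H_tri (map phi W); rewrite ?size_map //.
have [WA [WBC [pW eA eBC]]] := perm_map_cat_lift p.
have [WB [WC [pBC eB eC]]] : exists WB WC, [/\ perm_eq WBC (WB ++ WC), map phi WB = nseq n.-1 b
     & map phi WC = nseq k (a *+ x + b)].
  by apply: perm_map_cat_lift; rewrite eBC.
have {}pW : perm_eq W (WA ++ WB ++ WC) by perm_count.
have sA : size WA = n.-1 by rewrite -(size_map phi) eA size_nseq.
have sB : size WB = n.-1 by rewrite -(size_map phi) eB size_nseq.
have sC : size WC = k by rewrite -(size_map phi) eC size_nseq.
have phiA v : v \in WA -> phi v = a.
  by move/(map_f phi); rewrite eA mem_nseq => /andP[_ /eqP].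
have phiB v : v \in WB -> phi v = b.
  by move/(map_f phi); rewrite eB mem_nseq => /andP[_ /eqP].
have phiC v : v \in WC -> phi v = a *+ x + b.
  by move/(map_f phi); rewrite eC mem_nseq => /andP[_ /eqP].
have sumc (T : seq V) u : (forall v, v \in T -> phi v = u) -> phi (sg T) = u *+ size T.
  move=> h; rewrite phi_sg (@nseq_of_all _ u (map phi T) (size T)) ?sg_nseq ?size_map //.
  by move=> y /mapP [v vT ->]; apply: h.
have [B0 B0B] : exists B0, B0 \in Bs.
  by case: Bs sBs {d pS hBs} => [|B0 Bs] /= ?; [exfalso; lia | exists B0; rewrite mem_head].
set g := sg B0.
have gg : ker_gen phi m g := dec_gen red hk hS d B0B.
have hT j TA RA TB RB TC RC : (0 < j < n)%N -> perm_eq WA (TA ++ RA) -> perm_eq WB (TB ++ RB) ->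
    perm_eq WC (TC ++ RC) -> size TA = (x * j %% n)%N -> size TB = j -> size TC = (n - j)%N ->
    sg TA + (sg TB + sg TC) = g.
  move=> hj pA pB pC zA zB' zC; rewrite -!sg_cat.
  apply: (dec_exchange red hk hS d B0B (R := RA ++ RB ++ RC ++ B0)).
  - by perm_count.
  - rewrite !size_cat zA zB' zC; have := ltn_pmod (x * j) (ltnW n1); clear - hj hk; lia.
  - rewrite !sg_cat !raddfD /= (sumc TA a) ?(sumc TB b) ?(sumc TC (a *+ x + b)).
    + rewrite zA zB' zC mulrnDl -mulrnA.
      have -> : a *+ (x * j %% n) + (b *+ j + (a *+ (x * (n - j)) + b *+ (n - j))) =
          (a *+ (x * (n - j)) + a *+ (x * j %% n)) + (b *+ (n - j) + b *+ j) by zmodule.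
      rewrite -!mulrnDr.
      have -> : (n - j + j = n)%N by clear - hj; lia.
      rewrite Un addr0; have /dvdnP [q ->] : (n %| x * (n - j) + x * j %% n)%N.
        by rewrite /dvdn modnDmr -mulnDr subnK ?modnMl // ltnW //; case/andP: hj.
      by rewrite mulnC mulrnA Un mul0rn.
    + by move=> v vT; apply: phiC; rewrite (perm_mem pC) mem_cat vT.
    + by move=> v vT; apply: phiB; rewrite (perm_mem pB) mem_cat vT.
    + by move=> v vT; apply: phiA; rewrite (perm_mem pA) mem_cat vT.
have hTt j : (0 < j < n)%N -> (n - j <= k)%N ->
   [/\ forall T R, perm_eq WA (T ++ R) -> size T = (x * j %% n)%N ->
      sg T = g - (sg (take j WB) + sg (take (n - j) WC)),
      forall T R, perm_eq WB (T ++ R) -> size T = j ->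
      sg T = g - sg (take (n - j) WC) - sg (take (x * j %% n) WA)
    & forall T R, perm_eq WC (T ++ R) -> size T = (n - j)%N ->
      sg T = g - sg (take j WB) - sg (take (x * j %% n) WA)].
  move=> hj hjk.
  have lA : (x * j %% n <= size WA)%N by rewrite sA; have := ltn_pmod (x * j) (ltnW n1); clear; lia.
  have lB : (j <= size WB)%N by rewrite sB; clear - hj; lia.
  have lC : (n - j <= size WC)%N by rewrite sC.
  have pA := perm_take WA (x * j %% n); have pB := perm_take WB j; have pC := perm_take WC (n - j).
  split=> T R pT sT.
  - have := hT j T R _ _ _ _ hj pT pB pC sT; rewrite !size_takel // => <- //.
    by zmodule.
  - have := hT j _ _ T R _ _ hj pA pT pC; rewrite !size_takel // => <- //.
    by zmodule.
  - have := hT j _ _ _ _ T R hj pA pB pT; rewrite !size_takel // => <- //.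
    by zmodule.
have same1 (L : seq V) u v : (size L <= 1)%N -> u \in L -> v \in L -> u = v.
  by case: L => [|y [|]] //= _; rewrite !inE => /eqP -> /eqP ->.
have sameA u v : u \in WA -> v \in WA -> u = v.
  case: hk2 => [k2|n2]; last by apply: same1; rewrite sA n2.
  (* The exchange has to use some but not all of [WA]: an inverse of [x] uses one element, and for
     [x = 1] the choice [j = n - 2] uses [n - 2]. *)
  have [j [hj hjk hr]] : exists j, [/\ (0 < j < n)%N, (n - j <= k)%N & (0 < x * j %% n < n.-1)%N].
    have [kn|kn] := leqP n.-1 k.
      have /(coprimeP _ (proj1 (andP hx))) [[y z] /= e] := cx.
      exists (y %% n)%N.
      have e1 : (x * (y %% n) %% n = 1)%N.
        rewrite modnMmr mulnC (_ : (y * x = z * n + 1)%N); last by clear - e; lia.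
        by rewrite modnMDl modn_small.
      have y0 : (0 < y %% n)%N.
        by rewrite lt0n; apply/eqP => e0; move: e1; rewrite e0 muln0 mod0n.
      rewrite e1 y0 ltn_pmod; last by clear - n1; lia.
      by split=> //; clear - y0 k2 hk kn; lia.
    have ex := x1 kn; exists (n - 2)%N; rewrite ex mul1n modn_small; last by clear - n1; lia.
    by split; clear - kn k2; lia.
  have [h1 _ _] := hTt j hj hjk.
  by apply: (const_of_subsums (r := (x * j %% n)%N) _ h1); rewrite sA.
have sameB u v : u \in WB -> v \in WB -> u = v.
  case: hk2 => [k2|n2]; last by apply: same1; rewrite sB n2.
  have [||_ h2 _] := hTt (n - 2)%N; [clear - k2 hk; lia|clear - k2 hk; lia|].
  by apply: (const_of_subsums (r := (n - 2)%N) _ h2); rewrite sB; clear - k2 hk; lia.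
have sameC u v : u \in WC -> v \in WC -> u = v.
  have [k2|k1] := ltnP 1 k; last by apply: same1; rewrite sC.
  have [||_ _ h3] := hTt n.-1%N; [clear - k2 hk; lia|clear - k2 hk; lia|].
  by apply: (const_of_subsums (r := (n - n.-1)%N) _ h3); rewrite sC; clear - k2 hk; lia.
have [|E eE] := nseq_of_same _ sameA; first by rewrite sA; clear - n1; lia.
have [|F eF] := nseq_of_same _ sameB; first by rewrite sB; clear - n1; lia.
have [|H eH] := nseq_of_same _ sameC; first by rewrite sC; case/andP: hk.
rewrite sA in eE; rewrite sB in eF; rewrite sC in eH.
have EA : E \in WA by rewrite eE mem_nseq eqxx andbT; clear - n1; lia.
have FB : F \in WB by rewrite eF mem_nseq eqxx andbT; clear - n1; lia.
have HC : H \in WC by rewrite eH mem_nseq eqxx andbT; case/andP: hk.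
have pE := phiA _ EA; have pF := phiB _ FB; have pH := phiC _ HC.
have sub : {subset Bs <= [:: nseq n E; nseq n F; nseq n H]}.
  move=> B BB; have [szB zB] := hBs _ BB.
  have subB := dec_block_support hS d BB gab hx x1 p.
  have [||u hu eu] := block_mono gab hx cx _ _ subB; rewrite ?size_map -?phi_sg //.
  have key v : v \in W -> phi v = u -> B = nseq n v.
    move=> vW ev; apply: nseq_of_all => // y yB.
    apply/esym; apply: (dec_swap red hk hS d BB vW yB); rewrite ev.
    by have := map_f phi yB; rewrite eu mem_nseq => /andP[_ /eqP ->].
  have inW v : v \in WA ++ WB ++ WC -> v \in W by rewrite (perm_mem pW).
  move: hu; rewrite !inE => /or3P[] /eqP hu.
  - by rewrite (key E) ?eqxx // ?inW ?pE ?hu // mem_cat EA.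
  - by rewrite (key F) ?eqxx ?orbT // ?inW ?pF ?hu // !mem_cat FB orbT.
  - by rewrite (key H) ?eqxx ?orbT // ?inW ?pH ?hu // !mem_cat HC !orbT.
have [a1 [a2 [a3 [sa pf m1' m2' m3']]]] := gather_nseq3 sub.
have sgB B : B \in Bs -> sg B = g by move=> BB; exact: (dec_sum_eq red hk hS d BB B0B).
exists E, F, H, g, x, a1, a2, a3; split.
- by rewrite pE pF pH.
- exact: gg.
- split; first by rewrite !nseqD -eE -eF -eH; perm_count.
  + by rewrite sa sBs.
  + by move/m1'/sgB; rewrite sg_nseq.
  + by move/m2'/sgB; rewrite sg_nseq.
  + by move/m3'/sgB; rewrite sg_nseq.
- move=> j hj hjk.
  have lA : (x * j %% n <= n.-1)%N by have := ltn_pmod (x * j) (ltnW n1); clear; lia.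
  have lB : (j <= n.-1)%N by clear - hj; lia.
  have := hT j _ _ _ _ _ _ hj (perm_take WA (x * j %% n)) (perm_take WB j) (perm_take WC (n - j)).
  by rewrite eE eF eH !take_nseq // !size_nseq !sg_nseq addrA => ->.
Qed.
End Lift.
End Triples.

(** * From lifted triples to the forms of items 3 and 4 *)

Section Endgame.
Variables (V U : zmodType) (phi : {additive V -> U}) (n m : nat) (w : V).
Hypothesis red : reduction phi n m w.
Let n1 := red_n red.
Let m1 := red_m red.
Let Un := red_exp red.
Let indep := red_indep red.
Variable g : V.
Hypothesis gg : ker_gen phi m g.

Lemma gen_neq0 : g <> 0.
Proof.
case: gg => _ h _ e; have := h 1%N; rewrite e mul0rn eqxx => /esym; rewrite dvdn1.
by move=> /eqP em; move: m1; rewrite em.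
Qed.

Lemma order_lift (A : V) : A *+ n = g -> (forall t, phi A *+ t = 0 -> (n %| t)%N) ->
  has_order A (m * n).
Proof.
case: gg => _ go _ nA oA; split; first by rewrite muln_gt0; apply/andP; split; apply: ltnW.
  by rewrite mulnC mulrnA nA; apply/eqP; rewrite go.
move=> t /andP[t0 tlt] e.
have /dvdnP [q eq] : (n %| t)%N by apply: oA; rewrite -raddfMn e raddf0.
have : (m %| q)%N by rewrite -go -nA -mulrnA mulnC -eq e.
case: q eq => [|q] eq; first by rewrite eq in t0.
move/dvdn_leq => /(_ isT); rewrite leqNgt => /negP; apply.
by rewrite -(ltn_pmul2r (ltnW n1)) -eq.
Qed.

(** A combination of [B] and [A] that matches the image misses its target by a kernel element, a
    multiple of [g = n A]. In a relation [n] divides both exponents, and [n B = 0] removes the [B]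
    part. *)
Lemma basis_lift (B A : V) : generates (phi B) (phi A) -> B *+ n = 0 -> A *+ n = g ->
  is_basis B A /\ has_order A (m * n).
Proof.
move=> gab nB nA; split; last first.
  by apply: order_lift => // t; apply: generates_mulrn0 red _ _ _ gab.
split=> [v|i j e].
  have [i [j e]] := gab (phi v).
  have [_ _ gk] := gg; have [|l el] := gk (v - (B *+ i + A *+ j)).
    by rewrite raddfB raddfD !raddfMn e subrr.
  exists i, (j + n * l)%N; rewrite mulrnDr mulrnA nA -el.
  by zmodule.
have [di dj] : (n %| i)%N /\ (n %| j)%N.
  by apply: (indep gab); rewrite -!raddfMn -raddfD e raddf0.
have Bi : B *+ i = 0 by case/dvdnP: di => q ->; rewrite mulnC mulrnA nB mul0rn.
by split=> //; rewrite Bi add0r in e.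
Qed.

Lemma gen_lift (A B : V) : generates (phi A) (phi B) -> (A + B) *+ n = g ->
  generates A B /\ has_order (A + B) (m * n).
Proof.
move=> gab nC; split.
  move=> v; have [i [j e]] := gab (phi v).
  have [_ _ gk] := gg; have [|l el] := gk (v - (A *+ i + B *+ j)).
    by rewrite raddfB raddfD !raddfMn e subrr.
  exists (i + n * l)%N, (j + n * l)%N.
  have : v = A *+ i + B *+ j + g *+ l by rewrite -el; zmodule.
  by rewrite -nC -mulrnA mulrnDl !mulrnDr => ->; zmodule.
apply: order_lift => // t; rewrite raddfD mulrnDl => e.
by have [] := indep gab e.
Qed.

(* The case distinction is on which of [A], [B] has order [m n]. *)
Lemma triple_form k S (A B : V) a b c : generates (phi A) (phi B) -> (A + B) *+ n = g ->
  ((0 < a)%N -> A *+ n = g) -> ((0 < b)%N -> B *+ n = g) -> (a + b + c = m.-1)%N ->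
  perm_eq S (nseq (n.-1 + n * a) A ++ nseq (n.-1 + n * b) B ++ nseq (k + n * c) (A + B)) ->
  altA m n (form3a n m k) S \/ altG m n (form3b n m k) S.
Proof.
move=> gab nC nA nB abc p.
have key (X Y : V) l : (0 < l)%N -> (l + c = m.-1)%N ->
    ((l.+1 * n).-1 = n.-1 + n * l)%N /\ ((m - l.+1) * n + k = k + n * c)%N.
  move=> l0 lc; split; first by rewrite mulSn mulnC; clear - n1; lia.
  by rewrite addnC mulnC; congr (_ + _ * _)%N; clear - lc m1; lia.
have [b0|b0] := posnP b; last first.
  have nA0 : A *+ n = 0 by apply: (addIr (B *+ n)); rewrite -mulrnDl add0r nC nB.
  have a0 : a = 0%N.
    by have [//|a0] := posnP a; case: gen_neq0; rewrite -(nA a0).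
  have [bs od] := basis_lift gab nA0 (nB b0).
  left; exists A, B; split=> //; exists b.+1; split; first by clear - abc m1; lia.
  have [||-> ->] := key A B b => //; first by clear - abc a0; lia.
  by move: p; rewrite a0 muln0 addn0.
have [a0|a0] := posnP a; last first.
  have nB0 : B *+ n = 0 by apply: (addrI (A *+ n)); rewrite -mulrnDl addr0 nC nA.
  have [bs od] := basis_lift (generatesC gab) nB0 (nA a0).
  left; exists B, A; split=> //; exists a.+1; split; first by clear - abc m1; lia.
  have [||-> ->] := key A B a => //; first by clear - abc b0; lia.
  by rewrite (permPl p) b0 muln0 addn0 perm_catCA [A + B]addrC.
right; have [gn od] := gen_lift gab nC; exists A, B; split=> //.
rewrite /form3b; move: p; rewrite a0 b0 muln0 !addn0.
by have -> : ((m - 1) * n + k = k + n * c)%N by rewrite addnC mulnC; congr (_ + _ * _)%N; clear - abc a0 b0; lia.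
Qed.

End Endgame.

Section Items34.
Variables (V U : zmodType) (phi : {additive V -> U}) (n m : nat) (w : V).
Hypothesis red : reduction phi n m w.
Let n1 := red_n red.
Let m1 := red_m red.
Variable k : nat.
Hypothesis hk : (0 < k < n)%N.
Hypothesis U_bound : forall s : seq U, zsfree (2 * n - 1 - k) s -> (size s < 2 * n - 1 + k)%N.
Hypothesis H_tri : forall s : seq U, size s = (2 * n - 2 + k)%N ->
  zsfree (2 * n - 1 - k) s -> tri_form n k s.

(** The exchanges for [j = n - 1] and [j = n - 2], the latter using two copies of [H], differ
    exactly by the relation [H = E + F]. *)
Lemma item3_main (S : seq V) : (1 < k < n.-1)%N -> extremal n m k S ->
  altA m n (form3a n m k) S \/ altG m n (form3b n m k) S.
Proof.
move=> hk2 hS.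
have hk2' : (1 < k)%N \/ n = 2%N by left; case/andP: hk2.
have [E [F [H [g [x [a1 [a2 [a3 [[gab pH hx cx x1] gg [p sa nE nF nH] hj]]]]]]]]]
  := tri_lift red hk U_bound H_tri hk2' hS.
have ex : x = 1%N by apply: x1; case/andP: hk2.
have j1 : E *+ n.-1 + F *+ n.-1 + H = g.
  have := hj n.-1; rewrite ex mul1n modn_small; last by clear - n1; lia.
  rewrite (_ : n - n.-1 = 1)%N; last by clear - n1; lia.
  by rewrite mulr1n; apply; clear - hk2 n1; lia.
have j2 : E *+ (n - 2) + F *+ (n - 2) + H *+ 2 = g.
  have := hj (n - 2)%N; rewrite ex mul1n modn_small; last by clear - n1; lia.
  rewrite (_ : n - (n - 2) = 2)%N; last by clear - n1; lia.
  by apply; clear - hk2 n1; lia.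
have eH : H = E + F.
  have en : n.-1 = (n - 2).+1 by clear - n1; lia.
  move: j1; rewrite -j2 mulr2n en !mulrSr => e; apply/esym.
  have : (E *+ (n - 2) + F *+ (n - 2) + H) + (E + F) = (E *+ (n - 2) + F *+ (n - 2) + H) + H.
    by transitivity (E *+ (n - 2) + E + (F *+ (n - 2) + F) + H); [zmodule | rewrite e; zmodule].
  by move/addrI.
rewrite eH in p j1; apply: (triple_form red gg gab _ nE nF sa p).
by rewrite -j1 -mulrnDl -mulrSr prednK // ltnW.
Qed.

Lemma form4a_of_3a e1 e2 (S : seq V) : k = n.-1 -> form3a n m k e1 e2 S -> form4a n m e1 e2 S.
Proof.
move=> ek [s [hs p]]; exists s, 1%N; split=> //; first by clear - n1; lia.
  by rewrite coprime1n.
by move: p; rewrite mulr1n ek.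
Qed.

(** Now every [j] with [0 < j < n] gives an exchange. If [n E <> 0] and [n > 2], consecutive ones
    give [x E + F = H], or [x E + F = H + n E] when [x j mod n] wraps around, and these exclude each
    other. Never wrapping forces [x = 1] and [H = E + F]; always wrapping forces [x = n - 1] and
    [F = E + H]. *)
Lemma item4_main (S : seq V) : k = n.-1 -> extremal n m k S ->
  altA m n (form4a n m) S \/ altG m n (form4b n m) S.
Proof.
move=> ek hS.
have hk2 : (1 < k)%N \/ n = 2%N by clear - ek n1; lia.
have [E [F [H [g [x [a1 [a2 [a3 [[gab pH hx cx _] gg [p sa nE nF nH] hj]]]]]]]]]
  := tri_lift red hk U_bound H_tri hk2 hS.
have conv : altA m n (form3a n m k) S \/ altG m n (form3b n m k) S ->
    altA m n (form4a n m) S \/ altG m n (form4b n m) S.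
  case=> [[e1 [e2 [h1 h2 h3]]]|[g1 [g2 [h1 h2 h3]]]]; [left|right].
    by exists e1, e2; split=> //; apply: form4a_of_3a.
  by exists g1, g2; split=> //; move: h3; rewrite /form3b /form4b -ek.
have {}hj j : (0 < j < n)%N -> E *+ (x * j %% n) + F *+ j + H *+ (n - j) = g.
  by move=> h; apply: hj; rewrite // ek; clear - h; lia.
have j1 : E *+ x + F + H *+ n.-1 = g.
  have := hj 1%N; rewrite muln1 modn_small ?subn1; last by case/andP: hx.
  by rewrite mulr1n; apply; clear - n1; lia.
have jn : E *+ (n - x) + F *+ n.-1 + H = g.
  have := hj n.-1; rewrite (_ : (x * n.-1 %% n = n - x)%N).
    rewrite (_ : n - n.-1 = 1)%N; last by clear - n1; lia.
    by apply; clear - n1; lia.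
  have -> : (x * n.-1 = x.-1 * n + (n - x))%N.
    case: (x) hx => // y hy; rewrite -subn1 mulnBr muln1 mulSn /=; clear - hy; lia.
  by rewrite modnMDl modn_small //; clear - hx; lia.
have nS (u : V) : u *+ n = u *+ n.-1 + u by rewrite -mulrSr prednK // ltnW.
have [nE0|nE0] := eqVneq (E *+ n) 0.
  left; have a10 : a1 = 0%N.
    by have [//|/nE h] := posnP a1; case: (gen_neq0 red gg); rewrite -h.
  have eH : H = E *+ x + F.
    have [a30|/nH h] := posnP a3; last first.
      by apply: (addrI (H *+ n.-1)); rewrite -nS h -j1 addrC.
    have /nF h : (0 < a2)%N by clear - sa a10 a30 m1; lia.
    have e0 : E *+ (n - x) + E *+ x = 0 by rewrite -mulrnDr subnK ?nE0 //; case/andP: hx => _ /ltnW.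
    have : E *+ (n - x) + F *+ n.-1 + (E *+ x + F) = g.
      by rewrite -h nS -[RHS]add0r -e0; zmodule.
    by rewrite -jn => /addrI.
  have nFg : F *+ n = g.
    have [a20|/nF //] := posnP a2.
    have /nH : (0 < a3)%N by clear - sa a10 a20 m1; lia.
    by rewrite eH mulrnDl -mulrnA mulnC mulrnA nE0 mul0rn add0r.
  have [bs od] := basis_lift red gg gab nE0 nFg.
  exists E, F; split=> //; exists a2.+1, x; split=> //; first by clear - sa m1; lia.
    by clear - hx; lia.
  move: p; rewrite a10 muln0 addn0 eH ek.
  have -> : ((a2.+1 * n).-1 = n.-1 + n * a2)%N by rewrite mulSn mulnC; clear - n1; lia.
  by have -> : ((m - a2.+1) * n + n.-1 = n.-1 + n * a3)%N
    by rewrite addnC mulnC; congr (_ + _ * _)%N; clear - sa a10 m1; lia.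
have gEH : phi F = phi E + phi H -> generates (phi E) (phi H).
  move=> e u; have [i [j ->]] := gab u; exists (i + j)%N, j.
  by rewrite e mulrnDl mulrnDr addrA.
have fin1 : H = E + F -> H *+ n = g -> altA m n (form4a n m) S \/ altG m n (form4b n m) S.
  by move=> eH; rewrite eH in p * => nHg; apply: conv; apply: (triple_form red gg gab nHg nE nF sa p).
have fin2 : F = E + H -> F *+ n = g -> altA m n (form4a n m) S \/ altG m n (form4b n m) S.
  move=> eF nFg; apply: conv.
  have gEH' : generates (phi E) (phi H) by apply: gEH; rewrite eF raddfD.
  rewrite eF in nFg; apply: (triple_form red gg gEH' nFg nE nH (c := a2)).
    by clear - sa; lia.
  by rewrite -eF; move: p; rewrite ek; clear; move=> p; perm_count.
(* For [n = 2] there are no consecutive exchanges; instead a block made of two copies of [v] gives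
   [2 v = g = E + F + H], so [v] is the sum of the other two. *)
have [n2|n3] := leqP n 2.
  have en : n = 2%N by clear - n1 n2; lia.
  have ex : x = 1%N by clear - hx en; lia.
  rewrite ex en /= !mulr1n in j1.
  have [a30|/nH h] := posnP a3; last first.
    by apply: fin1 => //; apply: (addIr H); rewrite j1 -h en mulr2n.
  have [a20|/nF h] := posnP a2; last first.
    by apply: fin2 => //; apply: (addIr F); rewrite addrAC j1 -h en mulr2n.
  have /nE h : (0 < a1)%N by clear - sa a20 a30 m1; lia.
  have eE : E = F + H by apply: (addrI E); rewrite addrA j1 -h en mulr2n.
  have gFH : generates (phi F) (phi H).
    move=> u; have [i [j ->]] := gab u; exists (i + j)%N, i.
    by rewrite eE raddfD mulrnDl mulrnDr; zmodule.
  apply: conv; rewrite {1}eE in h; apply: (triple_form red gg gFH h nF nH (c := a1)).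
    by clear - sa; lia.
  by rewrite -eE; move: p; rewrite ek; clear; move=> p; perm_count.
have hstep j : (0 < j)%N -> (j.+1 < n)%N -> E *+ (x * j.+1 %% n) + F = E *+ (x * j %% n) + H.
  move=> j0 jn'.
  have e1 := hj j.+1; have e2 := hj j.
  have {}e1 := e1 (introT andP (conj isT jn')).
  have {}e2 : E *+ (x * j %% n) + F *+ j + H *+ (n - j) = g by apply: e2; clear - j0 jn'; lia.
  have en : (n - j = (n - j.+1).+1)%N by clear - j0 jn'; lia.
  apply: (addIr (F *+ j + H *+ (n - j.+1))).
  move: e1; rewrite -e2 en !mulrSr => e1.
  by transitivity (E *+ (x * j.+1 %% n) + (F *+ j + F) + H *+ (n - j.+1)); [zmodule | rewrite e1; zmodule].
have mstep j : (x * j.+1 %% n = if x * j %% n + x < n then x * j %% n + x else x * j %% n + x - n)%N.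
  rewrite mulnS addnC -modnDml; case: ifP => c; first by rewrite modn_small.
  have lt := ltn_pmod (x * j) (ltnW n1).
  have -> : (x * j %% n + x = (x * j %% n + x - n) + n)%N by clear - c; lia.
  by rewrite modnDr modn_small; clear - c lt hx; lia.
have stepA j : (0 < j)%N -> (j.+1 < n)%N -> (x * j %% n + x < n)%N -> E *+ x + F = H.
  move=> j0 jn' c; have := hstep j j0 jn'; rewrite mstep c mulrnDr -addrA.
  by move/addrI.
have stepB j : (0 < j)%N -> (j.+1 < n)%N -> (n <= x * j %% n + x)%N -> E *+ x + F = H + E *+ n.
  move=> j0 jn' c; have := hstep j j0 jn'; rewrite mstep ltnNge c /= => e.
  apply: (addrI (E *+ (x * j %% n))); rewrite addrA -mulrnDr.
  by rewrite -{1}(subnK c) mulrnDr addrAC e addrA.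
have noAB : E *+ x + F = H -> E *+ x + F = H + E *+ n -> False.
  move=> -> e; move/eqP: nE0; apply; apply: (addrI H); rewrite -e addr0 //.
have [c1|c1] := ltnP (x * 1 %% n + x)%N n.
  have eA := stepA 1%N isT n3 c1.
  have nowrap j : (0 < j)%N -> (j.+1 < n)%N -> (x * j %% n + x < n)%N.
    move=> j0 jn'; rewrite ltnNge; apply/negP => c; exact: noAB eA (stepB j j0 jn' c).
  have lin j : (j < n)%N -> (x * j %% n = x * j)%N.
    elim: j => [|j IH] jn'; first by rewrite muln0 mod0n.
    rewrite mstep IH; last by apply: ltnW.
    case: (posnP j) => [->|j0].
      by rewrite muln0 add0n muln1; case/andP: hx => _ ->.
    by have := nowrap j j0 jn'; rewrite IH ?(ltnW jn') // => ->; rewrite mulnS addnC.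
  have ex : x = 1%N.
    have := lin n.-1; have := ltn_pmod (x * n.-1) (ltnW n1).
    move=> h1 h2; rewrite h2 in h1; last by clear - n1; lia.
    have [c|c] := leqP x 1; first by clear - c hx; lia.
    have : (2 * n.-1 <= x * n.-1)%N by rewrite leq_mul2r c orbT.
    by clear - h1 n3; lia.
  rewrite ex mulr1n in eA j1.
  by apply: fin1 => //; rewrite nS addrC -{1}eA.
have eB := stepB 1%N isT n3 c1.
have wrap j : (0 < j)%N -> (j.+1 < n)%N -> (n <= x * j %% n + x)%N.
  move=> j0 jn'; rewrite leqNgt; apply/negP => c; exact: noAB (stepA j j0 jn' c) eB.
have lin j : (0 < j)%N -> (j < n)%N -> (x * j %% n + j * (n - x) = n)%N.
  elim: j => [//|j IH] _ jn'.
  case: (posnP j) => [->|j0].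
    by rewrite muln1 mul1n modn_small ?subnKC //; case/andP: hx => // _ /ltnW.
  rewrite mstep ltnNge wrap //= mulSn.
  have := IH j0 (ltnW jn'); have := wrap j j0 jn'; clear - hx; lia.
have ex : x = n.-1.
  have := lin n.-1; clear - hx n3 n1 => h.
  have {}h := h _ _; have : (n.-1 * (n - x) <= n)%N by rewrite -[X in (_ <= X)%N]h ?leq_addl //; lia.
  have [c|c] := leqP (n - x) 1; first by clear - c hx; lia.
  have : (n.-1 * 2 <= n.-1 * (n - x))%N by rewrite leq_mul2l c orbT.
  by clear - n3; lia.
have eF : F = E + H.
  apply: (addrI (E *+ n.-1)); move: eB; rewrite ex nS => ->; zmodule.
apply: fin2 => //; move: jn; rewrite ex (_ : n - n.-1 = 1)%N; last by clear - n1; lia.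
by rewrite mulr1n => <-; rewrite nS {2}eF; zmodule.
Qed.
End Items34.

(** * The case [k = 1] *)

Lemma exists_subset_card (T : finType) (A : {set T}) (k : nat) : (k <= #|A|)%N ->
  exists K : {set T}, K \subset A /\ #|K| = k.
Proof.
move=> le; exists [set x in take k (enum A)]; split.
  by apply/subsetP => x; rewrite inE => /mem_take; rewrite mem_enum.
rewrite cardsE (card_uniqP _) ?take_uniq ?enum_uniq // size_takel // -cardE //.
Qed.

(** Average over the subsets of [I] with one index removed. If [I] has [s + 1] elements, a sum of at
    least [c + 1] would give [(c + 1) s <= c (s + 1)], that is [s <= c < z]. *)
Lemma sum_bounded_up (n : nat) (X : 'I_n -> int) (z : nat) (c : int) : 0 <= c -> c < z%:Z ->
  (forall I : {set 'I_n}, #|I| = z -> \sum_(i in I) X i <= c) ->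
  forall I : {set 'I_n}, (z <= #|I|)%N -> \sum_(i in I) X i <= c.
Proof.
move=> c0 cz h I; move: {2}#|I| (erefl #|I|) => s; elim: s I => [|s IH] I eI le.
  by apply: h; lia.
have [e|ne] := eqVneq z s.+1; first by apply: h; rewrite eI e.
have zs : (z <= s)%N by lia.
have hI i : i \in I -> \sum_(j in I :\ i) X j <= c.
  move=> iI; apply: IH; have := cardsD1 i I; rewrite iI eI; lia.
have tot : \sum_(i in I) \sum_(j in I :\ i) X j = (\sum_(j in I) X j) *+ s.
  have -> : \sum_(i in I) \sum_(j in I :\ i) X j = \sum_(i in I) (\sum_(j in I) X j - X i).
    by apply: eq_bigr => i iI; rewrite [in RHS](big_setD1 i) //= addrC addrK.
  by rewrite sumrB sumr_const eI mulrSr addrK.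
have : \sum_(i in I) \sum_(j in I :\ i) X j <= c *+ s.+1.
  by rewrite -eI -sumr_const; apply: ler_sum.
rewrite tot; move: (\sum_(j in I) X j) => t.
rewrite -[t *+ s]mulr_natr -[c *+ _]mulr_natr !natz => le2.
rewrite leNgt; apply/negP => lt.
have : (c + 1) * s%:Z <= t * s%:Z by rewrite ler_wpM2r // lezD1.
by move: le2; clear - c0 cz zs; rewrite intS mulrDr mulrDl mulr1 mul1r => /= *; lia.
Qed.

(** * Integer coordinates along [eps] *)

Section Coordinates.
Variables (V : zmodType) (n : nat) (eps : V) (f : 'I_n -> V).
Hypothesis n1 : (1 < n)%N.
Hypothesis eps_dvd : forall d : int, eps *~ d = 0 -> (n%:Z %| d)%Z.
Hypothesis eps_n : eps *+ n <> 0.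

Lemma small_multiple0 (d : int) : eps *~ d = 0 -> `|d| < (2 * n)%:Z -> d = 0.
Proof.
move=> e lt; have /dvdzP [q eq] := eps_dvd e.
have [e1|[e1|e1]] : q = 0 \/ (q = 1 \/ q = -1) by nia.
- by rewrite eq e1 mul0r.
- by case: eps_n; rewrite -e eq e1 mul1r pmulrn.
- by case: eps_n; apply: oppr_inj; rewrite oppr0 -e eq e1 mulN1r mulrNz pmulrn.
Qed.

Lemma mulrz_eq_small (a b : int) : eps *~ a = eps *~ b -> `|a - b| < (2 * n)%:Z -> a = b.
Proof.
by move=> e lt; apply/subr0_eq; apply: small_multiple0 => //; rewrite mulrzBr e subrr.
Qed.

(** Exchanging [i] and [o] in a [z]-set writes [f i - f o] as a multiple of [eps]; for two choices
    of the other [z - 1] indices the multipliers differ by less than [2 n], so the integer is well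
    defined. For [z = n - 1] those indices cannot avoid three given ones, and complements of single
    indices are used. *)
Lemma lift_coordinates (H : V) (z : nat) (r : {set 'I_n} -> nat) : (0 < z < n)%N ->
  (forall I : {set 'I_n}, #|I| = z -> (r I < n)%N /\ H = \sum_(i in I) f i + eps *+ r I) ->
  exists X : 'I_n -> int, exists F : V,
    (forall i, f i = F + eps *~ X i) /\ forall i j, `|X i - X j| < n%:Z.
Proof.
move=> hz hr.
have [ez|zn] : z = n.-1 \/ (z < n.-1)%N by lia.
  exists (fun i => (r (~: [set i]))%:Z), (\sum_i f i - H).
  have cI (i : 'I_n) : #|~: [set i]| = z by have := cardsC [set i]; rewrite cards1 card_ord; lia.
  split=> [i|i j]; last first.
    have [h1 _] := hr _ (cI i); have [h2 _] := hr _ (cI j).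
    by move: (r _) (r _) h1 h2 => p q h1 h2; rewrite ltr_norml; clear - h1 h2; lia.
  have [_ e] := hr _ (cI i); rewrite -pmulrn.
  have -> : \sum_j f j = f i + \sum_(j in ~: [set i]) f j.
    rewrite (bigD1 i) //=; congr (_ + _); apply: eq_bigl => j.
    by rewrite !inE.
  by rewrite {1}e; zmodule.
pose o : 'I_n := Ordinal (ltnW n1).
have swap (K : {set 'I_n}) i j : #|K| = z.-1 -> i \notin K -> j \notin K ->
    f i + eps *+ r (i |: K) = f j + eps *+ r (j |: K).
  move=> cK iK jK.
  have ci l : l \notin K -> #|l |: K| = z by move=> lK; rewrite cardsU1 lK cK; lia.
  have [_ e1] := hr _ (ci _ iK); have [_ e2] := hr _ (ci _ jK).
  move: e2; rewrite {1}e1 !big_setU1 //= => e.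
  apply: (addIr (\sum_(l in K) f l)); move: e; rewrite !(addrAC _ (eps *+ _)).
  by [].
have rn (K : {set 'I_n}) i : #|K| = z.-1 -> i \notin K -> (r (i |: K) < n)%N.
  by move=> cK iK; have [] := hr (i |: K); rewrite // cardsU1 iK cK; lia.
have avoid i j : exists K : {set 'I_n}, [/\ #|K| = z.-1, o \notin K, i \notin K & j \notin K].
  have [|K [sK cK]] := @exists_subset_card _ (~: [set o; i; j]) z.-1.
    have c3 : (#|[set o; i; j]| <= 3)%N by rewrite !cardsU !cards1; lia.
    have := cardsC [set o; i; j]; rewrite card_ord; lia.
  exists K; split=> //; apply/negP => /(subsetP sK); rewrite !inE eqxx ?orbT //.
have hX i : exists d : int, f i = f o + eps *~ d /\
    forall K : {set 'I_n}, #|K| = z.-1 -> o \notin K -> i \notin K -> d = (r (o |: K))%:Z - (r (i |: K))%:Z.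
  have [K [cK oK iK _]] := avoid i i.
  pose dK (K : {set 'I_n}) : int := (r (o |: K))%:Z - (r (i |: K))%:Z.
  have key (K' : {set 'I_n}) : #|K'| = z.-1 -> o \notin K' -> i \notin K' -> f i = f o + eps *~ dK K'.
    move=> cK' oK' iK'; have := swap K' i o cK' iK' oK'.
    rewrite /dK mulrzBr -!pmulrn addrA => <-.
    by zmodule.
  exists (dK K); split; first exact: key.
  move=> K' cK' oK' iK'; apply: mulrz_eq_small.
    by apply: (addrI (f o)); rewrite -!key.
  have := rn K o cK oK; have := rn K i cK iK; have := rn K' o cK' oK'; have := rn K' i cK' iK'.
  rewrite /dK ltr_norml; move: (r (_ |: K')) (r (_ |: K')) (r (_ |: K)) (r (_ |: K)).
  by clear; lia.
have [X hX'] := fin_all_exists hX.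
exists X, (f o); split=> [i|i j]; first by have [] := hX' i.
have [K [cK oK iK jK]] := avoid i j.
have [_ /(_ K cK oK iK) ->] := hX' i; have [_ /(_ K cK oK jK) ->] := hX' j.
have := rn K i cK iK; have := rn K j cK jK.
by rewrite ltr_norml; move: (r _) (r _) (r _); clear; lia.
Qed.

Variables (X : 'I_n -> int) (F : V).
Hypothesis fX : forall i, f i = F + eps *~ X i.
Hypothesis spread : forall i j, `|X i - X j| < n%:Z.

Lemma sum_f (I : {set 'I_n}) : \sum_(i in I) f i = F *+ #|I| + eps *~ (\sum_(i in I) X i).
Proof.
rewrite (eq_bigr (fun i => F + eps *~ X i)) => [|i _]; last exact: fX.
by rewrite big_split /= sumr_const -mulrz_sumr.
Qed.

(** [C] is [r I] plus the sum of [X] over [I]: by [mulrz_eq_small] it does not change when one index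
    of [I] is exchanged for another. *)
Lemma element_coordinate (H : V) (z : nat) (r : {set 'I_n} -> nat) : (z <= n)%N ->
  (forall I : {set 'I_n}, #|I| = z -> (r I < n)%N /\ H = \sum_(i in I) f i + eps *+ r I) ->
  exists C : int, H = F *+ z + eps *~ C /\
    forall I : {set 'I_n}, #|I| = z -> 0 <= C - \sum_(i in I) X i <= n%:Z - 1.
Proof.
move=> zn hr.
have same (I J : {set 'I_n}) : #|I| = z -> #|J| = z ->
    (r I)%:Z + \sum_(i in I) X i = (r J)%:Z + \sum_(i in J) X i.
  move: {2}#|I :\: J| (erefl #|I :\: J|) => s; elim: s I => [|s IH] I es cI cJ.
    have -> // : I = J.
    apply/eqP; rewrite eqEcard cI cJ leqnn andbT -setD_eq0 -cards_eq0 es //.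
  have [i] : exists i, i \in I :\: J by apply/card_gt0P; rewrite es.
  rewrite inE => /andP[iJ iI].
  have [j] : exists j, j \in J :\: I.
    apply/card_gt0P; have := cardsID J I; have := cardsID I J.
    by rewrite setIC cI cJ es; lia.
  rewrite inE => /andP[jI jJ].
  pose I2 := j |: (I :\ i).
  have jI2 : j \notin I :\ i by rewrite !inE negb_and jI orbT.
  have cI1 : #|I :\ i| = z.-1 by have := cardsD1 i I; rewrite iI cI; lia.
  have z0 : (0 < z)%N by rewrite -cI; apply/card_gt0P; exists i.
  have cI2 : #|I2| = z by rewrite /I2 cardsU1 jI2 cI1; lia.
  have eI2 : #|I2 :\: J| = s.
    have -> : I2 :\: J = (I :\: J) :\ i.
      apply/setP => l; rewrite !inE; case: eqVneq => [->|] /=; first by rewrite jJ !andbF.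
      by rewrite andbCA.
    by have := cardsD1 i (I :\: J); rewrite es !inE iJ iI; lia.
  rewrite -(IH I2 eI2 cI2 cJ).
  have sI : \sum_(l in I) X l = X i + \sum_(l in I :\ i) X l by rewrite (big_setD1 i).
  have sI2 : \sum_(l in I2) X l = X j + \sum_(l in I :\ i) X l by rewrite big_setU1.
  have [r1 e1] := hr I cI; have [r2 e2] := hr I2 cI2.
  suff : (r I)%:Z + X i = (r I2)%:Z + X j by rewrite sI sI2; lia.
  apply: mulrz_eq_small; last by have := spread i j; lia.
  move: e2; rewrite {1}e1 !sum_f cI cI2 sI sI2 => /eqP.
  rewrite !mulrzDr -!pmulrn => /eqP e.
  apply: (addrI (F *+ z + eps *~ (\sum_(l in I :\ i) X l))).
  transitivity (F *+ z + (eps *~ X i + eps *~ (\sum_(l in I :\ i) X l)) + eps *+ r I); first by zmodule.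
  by rewrite e; zmodule.
have [I0 [_ c0]] : exists K : {set 'I_n}, K \subset [set: 'I_n] /\ #|K| = z.
  by apply: exists_subset_card; rewrite cardsT card_ord.
exists ((r I0)%:Z + \sum_(i in I0) X i); split.
  have [_ {1}->] := hr I0 c0; rewrite sum_f c0 mulrzDr -pmulrn.
  by zmodule.
move=> I cI; rewrite (same _ _ c0 cI); have [rI _] := hr I cI.
by lia.
Qed.

End Coordinates.

Lemma Zp_natr_mod n a b : (1 < n)%N -> a = b %[mod n] -> a%:R = b%:R :> 'Z_n.
Proof. by move=> n1 e; apply: val_inj; rewrite /= !val_Zp_nat. Qed.

Lemma Zp_natr_eq0 n k : (1 < n)%N -> (k%:R == 0 :> 'Z_n) = (n %| k)%N.
Proof. by move=> n1; rewrite -val_eqE /= val_Zp_nat. Qed.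

(** Exchanging indices shows that distinct values differ by one and that only [v] and [v + 1] occur.
    Since [n v = 0], the total [1] counts the occurrences of [v + 1], so there is exactly one. *)
Lemma two_values n (x : 'I_n -> 'Z_n) z (Y : 'Z_n) : (2 < n)%N -> (0 < z < n)%N ->
  \sum_i x i = 1 ->
  (forall I : {set 'I_n}, #|I| = z -> \sum_(i in I) x i = Y \/ \sum_(i in I) x i = Y + 1) ->
  exists v i0, [/\ forall i, i != i0 -> x i = v, x i0 = v + 1 & Y = v *+ z].
Proof.
move=> n3 hz tot hI; have n1 : (1 < n)%N by lia.
have ne1 : (1 : 'Z_n) <> 0.
  by move/eqP; rewrite (Zp_natr_eq0 1 n1) dvdn1; lia.
have ne2 : (1 + 1 : 'Z_n) <> 0.
  by move/eqP; rewrite (Zp_natr_eq0 2 n1) gtnNdvd.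
have vn (u : 'Z_n) : u *+ n = 0.
  by rewrite -mulr_natr; have /eqP -> : (n%:R == 0 :> 'Z_n); rewrite ?Zp_natr_eq0 // mulr0.
have setC1 (i : 'I_n) : #|~: [set i]| = n.-1.
  by have := cardsC [set i]; rewrite cards1 card_ord; lia.
have compl (i : 'I_n) : \sum_(j in ~: [set i]) x j = 1 - x i.
  apply/eqP; rewrite eq_sym subr_eq -tot; apply/eqP.
  rewrite [LHS](bigD1 i) //= addrC; congr (_ + _).
  by apply: eq_bigl => j; rewrite !inE.
have third a b j : x a != x b -> j != a -> j != b ->
    (x b = x a + 1 \/ x a = x b + 1) /\ (x b = x a + 1 -> x j = x a \/ x j = x a + 1).
  move=> nab ja jb.
  (* For [z = n - 1] the available sums are [1 - x l], otherwise [x l] plus a fixed sum; the sign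
     [s] treats both at once. *)
  have [k1 [s hk]] : exists k (s : bool), forall l, l \in [:: a; b; j] ->
      k + x l *~ (if s then 1 else -1) = Y \/ k + x l *~ (if s then 1 else -1) = Y + 1.
    have [ez|zn] : z = n.-1 \/ (z < n.-1)%N by lia.
      exists 1, false => l _; rewrite mulrNz mulr1z -compl; apply: hI.
      by rewrite setC1.
    have [|K [sK cK]] := @exists_subset_card _ (~: [set a; b; j]) z.-1.
      have c3 : (#|[set a; b; j]| <= 3)%N by rewrite !cardsU !cards1; lia.
      have := cardsC [set a; b; j]; rewrite card_ord; lia.
    exists (\sum_(l in K) x l), true => l hl; rewrite mulr1z addrC.
    have lK : l \notin K.
      apply/negP => /(subsetP sK); rewrite !inE; move: hl; rewrite !inE.
      by case/or3P=> ->; rewrite ?orbT.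
    rewrite -(big_setU1 _ lK); apply: hI; rewrite cardsU1 lK cK; lia.
  have ha := hk a; have hb := hk b; have hj := hk j.
  rewrite !inE !eqxx ?orbT in ha hb hj.
  have {}ha := ha isT; have {}hb := hb isT; have {}hj := hj isT.
  have cancel1 p q : k1 + p *~ (if s then 1 else -1) = q ->
      p = (q - k1) *~ (if s then 1 else -1).
    move=> <-; rewrite [k1 + _]addrC addrK -mulrzA; case: (s); rewrite /= ?mulr1z //.
  have {}ha : x a = (Y - k1) *~ (if s then 1 else -1) \/ x a = (Y + 1 - k1) *~ (if s then 1 else -1).
    by case: ha => /cancel1; [left | right].
  have {}hb : x b = (Y - k1) *~ (if s then 1 else -1) \/ x b = (Y + 1 - k1) *~ (if s then 1 else -1).
    by case: hb => /cancel1; [left | right].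
  have {}hj : x j = (Y - k1) *~ (if s then 1 else -1) \/ x j = (Y + 1 - k1) *~ (if s then 1 else -1).
    by case: hj => /cancel1; [left | right].
  have [u hu] : exists u, [/\ x a = u \/ x a = u + 1, x b = u \/ x b = u + 1 & x j = u \/ x j = u + 1].
    case: (s) ha hb hj => /= ha hb hj.
      exists (Y - k1); rewrite !mulr1z (addrAC Y) in ha hb hj; split=> //.
    exists (- (Y + 1 - k1)); rewrite !mulrNz !mulr1z in ha hb hj.
    have e : - (Y - k1) = - (Y + 1 - k1) + 1 by ring.
    by rewrite e in ha hb hj; split; [case: ha|case: hb|case: hj]; auto.
  have bad : u = u + 1 + 1 -> False.
    by move=> e; apply: ne2; apply: (addrI u); rewrite addrA -e addr0.
  case: hu => -[ea|ea] [eb|eb] hj'; move: nab; rewrite ea eb ?eqxx // => _; split; auto.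
  by move=> e; case: bad.
have [a [b [nab eb]]] : exists a b, x b = x a + 1 /\ a != b.
  pose o : 'I_n := Ordinal (ltnW n1).
  have [i ni|all_eq] := pickP (fun i => x i != x o); last first.
    case: ne1; rewrite -tot (eq_bigr (fun=> x o)) => [|i _]; last first.
      by apply/eqP; have := all_eq i => /negbFE.
    by rewrite sumr_const card_ord vn.
  have [j] : exists j, j \in ~: [set i; o].
    apply/card_gt0P; have := cardsC [set i; o]; rewrite card_ord cards2; case: (i != o) => /=; lia.
  rewrite !inE negb_or => /andP[ji jo].
  have io : i != o by apply: contraNneq ni => ->.
  have [[e|e] _] := third i o j ni ji jo; first by exists i, o.
  by exists o, i; rewrite eq_sym.
set v := x a in nab.
have nvb : x a != x b by rewrite nab; apply/eqP => e; apply: ne1; apply: (addrI (x a)); rewrite addr0 -e.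
have vals j : x j = v \/ x j = v + 1.
  have [->|ja] := eqVneq j a; first by left.
  have [->|jb] := eqVneq j b; first by right.
  by have [_ /(_ nab)] := third a b j nvb ja jb.
pose P := [set j | x j == v + 1].
have vv : (v == v + 1) = false.
  by apply/eqP => e; apply: ne1; apply: (addrI v); rewrite addr0 -e.
have cP : #|P| = 1%N.
  have eP : \sum_i x i = (#|P|%:R : 'Z_n).
    rewrite (eq_bigr (fun i => v + (i \in P)%:R)) => [|i _]; last first.
      by rewrite inE; case: (vals i) => ->; rewrite ?eqxx ?vv ?addr0.
    rewrite big_split /= sumr_const card_ord vn add0r -natr_sum; congr (_%:R); rewrite -sum1_card [RHS]big_mkcond /=.
    by apply: eq_bigr => i _; case: (i \in P).
  have b1 : (0 < #|P|)%N by apply/card_gt0P; exists b; rewrite inE nab.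
  have P1 : (#|P| < n)%N.
    rewrite -[X in (_ < X)%N](card_ord n) -cardsT; apply: proper_card.
    by apply/properP; split; [exact: subsetT | exists a; rewrite ?inE // vv].
  have : (#|P|.-1%:R == 0 :> 'Z_n).
    by apply/eqP; apply: (addIr 1); rewrite natr1 prednK // -eP tot add0r.
  rewrite Zp_natr_eq0 // => /dvdn_leq; lia.
have vi i : i != b -> x i = v.
  move=> ib; case: (vals i) => // ei; exfalso.
  have : (#|[set i; b]| <= #|P|)%N.
    by apply: subset_leq_card; apply/subsetP => l; rewrite !inE => /orP[] /eqP->; rewrite ?ei ?nab.
  by rewrite cards2 ib cP.
exists v, b; split=> //.
have sumv (K : {set 'I_n}) : b \notin K -> \sum_(i in K) x i = v *+ #|K|.
  move=> bK; rewrite -sumr_const; apply: eq_bigr => i iK; apply: vi.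
  by apply: contraTneq iK => ->.
have [|K [sK cK]] := @exists_subset_card _ (~: [set b]) z; first by rewrite setC1; lia.
have bK : b \notin K by apply/negP => /(subsetP sK); rewrite !inE eqxx.
have [|K' [sK' cK']] := @exists_subset_card _ (~: [set b]) z.-1; first by rewrite setC1; lia.
have bK' : b \notin K' by apply/negP => /(subsetP sK'); rewrite !inE eqxx.
have e1 := hI K cK; rewrite sumv // cK in e1.
have cb : #|b |: K'| = z by rewrite cardsU1 bK' cK'; lia.
have e2 := hI _ cb; rewrite big_setU1 //= sumv // cK' nab in e2.
have ez : v + 1 + v *+ z.-1 = v *+ z + 1 by rewrite addrAC -mulrS prednK //; case/andP: hz.
rewrite ez in e2; case: e1 => // e1; exfalso; rewrite e1 in e2.
case: e2 => [e|/addIr e].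
  by apply: ne2; apply: (addrI Y); rewrite addrA e addr0.
by apply: ne1; apply: (addrI Y); rewrite e addr0.
Qed.

(** * The remainder for [k = 1]: index sets and normal form *)

Lemma list_ord (V : zmodType) n (L : seq V) : size L = n ->
  L = [seq nth 0 L (i : 'I_n) | i <- enum 'I_n].
Proof.
move=> sL; rewrite -{1}[L](mkseq_nth 0) /mkseq sL -val_enum_ord -map_comp.
by [].
Qed.

Definition pick_seq (V : zmodType) n (L : seq V) (I : {set 'I_n}) : seq V :=
  [seq nth 0 L (i : 'I_n) | i <- enum I].

Lemma perm_pick (V : zmodType) n (L : seq V) (I : {set 'I_n}) : size L = n ->
  perm_eq L (pick_seq L I ++ pick_seq L (~: I)).
Proof.
move=> sL; rewrite {1}(list_ord sL) -map_cat; apply: perm_map; rewrite perm_sym.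
apply: uniq_perm; rewrite ?cat_uniq ?enum_uniq //= ?andbT.
  by apply/hasPn => i; rewrite !mem_enum inE.
by move=> i; rewrite mem_cat !mem_enum !inE orbN.
Qed.

Lemma sg_pick (V : zmodType) n (L : seq V) (I : {set 'I_n}) :
  sg (pick_seq L I) = \sum_(i in I) nth 0 L i.
Proof. by rewrite big_map big_enum. Qed.

Lemma size_pick (V : zmodType) n (L : seq V) (I : {set 'I_n}) : size (pick_seq L I) = #|I|.
Proof. by rewrite size_map -cardE. Qed.

(** Among [2 n] elements, omitting any [y] leaves [2 n - 1], whose zero-sum must use all of them. So
    every [y] equals the total, and [n] equal elements sum to [0]. *)
Lemma davenport_bound (U : zmodType) n : (1 < n)%N -> (forall u : U, u *+ n = 0) ->
  (forall s : seq U, (2 * n - 1 <= size s)%N ->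
     exists T R, [/\ perm_eq s (T ++ R), (0 < size T)%N & sg T = 0]) ->
  forall s : seq U, zsfree (2 * n - 2) s -> (size s < 2 * n)%N.
Proof.
move=> n1 Un dav s0 z0; rewrite ltnNge; apply/negP => le.
pose s := take (2 * n) s0.
have ss : size s = (2 * n)%N by rewrite size_takel.
have zs : zsfree (2 * n - 2) s.
  by move=> T R p; apply: (z0 T (R ++ drop (2 * n) s0)); have := perm_take s0 (2 * n); rewrite -/s => p'; perm_count.
have all_eq y : y \in s -> y = sg s.
  move=> /mem_perm_cons [r p]; have := perm_size p; rewrite ss /= => sr.
  have [|T [R [pT T0 zT]]] := dav r; first by lia.
  have sT := perm_size pT; rewrite size_cat in sT.
  have R0 : R = [::].
    apply/nilP; rewrite /nilp; apply/eqP; apply/eqP; rewrite -leqn0 leqNgt; apply/negP => R0.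
    by apply: (zs T (y :: R)) => //; [perm_count | slia].
  rewrite (sg_perm p) sg_cons; have -> : sg r = 0 by rewrite (sg_perm pT) R0 cats0.
  by rewrite addr0.
have es : s = nseq (2 * n) (sg s) by apply: nseq_of_all.
apply: (zs (nseq n (sg s)) (nseq n (sg s))); rewrite ?size_nseq ?sg_nseq ?Un //; last by lia.
by rewrite {1}es mulSn mul1n nseqD.
Qed.

(** Item 2(a) for [m = 1], stripped of directness, of the order of [e2] and of the range of the
    coefficients. *)
Definition line_form (U : zmodType) n (s : seq U) : Prop :=
  exists e1 e2 (xs : seq nat), [/\ generates e1 e2, size xs = n, sumn xs = 1 %[mod n]
    & perm_eq s (nseq n.-1 e1 ++ [seq e1 *+ x + e2 | x <- xs])].

Section Davenport.
Variables (V U : zmodType) (phi : {additive V -> U}) (n m : nat) (w : V).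
Hypothesis red : reduction phi n m w.
Let n1 := red_n red.
Let m1 := red_m red.
Let Un := red_exp red.
Let indep := red_indep red.
Hypothesis U_bound : forall s : seq U, zsfree (2 * n - 1 - 1) s -> (size s < 2 * n - 1 + 1)%N.
Hypothesis H_line : forall s : seq U, size s = (2 * n - 2 + 1)%N ->
  zsfree (2 * n - 1 - 1) s -> line_form n s.
Let hk : (0 < 1 < n)%N.
Proof. exact: n1. Qed.

Lemma mulrn_modU (u : U) i j : i = j %[mod n] -> u *+ i = u *+ j.
Proof.
have um l : u *+ l = u *+ (l %% n).
  by rewrite {1}(divn_eq l n) mulrnDr mulnC mulrnA Un mul0rn add0r.
by move=> e; rewrite (um i) (um j) e.
Qed.

Lemma phi_sg_const (T : seq V) (u : U) : (forall v, v \in T -> phi v = u) ->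
  phi (sg T) = u *+ size T.
Proof.
move=> h; rewrite phi_sg (@nseq_of_all _ u (map phi T) (size T)) ?sg_nseq ?size_map //.
by move=> y /mapP [v vT ->]; apply: h.
Qed.

Section FixDec.
Variables (S W : seq V) (Bs : seq (seq V)).
Hypothesis hS : extremal n m 1 S.
Hypothesis hd : dec phi n m 1 S W Bs.

Let hB B : B \in Bs -> size B = n /\ phi (sg B) = 0.
Proof. by case: hd => _ _ h _ _; exact: h. Qed.

(** In [B], the elements indexed by [J] are exchanged for elements of [W]. As [J] is nonempty the
    result has at most [(n - 1) + n + (n - 1) = 3 n - 2] elements, the limit of [dec_exchange] for
    [k = 1]. *)
Lemma subsum_exchange B WA WF RA RA' (I J : {set 'I_n}) : B \in Bs ->
  perm_eq W (WA ++ WF) -> size WA = n.-1 -> size WF = n -> perm_eq WA (RA ++ RA') ->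
  J != set0 -> (0 < (n - #|J|) + #|I| + size RA)%N ->
  phi (\sum_(j in J) nth 0 B j) = phi (\sum_(i in I) nth 0 WF i + sg RA) ->
  \sum_(j in J) nth 0 B j = \sum_(i in I) nth 0 WF i + sg RA.
Proof.
move=> BB pW sA sF pA J0 pos e; have [sB zB] := hB BB.
have pF := perm_pick I sF; have pB := perm_pick J sB.
have sAA := perm_size pA; rewrite size_cat in sAA.
have cJ : (0 < #|J|)%N by rewrite card_gt0.
have cC := cardsC J; rewrite card_ord in cC.
have cI : (#|I| <= n)%N by have := max_card (mem I); rewrite card_ord.
rewrite -(sg_pick B) -(sg_pick WF) in e *.
apply: (addIr (sg (pick_seq B (~: J)))).
have sgB : sg B = sg (pick_seq B J) + sg (pick_seq B (~: J)) by rewrite {1}(sg_perm pB) sg_cat.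
rewrite -sgB; apply/esym.
have <- : sg ((pick_seq WF I ++ RA) ++ pick_seq B (~: J)) =
  sg (pick_seq WF I) + sg RA + sg (pick_seq B (~: J)) by rewrite !sg_cat.
apply: (dec_exchange red hk hS hd BB (R := pick_seq WF (~: I) ++ RA' ++ pick_seq B J)).
- by perm_count.
- by rewrite !size_cat !size_pick; clear - pos cJ cC cI sAA sA; lia.
- by rewrite !sg_cat raddfD -e -raddfD -sgB.
Qed.

(** [H_line] only describes [phi(W)], and the part over [e1] might contain [u <> v]. In that case
    [n - 1] of the other elements turn out to equal a block element [h], which takes over the role
    of [eps]. *)
Lemma line_normal_form : exists eps e2 (WF : seq V) (xs : seq nat),
  [/\ perm_eq W (nseq n.-1 eps ++ WF), generates (phi eps) e2, size xs = n,
      sumn xs = 1 %[mod n] & map phi WF = [seq phi eps *+ x + e2 | x <- xs]].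
Proof.
case: (hd) => _ sBs _ szW zW.
have [|e1 [e2 [xs [gab sx tx p]]]] := H_line _ zW; first by rewrite size_map.
have [WA [WF [pW eA eF]]] := perm_map_cat_lift p.
have sA : size WA = n.-1 by rewrite -(size_map phi) eA size_nseq.
have sF : size WF = n by rewrite -(size_map phi) eF size_map.
have phiA v : v \in WA -> phi v = e1.
  by move/(map_f phi); rewrite eA mem_nseq => /andP[_ /eqP].
have hA : head 0 WA \in WA.
  by case: WA sA {pW eA phiA} => [|u WA] /= sA; [exfalso; clear - sA n1; lia | exact: mem_head].
case: (boolP (all (pred1 (head 0 WA)) WA)) => [/allP allA|].
  exists (head 0 WA), e2, WF, xs; rewrite phiA // -(@nseq_of_all _ (head 0 WA) WA n.-1) //.
  by move=> y yA; apply/eqP; exact: allA.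
case/allPn => u uA /= nu; set v := head 0 WA in hA nu.
have [WA1 pA1] := mem_perm_cons uA.
have : v \in WA1 by move: hA; rewrite (perm_mem pA1) in_cons eq_sym (negbTE nu).
case/mem_perm_cons => K pK.
have sK : n.-1 = (size K).+2 by rewrite -sA (perm_size pA1) /= (perm_size pK).
have n3 : (2 < n)%N by clear - sK; lia.
have [B BB] : exists B, B \in Bs.
  by case: (Bs) sBs => [|B Bs'] /= hs; [exfalso; clear - hs m1; lia | exists B; rewrite mem_head].
have [sB zB] := hB BB.
pose o : 'I_n := Ordinal (ltnW n1); pose h := nth 0 B o.
have hin : h \in B by apply: mem_nth; rewrite sB.
pose f (i : 'I_n) := nth 0 WF i; pose x (i : 'I_n) := nth 0%N xs i.
have phif i : phi (f i) = e1 *+ x i + e2.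
  have := congr1 (nth 0 ^~ i) eF; rewrite (nth_map 0) ?sF // => ->.
  by rewrite (nth_map 0%N) ?sx.
have phifI (I : {set 'I_n}) : phi (\sum_(i in I) f i) = e1 *+ (\sum_(i in I) x i) + e2 *+ #|I|.
  rewrite raddf_sum (eq_bigr (fun i => e1 *+ x i + e2)) => [|i _]; last exact: phif.
  by rewrite big_split /= sumr_const -sumrMnr.
(* With [0 < r < n - 1] elements over [e1], one may use either [u] or [v] and leave the other, and
   both choices would give the same sum. *)
have noR (I : {set 'I_n}) r : (0 < r < n.-1)%N -> phi h = phi (\sum_(i in I) f i) + e1 *+ r -> False.
  move=> hr e.
  have pt := perm_take K r.-1.
  have st : size (take r.-1 K) = r.-1 by rewrite size_takel //; clear - hr sK; lia.
  have key y y' : perm_eq WA [:: y, y' & K] -> h = \sum_(i in I) f i + sg (y :: take r.-1 K).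
    move=> py; have := @subsum_exchange B WA WF (y :: take r.-1 K) (y' :: drop r.-1 K) I [set o] BB pW sA sF.
    rewrite !big_set1; apply.
    - by perm_count.
    - by apply/set0Pn; exists o; rewrite inE.
    - by rewrite addnS.
    - rewrite raddfD (phi_sg_const (u := e1)); last first.
        move=> l lT; apply: phiA; rewrite (perm_mem py) in_cons.
        by move: lT; rewrite !in_cons => /orP[->//|/mem_take ->]; rewrite !orbT.
      by rewrite /= st prednK //; case/andP: hr.
  have e1' : h = \sum_(i in I) f i + sg (u :: take r.-1 K) by apply: (key u v); perm_count.
  have e2' : h = \sum_(i in I) f i + sg (v :: take r.-1 K) by apply: (key v u); perm_count.
  by move/eqP: nu; apply; move: e1'; rewrite {1}e2' => /addrI; rewrite !sg_cons => /addIr.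
have [B1 pB1] := mem_perm_cons hin.
have [y [z' eh]] := gab (phi h).
pose z := (z' %% n)%N.
have {}eh : phi h = e1 *+ y + e2 *+ z by rewrite eh; congr (_ + _); apply: mulrn_modU; rewrite modn_mod.
have zn : (z < n)%N by rewrite ltn_pmod // ltnW.
have [z0|z0] := posnP z.
  exfalso; rewrite z0 mulr0n addr0 in eh.
  have {}eh : phi h = e1 *+ (y %% n) by rewrite eh; apply: mulrn_modU; rewrite modn_mod.
  have := ltn_pmod y (ltnW n1); set r := (y %% n)%N in eh *; move=> rn.
  have [r0|r0] := posnP r.
    rewrite r0 mulr0n in eh.
    have := @dec_no_short _ _ _ _ _ _ red 1%N hk U_bound S W Bs B [:: h] (W ++ B1) hS hd BB.
    rewrite big_seq1 => /(_ _ (ltnW n1) eh) e; have : 1%N = n by apply: e; perm_count.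
    by clear - n3; lia.
  have [rn1|rn1] := ltnP r n.-1.
    by apply: (noR set0 r); [rewrite r0 | rewrite big_set0 raddf0 add0r].
  have := @dec_no_short _ _ _ _ _ _ red 1%N hk U_bound S W Bs B [:: h; u] (v :: K ++ WF ++ B1) hS hd BB.
  have e0 : phi (sg [:: h; u]) = 0.
    rewrite sg_cons big_seq1 raddfD eh (phiA u uA) -mulrSr.
    by have -> : r.+1 = n by clear - rn rn1; lia.
  have n2 : (0 < size [:: h; u] <= n)%N by clear - n3; rewrite /=; lia.
  move=> /(_ _ n2 e0) e; have : 2%N = n by apply: e; perm_count.
  by clear - n3; lia.
(* Only [r = 0] and [r = n - 1] remain possible, so the [z]-sums of the [x i] take at most the
   values [y] and [y + 1] modulo [n]. *)
have [|||v0 [i0 [v1 v2 v3]]] := @two_values n (fun i => (x i)%:R) z (y%:R) n3.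
- by rewrite z0.
- have eZ : (sumn xs)%:R = 1 :> 'Z_n := Zp_natr_mod n1 tx.
  rewrite -[RHS]eZ.
  rewrite -natr_sum; congr (_%:R); rewrite sumnE (big_nth 0%N) sx big_mkord.
  by [].
- move=> I cI; pose s := (\sum_(i in I) x i)%N.
  rewrite -natr_sum -/s; pose r := ((y + n.-1 * s) %% n)%N.
  have rn : (r < n)%N by rewrite ltn_pmod // ltnW.
  have sr : s + r = y %[mod n].
    rewrite /r modnDmr addnCA -mulSn prednK; last by rewrite ltnW.
    by rewrite addnC mulnC modnMDl.
  have er : phi h = phi (\sum_(i in I) f i) + e1 *+ r.
    rewrite phifI cI -/s addrAC -mulrnDr eh; congr (_ + _).
    exact: mulrn_modU.
  have srZ : s%:R + r%:R = y%:R :> 'Z_n.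
    by rewrite -natrD; apply: Zp_natr_mod.
  have [r0|r0] := posnP r; first by left; rewrite -srZ r0 addr0.
  have [rn1|rn1] := ltnP r n.-1; first by case: (noR I r); rewrite ?r0.
  have er1 : r.+1 = n by clear - rn rn1; lia.
  right; rewrite -srZ -addrA natr1 er1.
  by have /eqP -> : (n%:R == 0 :> 'Z_n); rewrite ?Zp_natr_eq0 // addr0.
pose v' : nat := v0.
have xi i : i != i0 -> x i = v' %[mod n].
  move=> ni; have := congr1 val (v1 i ni); rewrite /= val_Zp_nat // => ->.
  by rewrite modn_small //; have := ltn_ord v0; rewrite [X in (_ < X)%N]Zp_cast.
have v0E : v0 = v'%:R by rewrite /v' natr_Zp.
have xi0 : x i0 = v'.+1 %[mod n].
  by have := congr1 val v2; rewrite v0E natr1 /= !val_Zp_nat.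
have yE : y = v' * z %[mod n].
  by have := congr1 val v3; rewrite v0E -mulrnA /= !val_Zp_nat.
pose f0 := e1 *+ v' + e2.
have phif0 i : i != i0 -> phi (f i) = f0.
  by move=> ni; rewrite phif /f0; congr (_ + _); apply: mulrn_modU; exact: xi.
have phih : phi h = f0 *+ z.
  rewrite eh /f0 mulrnDl -mulrnA; congr (_ + _); exact: mulrn_modU.
(* [h] together with [n - z] elements of image [f0] is a kernel sum of length [n - z + 1], and short
   kernel sums have length [n]. *)
have z1 : z = 1%N.
  have [|Kz [sKz cKz]] := @exists_subset_card _ (~: [set i0]) (n - z).
    have := cardsC [set i0]; rewrite cards1 card_ord; clear - z0 zn; lia.
  have pF := perm_pick Kz sF.
  have := @dec_no_short _ _ _ _ _ _ red 1%N hk U_bound S W Bs B (h :: pick_seq WF Kz)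
    (WA ++ pick_seq WF (~: Kz) ++ B1) hS hd BB.
  rewrite /= size_pick cKz => hh.
  suff : (n - z).+1 = n by clear - zn; lia.
  apply: hh.
  - move: pF; set P1 := pick_seq WF Kz; set P2 := pick_seq WF _ => pF.
    move: (P1) (P2) (h) pF pB1 pW; clear => ? ? ? ? ? ?; perm_count.
  - by clear - z0 zn; lia.
  - rewrite sg_cons raddfD phih (phi_sg_const (u := f0)).
      by rewrite size_pick cKz -mulrnDr subnKC ?Un // ltnW.
    move=> l /mapP [i]; rewrite mem_enum => iK ->; apply: phif0.
    by apply: contraTneq iK => ->; apply/negP => /(subsetP sKz); rewrite !inE eqxx.
rewrite z1 mulr1n in phih.
have inW l : l \in WF -> l \in W by move=> lF; rewrite (perm_mem pW) mem_cat lF orbT.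
have fh i : i != i0 -> f i = h.
  move=> ni; apply: (dec_swap red hk hS hd BB) => //; last by rewrite phih phif0.
  by apply: inW; apply: mem_nth; rewrite sF.
have pF := perm_pick [set i0] sF.
have e1F : pick_seq WF [set i0] = [:: f i0] by rewrite /pick_seq enum_set1.
have e2F : pick_seq WF (~: [set i0]) = nseq n.-1 h.
  apply: nseq_of_all; first by rewrite size_pick; have := cardsC [set i0]; rewrite cards1 card_ord; move=> /(congr1 predn).
  by move=> l /mapP [i]; rewrite mem_enum !inE => ni ->; apply: fh.
(* The old [e1] becomes the second generator: the image of [f i0] is [phi h + e1], and those of [WA]
   are [e1]. *)
exists h, e1, (f i0 :: WA), (1%N :: nseq n.-1 0%N); split.
- by rewrite e1F e2F in pF; perm_count.
- move=> q; have [i [j ->]] := gab q; rewrite phih.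
  exists j, (i + (n - v' %% n) * j)%N.
  rewrite /f0 mulrnDl mulrnDr mulrnA; rewrite -(mulrn_modU e1 (modn_mod v' n)).
  have -> : e1 *+ (v' %% n) *+ j + e2 *+ j + (e1 *+ i + e1 *+ (n - v' %% n) *+ j) =
     e1 *+ i + e2 *+ j + (e1 *+ (v' %% n) + e1 *+ (n - v' %% n)) *+ j by rewrite mulrnDl; zmodule.
  by rewrite -mulrnDr subnKC ?Un ?mul0rn ?addr0 // ltnW // ltn_pmod // ltnW.
- by rewrite /= size_nseq prednK // ltnW.
- by rewrite /= sumn_nseq mul0n.
- rewrite /= mulr1n phih; congr (_ :: _).
    rewrite phif (mulrn_modU _ xi0) /f0 mulrSr; zmodule.
  by rewrite eA map_nseq mulr0n add0r.
Qed.

End FixDec.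
End Davenport.

(* The [X i] are the [eps]-coordinates of the elements of [W] of the form [F + X i eps], and
   [h_j = z j F + C j eps] are the elements of a block. Adding the [h_j] one at a time, each
   partial sum differs from a sum of elements of [W] by less than [n eps], which bounds the
   total of the [C j] by [2 n - 1] and forces [C j = 1]. *)
Section BlockCoordinates.
Variables (V : zmodType) (n : nat) (eps F g : V).
Variables (X : 'I_n -> int) (z : 'I_n -> nat) (C : 'I_n -> int).
Hypothesis n1 : (1 < n)%N.
Hypothesis eps_dvd : forall d : int, eps *~ d = 0 -> (n%:Z %| d)%Z.
Hypothesis eps_n : eps *+ n <> 0.
Hypothesis g0 : g <> 0.
Hypothesis sumX : \sum_i X i = 1.
Hypothesis nF : F *+ n + eps *+ n = g.
Hypothesis zn : forall j, (z j < n)%N.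
Hypothesis z0C : forall j, z j = 0%N -> C j = 1.
Hypothesis single : forall j (I : {set 'I_n}), #|I| = z j ->
  0 <= C j - \sum_(i in I) X i <= n%:Z - 1.
Hypothesis exchange : forall J I : {set 'I_n}, J != set0 -> J != setT ->
  #|I| = ((\sum_(j in J) z j) %% n)%N ->
  exists2 r : nat, (r < n)%N &
    (n%:Z %| \sum_(j in J) C j - \sum_(i in I) X i - r%:Z)%Z /\
    F *+ (\sum_(j in J) z j) + eps *~ (\sum_(j in J) C j) =
    F *+ #|I| + eps *~ (\sum_(i in I) X i) + eps *+ r.
Hypothesis tz : (n %| \sum_j z j)%N.
Hypothesis tC : (n%:Z %| \sum_j C j)%Z.

Let F0 : eps *+ n = g -> F *+ n = 0.
Proof. by move=> e; apply: (addIr (eps *+ n)); rewrite nF add0r. Qed.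

Let XC (I : {set 'I_n}) : \sum_(i in I) X i + \sum_(i in ~: I) X i = 1.
Proof.
rewrite -sumX [RHS](bigID (mem I)) /=; congr (_ + _).
by apply: eq_bigl => i; rewrite inE.
Qed.

(** Let [a] be the old sum of the [z] modulo [n]. If [a + z j < n], then [I] splits into sets of
    sizes [a] and [z j] and the bounds add up. Otherwise enlarge [I] by [K] to size [a] and use the
    complement of [K] for [z j]; this adds the total [1] of the [X i] and allows an error [t n] with
    [t] equal to [0] or [1]. Here [t = 1] would give [g = 0], while [t = 0] gives [n F = 0], so
    [n eps = g]. *)
Lemma partial_coordinates (J : {set 'I_n}) : J != setT ->
  (forall I : {set 'I_n}, #|I| = ((\sum_(j in J) z j) %% n)%N ->
     0 <= \sum_(j in J) C j - \sum_(i in I) X i <= n%:Z - 1) /\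
  ((n <= \sum_(j in J) z j)%N -> eps *+ n = g).
Proof.
move: {2}#|J| (erefl #|J|) => s; elim: s J => [|s IH] J cJ JT.
  rewrite (cards0_eq cJ) !big_set0 mod0n; split=> [I /cards0_eq ->|].
    by rewrite big_set0 subr0; clear - n1; lia.
  by clear - n1; lia.
have [j jJ] : exists j, j \in J by apply/card_gt0P; rewrite cJ.
have jJ' : j \notin J :\ j by rewrite !inE eqxx.
have [||IH1 IH2] := IH (J :\ j).
- by have := cardsD1 j J; rewrite jJ cJ add1n => -[].
- by apply: contraNneq jJ' => ->; rewrite inE.
have J0 : J != set0 by apply/set0Pn; exists j.
have ex := fun I => exchange (J := J) (I := I) J0 JT.
have sJ := @single j; have zj := zn j.
rewrite (big_setD1 j jJ) (big_setD1 j jJ) /= in ex *.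
move: IH1 IH2 ex.
set Z := (\sum_(i in J :\ j) z i)%N; set D : int := \sum_(i in J :\ j) C i => IH1 IH2 ex.
have eZ := divn_eq Z n; have aZ := ltn_pmod Z (ltnW n1).
set q := (Z %/ n)%N in eZ; set a := (Z %% n)%N in eZ aZ IH1.
have Fq l : (F *+ n = 0) \/ l = 0%N -> F *+ (l * n) = 0.
  by case=> [e|->]; rewrite ?mul0n // mulnC mulrnA e mul0rn.
have hq : F *+ n = 0 \/ q = 0%N.
  have [q0|q0] := posnP q; [by right | left; apply: F0; apply: IH2].
  by rewrite eZ; case: (q) q0 => // q' _; rewrite mulSn -addnA leq_addr.
have [ab|ab] := ltnP (a + z j) n.
  have eM : (z j + Z = q * n + (a + z j))%N by rewrite {1}eZ; clear; lia.
  have mM : ((z j + Z) %% n = a + z j)%N by rewrite eM modnMDl modn_small.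
  split=> [I|le]; last first.
    apply: IH2; have [q0|q0] := posnP q; first by move: le; rewrite eM q0 mul0n add0n; clear - ab; lia.
    by rewrite eZ; case: (q) q0 => // q' _; rewrite mulSn -addnA leq_addr.
  rewrite mM => cI.
  have [r rn [_ e]] := ex I (etrans cI (esym mM)).
  have [|I' [sI' cI']] := @exists_subset_card _ I a; first by rewrite cI leq_addr.
  have cI'' : #|I :\: I'| = z j.
    by have := cardsD I I'; rewrite (setIidPr sI') cI cI' addKn.
  have eX : \sum_(i in I) X i = \sum_(i in I') X i + \sum_(i in I :\: I') X i.
    by rewrite (big_setID I') /= (setIidPr sI').
  have b1 := IH1 I' cI'; have b2 := sJ _ cI''.
  have : C j + D - \sum_(i in I) X i - r%:Z = 0.
    apply: (small_multiple0 (eps := eps) (n := n)) => //.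
      rewrite !mulrzBr -pmulrn.
      move: e; rewrite eM cI mulrnDr Fq // add0r -!addrA => /addrI -> .
      by zmodule.
    move: b1 b2 rn; rewrite eX; move: (\sum_(i in I') X i) (\sum_(i in I :\: I') X i) (C j) (D).
    by clear; lia.
  by move/eqP; rewrite subr_eq0 => /eqP ->; move: rn; clear; lia.
have eM : (z j + Z = q.+1 * n + (a + z j - n))%N by rewrite {1}eZ mulSn; clear - ab; lia.
have mM : ((z j + Z) %% n = a + z j - n)%N by rewrite eM modnMDl modn_small //; clear - aZ zj; lia.
have key (I : {set 'I_n}) : #|I| = (a + z j - n)%N ->
    0 <= C j + D - \sum_(i in I) X i <= n%:Z - 1 /\ eps *+ n = g.
  move=> cI; have [r rn [dv e]] := ex I (etrans cI (esym mM)).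
  have cCI := cardsC I; rewrite card_ord in cCI.
  have [|K [sK cK]] := @exists_subset_card _ (~: I) (n - z j).
    by move: cCI; rewrite cI; clear - aZ zj ab; lia.
  have dIK : I :&: K = set0.
    by apply/setP => i; rewrite !inE; apply/negP => /andP[iI /(subsetP sK)]; rewrite inE iI.
  have cI' : #|I :|: K| = a.
    by rewrite cardsU dIK cards0 subn0 cI cK; clear - ab zj; lia.
  have cI'' : #|~: K| = z j.
    have := cardsC K; rewrite card_ord cK; clear - zj; lia.
  have eX : \sum_(i in I :|: K) X i = \sum_(i in I) X i + \sum_(i in K) X i.
    rewrite -bigU /=; last by rewrite -setI_eq0 dIK.
    by apply: eq_bigl => i; rewrite !inE.
  have := XC K; have b1 := IH1 _ cI'; have b2 := sJ _ cI'' => eK.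
  have [t et] : exists t : int, C j + D - \sum_(i in I) X i - r%:Z = t * n%:Z.
    by case/dvdzP: dv => t et; exists t.
  (* The bounds place [t n] between [2 - n] and [2 n - 1]. *)
  have ht : t = 0 \/ t = 1.
    move: b1 b2 rn et eK; rewrite eX.
    move: (\sum_(i in I) X i) (\sum_(i in K) X i) (\sum_(i in ~: K) X i) (C j) (D).
    by clear - n1; nia.
  have e' : F *+ (q.+1 * n) + eps *+ n *~ t = 0.
    have -> : eps *+ n *~ t = eps *~ (t * n%:Z) by rewrite mulrC mulrzA -pmulrn.
    rewrite -et !mulrzBr -pmulrn; move: e; rewrite eM cI mulrnDr => e.
    apply: (addIr (F *+ (a + z j - n) + eps *~ (\sum_(i in I) X i) + eps *+ r)).
    by rewrite add0r -[RHS]e; zmodule.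
  case: ht => ht; rewrite ht in e' et.
    split; first by move/eqP: et; rewrite mul0r subr_eq0 => /eqP ->; move: rn; clear; lia.
    move: e'; rewrite mulr0z addr0; case: hq => [nF0 _|->].
      by rewrite -nF nF0 add0r.
    by rewrite mul1n => nF0; rewrite -nF nF0 add0r.
  exfalso; move: e'; rewrite mulr1z; case: hq => [nF0|->].
    by rewrite mulnC mulrnA nF0 mul0rn add0r.
  by rewrite mul1n nF.
split=> [I|_]; first by rewrite mM => /key [].
have [|I [_ cI]] := @exists_subset_card _ [set: 'I_n] (a + z j - n)%N.
  by rewrite cardsT card_ord; clear - aZ zj; lia.
by have [] := key I cI.
Qed.

(** If [C j <= 0], all [z j]-sums of [X] are at most [0], and [sum_bounded_up] carries this over to
    the full sum, which is [1]. *)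
Let C_ge1 j : 1 <= C j.
Proof.
have [/z0C -> //|zj] := posnP (z j).
rewrite leNgt; apply/negP => C1.
have := @sum_bounded_up n X (z j) 0 (lexx _) _ _ [set: 'I_n] _.
rewrite (eq_bigl xpredT) ?sumX => [h|i]; last by rewrite inE.
have : 1 <= 0 :> int; last by [].
apply: h; rewrite ?cardsT ?card_ord //.
- by move=> I cI; have := single cI; move: C1; clear; lia.
- by apply: ltnW; apply: zn.
Qed.

Let splitC l : \sum_i C i = C l + \sum_(i in ~: [set l]) C i.
Proof. by rewrite (bigD1 l) //=; congr (_ + _); apply: eq_bigl => i; rewrite !inE. Qed.

Let splitz l : (\sum_i z i = z l + \sum_(i in ~: [set l]) z i)%N.
Proof. by rewrite (bigD1 l) //=; congr (_ + _)%N; apply: eq_bigl => i; rewrite !inE. Qed.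

Let neqT (l : 'I_n) : ~: [set l] != setT.
Proof. by apply/negP => /eqP/setP/(_ l); rewrite !inE eqxx. Qed.

Lemma coordinates_eq1 j : C j = 1.
Proof.
pose o : 'I_n := Ordinal (ltnW n1).
have [h _] := partial_coordinates (neqT o).
have zo := zn o; have az := ltn_pmod (\sum_(j in ~: [set o]) z j)%N (ltnW n1).
have dz : (n %| z o + (\sum_(j in ~: [set o]) z j) %% n)%N.
  by rewrite /dvdn modnDmr; move: tz; rewrite (splitz o).
have bnd : 0 <= \sum_i C i <= (2 * n)%:Z - 1.
  rewrite (splitC o).
  have [e0|e0] := posnP (z o).
    have ea : ((\sum_(j in ~: [set o]) z j) %% n = 0)%N.
      by apply/eqP; rewrite e0 add0n in dz; move: dz az; rewrite /dvdn modn_mod.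
    have := h set0; have := @single o set0; rewrite cards0 ea e0 big_set0.
    by move=> /(_ erefl) b1 /(_ erefl); move: b1 (\sum_(i in _) C i); clear - n1; lia.
  have ea : (z o + (\sum_(j in ~: [set o]) z j) %% n = n)%N.
    case/dvdnP: dz => d; move: zo az e0; move: (z o) (_ %% n)%N; clear => a b an bn a0.
    by case: d => [|[|d]]; rewrite ?mul0n ?mul1n ?mulSn; lia.
  have [|I [_ cI]] := @exists_subset_card _ [set: 'I_n] (z o).
    by rewrite cardsT card_ord ltnW.
  have cCI : #|~: I| = ((\sum_(j in ~: [set o]) z j) %% n)%N.
    by have := cardsC I; rewrite card_ord cI; move: ea; clear; lia.
  have b1 := single cI; have b2 := h _ cCI; have := XC I.
  move: b1 b2; move: (\sum_(i in [set~ o]) C i) (\sum_(i in I) X i) (\sum_(i in ~: I) X i) (C o).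
  by clear; lia.
have ge : n%:Z <= \sum_i C i.
  apply: le_trans (_ : \sum_(i < n) (1 : int) <= _); last by apply: ler_sum => i _; exact: C_ge1.
  by rewrite sumr_const card_ord natz.
have eT : \sum_i C i = n%:Z.
  case/dvdzP: tC => d ed; move: bnd ge; rewrite ed; clear - n1 => bnd ge.
  have [d0|[->|d2]] : d <= 0 \/ (d = 1 \/ 2 <= d) by lia.
  - by exfalso; nia.
  - by rewrite mul1r.
  - by exfalso; nia.
have h0 : \sum_i (C i - 1) = 0 by rewrite sumrB eT sumr_const card_ord natz subrr.
apply/eqP; rewrite -subr_eq0; apply/eqP.
by apply: (psumr_eq0P _ h0) => // i _; rewrite subr_ge0 C_ge1.
Qed.

(** [partial_coordinates] needs a proper index set whose [z]-sum is at least [n]. If the total is at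
    least [2 n], omit [j]; otherwise it is [n], and [z j > 1] leaves some index with [z = 0] to
    omit. *)
Lemma eps_mulrn_gen j : (1 < z j)%N -> eps *+ n = g.
Proof.
move=> zj; have szj := splitz j.
have [le|lt] := leqP (2 * n) (\sum_i z i).
  have [_] := partial_coordinates (neqT j); apply.
  by move: le (zn j); rewrite szj; move: (\sum_(i in _) z i)%N; clear; lia.
have eT : (\sum_i z i = n)%N.
  case/dvdnP: tz => d ed; move: lt; rewrite ed; case: d ed => [|[|d]] ed; rewrite ?mul0n ?mul1n //.
    by move: ed; rewrite szj mul0n; move: zj; move: (\sum_(i in _) z i)%N; clear; lia.
  by rewrite !mulSn; clear; lia.
have [l /eqP zl|nz] := pickP (fun l => z l == 0%N).
  have [_] := partial_coordinates (neqT l); apply.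
  by have := splitz l; rewrite eT zl add0n => <-.
exfalso.
have : (\sum_(i in ~: [set j]) 1 <= \sum_(i in ~: [set j]) z i)%N.
  by apply: leq_sum => i _; rewrite lt0n nz.
have := cardsC [set j]; rewrite cards1 card_ord sum1_card.
move: szj; rewrite [X in X = _]eT; move: zj.
by move: (\sum_(i in _) z i)%N #|_|; clear; lia.
Qed.

End BlockCoordinates.

Lemma seq_lift (A B : eqType) (P : B -> Prop) (F : B -> A) (s : seq A) :
  (forall v, v \in s -> exists2 b, P b & v = F b) ->
  exists bs, s = map F bs /\ forall b, b \in bs -> P b.
Proof.
elim: s => [|v s IH] h; first by exists [::].
have [|bs [-> hb]] := IH; first by move=> u us; apply: h; rewrite in_cons us orbT.
have [b Pb ->] := h v (mem_head _ _); exists (b :: bs); split=> // c.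
by rewrite in_cons => /orP[/eqP->|/hb].
Qed.

Lemma in_seq_or (A : eqType) (P : A -> Prop) (Q : Prop) (s : seq A) :
  (forall a, a \in s -> P a \/ Q) -> (forall a, a \in s -> P a) \/ Q.
Proof.
elim: s => [|a s IH] h; first by left.
have [hs|] := IH (fun b bs => h b (mem_behead (s := a :: s) bs)); last by right.
have [ha|] := h a (mem_head _ _); last by right.
by left=> b; rewrite in_cons => /orP[/eqP->|/hs].
Qed.

Lemma order_dvd (V : zmodType) (v : V) N t : has_order v N -> v *+ t = 0 -> (N %| t)%N.
Proof.
case=> N0 vN min e; apply/eqP; apply: contraTeq isT => t0; exfalso.
apply: (min (t %% N)%N); first by rewrite lt0n t0 ltn_pmod.
by move: e; rewrite {1}(divn_eq t N) mulrnDr mulnC mulrnA vN mul0rn add0r.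
Qed.

Lemma dvdn_pred_mod N s : (0 < N)%N -> (N %| N.-1 + s)%N -> s = 1 %[mod N].
Proof.
move=> N0 /dvdnP [q e]; case: q e => [|q] e.
  have -> : s = 0%N by lia.
  have -> : N = 1%N by lia.
  by rewrite !modn1.
have -> : (s = q * N + 1)%N by rewrite mulSn in e; lia.
by rewrite modnMDl.
Qed.

(* Projecting along [e1], the complement of [e1^(n-1)] becomes a minimal zero-sum
   sequence of length [m n] over a cyclic group of order [m n], hence constant. *)
Lemma form2a_of_power (V : zmodType) n m (e1 e2 : V) (S S' : seq V) s0 a0 :
  (1 < n)%N -> (1 < m)%N -> is_basis e1 e2 -> e1 *+ n = 0 ->
  (forall t, e1 *+ t = 0 -> (n %| t)%N) -> has_order e2 (m * n) ->
  perm_eq S (nseq n.-1 e1 ++ S') -> size S' = (m * n)%N ->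
  zsfree (m * n + n - 2) S -> sg S = 0 -> s0 \in S' -> s0 = e1 *+ a0 + e2 ->
  form2a n m e1 e2 S.
Proof.
move=> n1 m1 [gen ind] ne1 o1 o2 pS szS' zS tS s0S es0.
set N := (m * n)%N in o2 szS' zS *.
have N4 : (3 < N)%N by rewrite /N; clear - n1 m1; nia.
pose c (p : nat * nat) := e1 *+ p.1 + e2 *+ p.2.
have [ab [eab _]] : exists ab, S' = map c ab /\ forall p, p \in ab -> True.
  by apply: seq_lift => v _; have [a [b ->]] := gen v; exists (a, b).
have szab : size ab = N by rewrite -szS' eab size_map.
have sgc t : sg (map c t) = e1 *+ (\sum_(p <- t) p.1) + e2 *+ sumn (map snd t).
  elim: t => [|p t IH]; first by rewrite !big_nil addr0.
  by rewrite /= !big_cons /= IH !mulrnDr /c; zmodule.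
have e2N j : (N %| j)%N -> e2 *+ j = 0.
  by case: o2 => _ h _ /dvdnP [q ->]; rewrite mulnC mulrnA h mul0rn.
have mod1 i : exists2 q, (q <= n.-1)%N & e1 *+ (i + q) = 0.
  exists ((n - i %% n) %% n)%N; first by have := ltn_pmod (n - i %% n) (ltnW n1); clear; lia.
  have /dvdnP [q ->] : (n %| i + (n - i %% n) %% n)%N.
    rewrite /dvdn modnDmr -modnDml subnKC ?modnn //.
    by apply: ltnW; apply: ltn_pmod; apply: ltnW.
  by rewrite mulnC mulrnA ne1 mul0rn.
(* At most [n - 1] copies of [e1] cancel the first coordinate; unless [t] exhausts [S'], the length
   stays within [m n + n - 2]. *)
have full t r : perm_eq ab (t ++ r) -> (0 < size t)%N -> (N %| sumn (map snd t))%N -> size r = 0%N.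
  move=> p t0 d; apply/eqP; rewrite -leqn0 leqNgt; apply/negP => r0.
  have szp := perm_size p; rewrite size_cat szab in szp.
  have [q qn eq] := mod1 (\sum_(p <- t) p.1)%N.
  have ps : perm_eq S' (map c t ++ map c r) by rewrite eab -map_cat; apply: perm_map.
  apply: (zS (map c t ++ nseq q e1) (map c r ++ nseq (n.-1 - q) e1)).
  - have eq' : nseq n.-1 e1 = nseq q e1 ++ nseq (n.-1 - q) e1 by rewrite -nseqD subnKC.
    by rewrite eq' in pS; clear p; perm_count.
  - by rewrite size_cat size_map size_nseq; clear - t0 r0 szp qn n1; slia.
  - by rewrite sg_cat sg_nseq sgc (e2N _ d) addr0 -mulrnDr.
have cong p p' : p \in ab -> p' \in ab -> p.2 = p'.2 %[mod N].
  move=> hp hp'; case: (boolP (p == p')) => [/eqP -> //|npp].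
  have [r1 p1] := mem_perm_cons hp.
  have : p' \in r1 by move: hp'; rewrite (perm_mem p1) in_cons eq_sym (negbTE npp).
  case/mem_perm_cons => r2 p2.
  have s1 := perm_size p1; have s2 := perm_size p2; rewrite szab /= in s1; rewrite /= in s2.
  (* Deleting an element [q] other than [p] and [p'] leaves a zero-sum free sequence of the maximal
     length [N - 1]. *)
  case: r2 p2 s2 => [|q r2] p2 s2; first by exfalso; move: s1 s2 => /=; clear - N4; lia.
  have zf : nat_zsfree N [seq x.2 | x <- [:: p, p' & r2]].
    move=> t r /perm_map_cat_lift [T [R [pT eT eR]]] t0; apply/negP => d.
    have sT : (0 < size T)%N by rewrite -eT size_map in t0.
    have := @full T (q :: R) _ sT; rewrite eT => /(_ _ d) h.
    by have : size (q :: R) = 0%N by apply: h; perm_count.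
  apply: (nat_zsfree_congr (m := N) _ zf).
  - by clear - N4; lia.
  - by rewrite size_map /=; move: s1 s2 => /=; clear; lia.
  - by rewrite /= mem_head.
  - by rewrite /= !inE eqxx orbT.
have one p : p \in ab -> e2 *+ p.2 = e2.
  move=> hp; rewrite eab in s0S; have /mapP [p0 hp0 e0] := s0S.
  have e : p0.2 = 1 %[mod N].
    have : e1 *+ (p0.1 + n.-1 * a0) + e2 *+ (p0.2 + N.-1) = 0.
      have -> : e1 *+ (p0.1 + n.-1 * a0) + e2 *+ (p0.2 + N.-1) =
         c p0 + (e1 *+ (n.-1 * a0) + e2 *+ N.-1) by rewrite !mulrnDr /c; zmodule.
      rewrite -e0 es0.
      have -> : e1 *+ a0 + e2 + (e1 *+ (n.-1 * a0) + e2 *+ N.-1) =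
         (e1 *+ a0 + e1 *+ (n.-1 * a0)) + (e2 + e2 *+ N.-1) by zmodule.
      rewrite -mulrnDr -mulSn prednK ?(ltnW n1) // mulrnA ne1 mul0rn add0r -mulrS prednK.
        exact: e2N.
      by clear - N4; lia.
    case/ind => _ /(order_dvd o2); rewrite addnC; apply: dvdn_pred_mod.
    by clear - N4; lia.
  have ep : p.2 = 1 %[mod N] by rewrite -e; apply: cong.
  have h0 : e2 *+ (p.2 %/ N * N) = 0 by apply: e2N; apply: dvdn_mull.
  rewrite (divn_eq p.2 N) mulrnDr h0 add0r ep modn_small //.
  by clear - N4; lia.
have n0 := ltnW n1.
exists [seq (p.1 %% n)%N | p <- ab].
have eS' : S' = [seq e1 *+ xi + e2 | xi <- [seq (p.1 %% n)%N | p <- ab]].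
  rewrite eab -map_comp; apply/eq_in_map => p hp /=; rewrite /c one //; congr (_ + _).
  by rewrite {1}(divn_eq p.1 n) mulrnDr mulnC mulrnA ne1 mul0rn add0r.
split.
- by rewrite size_map.
- by apply/allP => y /mapP [p _ ->]; rewrite ltn_pmod.
- set xs := [seq (p.1 %% n)%N | p <- ab] in eS' *.
  have : e1 *+ (n.-1 + sumn xs) = 0.
    have sgxs t : sg [seq e1 *+ xi + e2 | xi <- t] = e1 *+ sumn t + e2 *+ size t.
      elim: t => [|y t IH] /=; first by rewrite big_nil addr0.
      by rewrite sg_cons IH mulrnDr mulrS; zmodule.
    move: tS; rewrite (sg_perm pS) sg_cat sg_nseq eS' sgxs size_map szab e2N // addr0 -mulrnDr.
    by [].
  by move/o1; apply: dvdn_pred_mod.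
- by rewrite -eS'.
Qed.

(** * The forms of item 2 *)

Section DavenportMain.
Variables (V U : zmodType) (phi : {additive V -> U}) (n m : nat) (w : V).
Hypothesis red : reduction phi n m w.
Let n1 := red_n red.
Let m1 := red_m red.
Let Un := red_exp red.
Let indep := red_indep red.
Hypothesis U_bound : forall s : seq U, zsfree (2 * n - 1 - 1) s -> (size s < 2 * n - 1 + 1)%N.
Let hk : (0 < 1 < n)%N.
Proof. exact: n1. Qed.
Variables (S W : seq V) (Bs : seq (seq V)).
Hypothesis hS : extremal n m 1 S.
Hypothesis hd : dec phi n m 1 S W Bs.
Variables (eps : V) (e2 : U) (WF : seq V) (xs : seq nat).
Hypothesis pW : perm_eq W (nseq n.-1 eps ++ WF).
Hypothesis gab : generates (phi eps) e2.
Hypothesis sx : size xs = n.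
Hypothesis tx : sumn xs = 1 %[mod n].
Hypothesis eF : map phi WF = [seq phi eps *+ x + e2 | x <- xs].
Variables (g : V).
Hypothesis gg : ker_gen phi m g.
Hypothesis gB : forall B, B \in Bs -> sg B = g.

Let e1 := phi eps.
Let f (i : 'I_n) := nth 0 WF i.
Let x (i : 'I_n) := nth 0%N xs i.

Let hB B : B \in Bs -> size B = n /\ phi (sg B) = 0.
Proof. by case: hd => _ _ h _ _; exact: h. Qed.

Let sF : size WF = n.
Proof. by rewrite -(size_map phi) eF size_map. Qed.

Let n0 : (0 < n)%N. Proof. exact: ltnW. Qed.

Let epsW : eps \in W.
Proof. by rewrite (perm_mem pW) mem_cat mem_nseq eqxx andbT; apply/orP; left; clear - n1; lia. Qed.

Let phif i : phi (f i) = e1 *+ x i + e2.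
Proof.
have := congr1 (nth 0 ^~ i) eF; rewrite (nth_map 0) ?sF // => ->.
by rewrite (nth_map 0%N) ?sx.
Qed.

Let phifI (I : {set 'I_n}) : phi (\sum_(i in I) f i) = e1 *+ (\sum_(i in I) x i) + e2 *+ #|I|.
Proof.
rewrite raddf_sum (eq_bigr (fun i => e1 *+ x i + e2)) => [|i _]; last exact: phif.
by rewrite big_split /= sumr_const -sumrMnr.
Qed.

Let sumx : (\sum_i x i = 1 %[mod n])%N.
Proof. by rewrite -tx sumnE (big_nth 0%N) sx big_mkord. Qed.

Lemma exchange_eps B (I J : {set 'I_n}) r : B \in Bs -> (r < n)%N ->
  J != set0 -> (0 < (n - #|J|) + #|I| + r)%N ->
  phi (\sum_(j in J) nth 0 B j) = phi (\sum_(i in I) f i) + e1 *+ r ->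
  \sum_(j in J) nth 0 B j = \sum_(i in I) f i + eps *+ r.
Proof.
move=> BB rn J0 pos e; rewrite -sg_nseq.
apply: (subsum_exchange red hS hd BB pW (RA' := nseq (n.-1 - r) eps)) => //.
- by rewrite size_nseq.
- by rewrite -nseqD subnKC //; clear - rn; lia.
- by rewrite size_nseq.
- by rewrite e raddfD sg_nseq raddfMn.
Qed.

(** [W] has [2 n - 1 <= 3 n - 2] elements and its sum has image [0], so it is itself an admissible
    exchange for a block. *)
Lemma sum_W B : B \in Bs -> sg W = g.
Proof.
move=> BB; rewrite -(gB BB); case: (hd) => _ _ _ szW _.
apply: (dec_exchange red hk hS hd BB (R := B)) => //.
  by rewrite szW; clear - n1; lia.
rewrite (sg_perm pW) sg_cat sg_nseq raddfD raddfMn phi_sg eF -/e1.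
have sgx t : sg [seq e1 *+ y + e2 | y <- t] = e1 *+ sumn t + e2 *+ size t.
  elim: t => [|y t IH] /=; first by rewrite big_nil addr0.
  by rewrite sg_cons IH mulrnDr mulrS; zmodule.
rewrite sgx sx Un addr0 -mulrnDr.
have -> : e1 *+ (n.-1 + sumn xs) = e1 *+ (n.-1 + 1).
  by apply: (mulrn_modU red); rewrite -modnDmr tx modnDmr.
by rewrite addn1 prednK.
Qed.

Lemma sum_S : sg S = 0.
Proof.
case: (hd) => pS sBs _ _ _.
have [B BB] : exists B, B \in Bs.
  by case: (Bs) sBs => [|B Bs'] /= hs; [exfalso; clear - hs m1; lia | exists B; rewrite mem_head].
rewrite (sg_perm pS) sg_cat (sum_W BB) big_flatten_map.
rewrite (eq_big_seq (fun=> g)); last by move=> C CB; exact: gB.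
rewrite big_const_seq count_predT iter_addr_0 sBs -mulrS prednK; last by apply: ltnW.
by case: gg => _ h _; apply/eqP; rewrite h.
Qed.

(** If [z = 0], the image of [h] is some [r e1]. Completed by copies of [eps] it becomes a kernel
    sum of length at most [n], hence exactly [n], which forces [r = 1]; then [dec_swap] applies. *)
Lemma block_element B h : B \in Bs -> h \in B -> exists y z,
  [/\ (z < n)%N, phi h = e1 *+ y + e2 *+ z & z = 0%N -> h = eps].
Proof.
move=> BB hin; have [y [z' eh]] := gab (phi h).
exists y, (z' %% n)%N; split; first by rewrite ltn_pmod.
  by rewrite eh; congr (_ + _); apply: (mulrn_modU red); rewrite modn_mod.
move=> z0; apply/esym; apply: (dec_swap red hk hS hd BB) => //.
have {}eh : phi h = e1 *+ (y %% n).
  rewrite eh; have -> : e2 *+ z' = e2 *+ 0 by apply: (mulrn_modU red); rewrite z0 mod0n.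
  by rewrite mulr0n addr0; apply: (mulrn_modU red); rewrite modn_mod.
have := ltn_pmod y n0; set r := (y %% n)%N in eh *; move=> rn.
have [B1 pB1] := mem_perm_cons hin.
have [r1|r1] := eqVneq r 1%N; first by rewrite eh r1.
pose q := if r == 0%N then 0%N else (n - r)%N.
have qn : (q <= n.-1)%N by rewrite /q; case: ifP r1; clear - rn; lia.
have : size (h :: nseq q eps) = n.
  apply: (dec_no_short red hk U_bound hS hd BB (R := nseq (n.-1 - q) eps ++ WF ++ B1)).
  - have eq : nseq n.-1 eps = nseq q eps ++ nseq (n.-1 - q) eps by rewrite -nseqD subnKC.
    by move: (pW) (pB1); rewrite eq; clear => ? ?; perm_count.
  - by rewrite /= size_nseq; clear - qn n0; lia.
  - rewrite sg_cons sg_nseq raddfD raddfMn eh -mulrnDr /q.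
    case: eqP => [->//|r0]; rewrite subnKC ?Un //; exact: ltnW.
rewrite /= size_nseq /q; case: ifP; clear - rn n1 r1; lia.
Qed.

(** The factor [n - 1] stands for [-1]. This supplies the function [r] required by
    [lift_coordinates] and [element_coordinate]. *)
Lemma block_element_rep B (j : 'I_n) y z : B \in Bs -> (0 < z < n)%N ->
  phi (nth 0 B j) = e1 *+ y + e2 *+ z ->
  forall I : {set 'I_n}, #|I| = z ->
    ((y + n.-1 * \sum_(i in I) x i) %% n < n)%N /\
    nth 0 B j = \sum_(i in I) f i + eps *+ ((y + n.-1 * \sum_(i in I) x i) %% n).
Proof.
move=> BB hz e I cI; have rn := ltn_pmod (y + n.-1 * \sum_(i in I) x i) n0; split=> //.
have := @exchange_eps B I [set j] _ BB rn; rewrite !big_set1; apply.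
- by apply/set0Pn; exists j; rewrite inE.
- by rewrite cards1 cI; clear - hz; lia.
- rewrite phifI cI addrAC -mulrnDr e; congr (_ + _); apply: (mulrn_modU red).
  rewrite modnDmr addnCA -mulSn prednK // addnC mulnC modnMDl.
  by [].
Qed.

(** Here [n eps = g], so subtracting a suitable multiple of [eps] from one [f o] gives [E] with
    [n E = 0], which completes [eps] to a basis. *)
Lemma all_eps_form2b : (forall B h, B \in Bs -> h \in B -> h = eps) ->
  altA m n (form2b n m) S.
Proof.
move=> all_eps; case: (hd) => pS sBs _ _ _.
have [B BB] : exists B, B \in Bs.
  by case: (Bs) sBs => [|B Bs'] /= hs; [exfalso; clear - hs m1; lia | exists B; rewrite mem_head].
have ne : eps *+ n = g.
  have [sB _] := hB BB; rewrite -(gB BB) (@nseq_of_all _ eps B n) ?sg_nseq // => h hh.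
  exact: all_eps BB hh.
have [gk go gl] := gg.
pose o : 'I_n := Ordinal n0.
have [c ec] : exists c, f o *+ n = g *+ c by apply: gl; rewrite raddfMn Un.
pose E := f o - eps *+ c.
have nE : E *+ n = 0 by rewrite /E mulrnBl ec -mulrnA mulnC mulrnA ne subrr.
have gE : generates (phi E) (phi eps).
  move=> q; have [i [j ->]] := gab q.
  exists j, (i + (c + n.-1 * x o) * j)%N.
  rewrite /E raddfB raddfMn phif -/e1.
  have e0 : e1 *+ x o + e1 *+ (n.-1 * x o) = 0.
    by rewrite -mulrnDr -mulSn prednK // mulrnA Un mul0rn.
  rewrite mulrnDr mulrnA [e1 *+ (_ + _)]mulrnDr !mulrnBl !mulrnDl.
  have -> : e1 *+ x o *+ j + e2 *+ j - e1 *+ c *+ j + (e1 *+ i + (e1 *+ c *+ j + e1 *+ (n.-1 * x o) *+ j)) =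
     e1 *+ i + e2 *+ j + (e1 *+ x o *+ j + e1 *+ (n.-1 * x o) *+ j) by zmodule.
  by rewrite -mulrnDl e0 mul0rn addr0.
have [bs od] := basis_lift red gg gE nE ne.
exists E, eps; split=> //.
have N0 : (0 < m * n)%N by rewrite muln_gt0 n0 andbT ltnW.
have [bl [ebl hbl]] : exists bl, WF = [seq eps *+ b + E | b <- bl] /\ forall b, b \in bl -> (b < m * n)%N.
  apply: seq_lift => v vW.
  have [i ei] : exists i : 'I_n, v = f i.
    have /(nthP 0) [i li e] := vW; rewrite sF in li.
    by exists (Ordinal li); rewrite /f /= e.
  have [l el] : exists l, v - f o - eps *+ (x i + n.-1 * x o) = g *+ l.
    apply: gl; rewrite !raddfB raddfMn ei !phif -/e1.
    have e0 : e1 *+ x o + e1 *+ (n.-1 * x o) = 0.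
      by rewrite -mulrnDr -mulSn prednK // mulrnA Un mul0rn.
    rewrite mulrnDr.
    have -> : e1 *+ x i + e2 - (e1 *+ x o + e2) - (e1 *+ x i + e1 *+ (n.-1 * x o)) =
      - (e1 *+ x o + e1 *+ (n.-1 * x o)) by zmodule.
    by rewrite e0 oppr0.
  pose b := (c + (x i + n.-1 * x o) + n * l)%N.
  have eb : v = eps *+ b + E.
    rewrite /b /E !mulrnDr [eps *+ (n * l)]mulrnA ne -el mulrnDr; zmodule.
  exists (b %% (m * n))%N; first by rewrite ltn_pmod.
  rewrite {1}eb; congr (_ + _); rewrite {1}(divn_eq b (m * n)) mulrnDr mulnC mulrnA.
  by case: od => _ -> _; rewrite mul0rn add0r.
have pT : perm_eq S (nseq (m * n).-1 eps ++ WF).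
  have eB : flatten Bs = nseq (n * m.-1) eps.
    apply: nseq_of_all; first by rewrite (@size_flatten_const _ n) ?sBs // => C /hB [].
    by move=> y /flattenP [C CB yC]; exact: all_eps CB yC.
  have -> : ((m * n).-1 = n.-1 + n * m.-1)%N.
    rewrite -{1}(prednK (ltnW m1)) mulSn mulnC; clear - n0; lia.
  rewrite nseqD -eB (permPl pS) -catA.
  apply: perm_trans (_ : perm_eq _ ((nseq n.-1 eps ++ WF) ++ flatten Bs)) _.
    by rewrite perm_cat2r.
  by rewrite -catA perm_cat2l perm_catC.
exists bl; split.
- by rewrite -sF ebl size_map.
- by apply/allP.
- have : eps *+ ((m * n).-1 + sumn bl) = 0.
    have sgb t : sg [seq eps *+ b + E | b <- t] = eps *+ sumn t + E *+ size t.
      elim: t => [|y t IH] /=; first by rewrite big_nil addr0.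
      by rewrite sg_cons IH mulrnDr mulrS; zmodule.
    have sb : size bl = n by rewrite -sF ebl size_map.
    by rewrite -sum_S (sg_perm pT) sg_cat sg_nseq ebl sgb sb nE addr0 mulrnDr.
  by move/(order_dvd od); apply: dvdn_pred_mod.
- by rewrite -ebl.
Qed.

Lemma eps_ord t : eps *+ t = 0 -> (n %| t)%N.
Proof.
move=> e; have [] := indep gab (i := t) (j := 0%N); last by [].
by rewrite mulr0n addr0 -raddfMn e raddf0.
Qed.

(** Comparing two [z]-sets that differ in one index shows that [f i - x i eps] is the same element
    [F] for all [i]. *)
Lemma eps_torsion_form2a B (j : 'I_n) y z : eps *+ n = 0 -> B \in Bs -> (0 < z < n)%N ->
  phi (nth 0 B j) = e1 *+ y + e2 *+ z -> altA m n (form2a n m) S.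
Proof.
move=> ne BB hz eh; case: (hd) => pS sBs _ _ _.
have rep := block_element_rep BB hz eh.
have epsm i l : i = l %[mod n] -> eps *+ i = eps *+ l.
  have um q : eps *+ q = eps *+ (q %% n).
    by rewrite {1}(divn_eq q n) mulrnDr mulnC mulrnA ne mul0rn add0r.
  by move=> e; rewrite (um i) (um l) e.
have same i i' : f i + eps *+ (n.-1 * x i) = f i' + eps *+ (n.-1 * x i').
  have [|K [sK cK]] := @exists_subset_card _ (~: [set i; i']) z.-1.
    have c2 : (#|[set i; i']| <= 2)%N by rewrite cards2; case: (i != i').
    have := cardsC [set i; i']; rewrite card_ord; clear - c2 hz; lia.
  have key l : l \notin K -> nth 0 B j = f l + eps *+ (n.-1 * x l) +
      (\sum_(i in K) f i + eps *+ (y + n.-1 * \sum_(i in K) x i)).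
    move=> lK; have [|_ ->] := rep (l |: K); first by rewrite cardsU1 lK cK; clear - hz; lia.
    rewrite !big_setU1 //= (epsm _ (y + n.-1 * (x l + \sum_(i in K) x i))%N) ?modn_mod //.
    by rewrite mulnDr addnCA mulrnDr; zmodule.
  have iK : i \notin K by apply/negP => /(subsetP sK); rewrite !inE eqxx.
  have iK' : i' \notin K by apply/negP => /(subsetP sK); rewrite !inE eqxx orbT.
  by have := key i iK; rewrite {1}(key i' iK') => /addIr.
pose o : 'I_n := Ordinal n0.
pose F := f o + eps *+ (n.-1 * x o).
have fE i : f i = eps *+ x i + F.
  rewrite /F (same o i).
  have e0 : eps *+ x i + eps *+ (n.-1 * x i) = 0.
    by rewrite -mulrnDr -mulSn prednK // mulrnA ne mul0rn.
  by rewrite -[LHS]addr0 -e0; zmodule.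
have sumF : \sum_i f i = eps *+ (\sum_i x i) + F *+ n.
  rewrite (eq_bigr (fun i => eps *+ x i + F)) => [|i _]; last exact: fE.
  by rewrite big_split /= sumr_const card_ord -sumrMnr.
have sgWF : sg WF = \sum_i f i.
  by rewrite [in LHS](list_ord sF) big_map big_enum.
have nF : F *+ n = g.
  rewrite -(sum_W BB) (sg_perm pW) sg_cat sg_nseq sgWF sumF addrA -mulrnDr.
  rewrite (epsm _ 0%N) ?mulr0n ?add0r // -modnDmr sumx modnDmr addn1 prednK // modnn mod0n.
  by [].
have pF : phi F = e2.
  rewrite /F raddfD raddfMn phif addrAC -mulrnDr -mulSn prednK // mulrnA Un mul0rn add0r.
  by [].
have gF : generates (phi eps) (phi F) by rewrite pF.
have [bs od] := basis_lift red gg gF ne nF.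
exists eps, F; split=> //; case: (hS) => szS zS.
apply: (@form2a_of_power _ n m eps F S (WF ++ flatten Bs) (f o) (x o)) => //.
- exact: eps_ord.
- by rewrite (permPl pS) catA perm_cat2r.
- rewrite size_cat sF (@size_flatten_const _ n) => [|C /hB []//].
  by rewrite sBs -mulnS (prednK (ltnW m1)) mulnC.
- by move: zS; have -> : (m * n + n - 1 - 1 = m * n + n - 2)%N by clear; lia.
- exact: sum_S.
- by rewrite mem_cat mem_nth // sF.
Qed.


Lemma mulrz_natU (u : U) (c : int) : exists2 t : nat, (n%:Z %| c - t%:Z)%Z & u *~ c = u *+ t.
Proof.
have c0 : 0 <= (c %% n%:Z)%Z by rewrite modz_ge0 // -lt0n.
exists `|(c %% n%:Z)%Z|%N; rewrite ?pmulrn gez0_abs //.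
  by rewrite {1}(divz_eq c n%:Z) addrK dvdz_mull.
by rewrite {1}(divz_eq c n%:Z) mulrzDr mulrC mulrzA -pmulrn Un mul0rz add0r.
Qed.

Lemma mulrz_eqU (u : U) (c d : int) : (n%:Z %| c - d)%Z -> u *~ c = u *~ d.
Proof.
case/dvdzP => q e; apply/eqP; rewrite -subr_eq0 -mulrzBr e mulrC mulrzA -pmulrn Un.
by rewrite mul0rz.
Qed.

Lemma e1_dvd (d : int) : e1 *~ d = 0 -> (n%:Z %| d)%Z.
Proof.
have [t dv et] := mulrz_natU e1 d; rewrite et => e.
have [] := indep gab (i := t) (j := 0%N); first by rewrite mulr0n addr0.
by move=> dt _; rewrite -[d](subrK t%:Z) rpredD.
Qed.

Lemma eps_dvd (d : int) : eps *~ d = 0 -> (n%:Z %| d)%Z.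
Proof. by move=> e; apply: e1_dvd; rewrite -raddfMz e raddf0. Qed.

Lemma sg_WF : sg WF = \sum_i f i.
Proof. by rewrite [in LHS](list_ord sF) big_map big_enum. Qed.

Section Nontorsion.
Hypothesis eps_n : eps *+ n <> 0.

(** The coordinates from [lift_coordinates] have sum [1] modulo [n] only; moving a multiple of [eps]
    from each of them into [F] makes the sum exactly [1]. *)
Lemma normal_coordinates B (j : 'I_n) y z : B \in Bs -> (0 < z < n)%N ->
  phi (nth 0 B j) = e1 *+ y + e2 *+ z ->
  exists (X : 'I_n -> int) (F : V), [/\ forall i, f i = F + eps *~ X i,
    forall i i', `|X i - X i'| < n%:Z, \sum_i X i = 1 & F *+ n + eps *+ n = g].
Proof.
move=> BB hz eh.
have [X [F [fX sp]]] := lift_coordinates n1 eps_dvd eps_n hz (block_element_rep BB hz eh).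
have sW : eps *+ n.-1 + (F *+ n + eps *~ (\sum_i X i)) = g.
  rewrite -(sum_W BB) (sg_perm pW) sg_cat sg_nseq sg_WF.
  rewrite (eq_bigr (fun i => F + eps *~ X i)) => [|i _]; last exact: fX.
  by rewrite big_split /= sumr_const card_ord -mulrz_sumr.
have /dvdzP [q eq] : (n%:Z %| \sum_i X i - 1)%Z.
  have e : e1 *+ n.-1 + e1 *~ (\sum_i X i) = 0.
    by have [<- _ _] := gg; rewrite -sW 2!(raddfD phi) 2!(raddfMn phi) (raddfMz phi) Un add0r.
  apply: e1_dvd; rewrite mulrzBr mulr1z.
  apply: (addrI (e1 *+ n)); rewrite addr0 {2}Un -{1}(prednK n0) mulrSr -[RHS]e.
  by zmodule.
exists (fun i => X i - q), (F + eps *~ q); split=> [i|i i'||].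
- by rewrite fX mulrzBr; zmodule.
- have -> : X i - q - (X i' - q) = X i - X i' by ring.
  exact: sp.
- rewrite sumrB sumr_const card_ord -mulr_natr natz -eq; ring.
- have eX : \sum_i X i = 1 + q * n%:Z by rewrite -eq; ring.
  rewrite -sW eX mulrzDr mulr1z mulrnDl -{3}(prednK n0) mulrSr.
  have -> : eps *~ q *+ n = eps *~ (q * n%:Z) by rewrite mulrzA pmulrn.
  by zmodule.
Qed.

Section Coordinatised.
Variables (X : 'I_n -> int) (F : V).
Hypothesis fX : forall i, f i = F + eps *~ X i.
Hypothesis spread : forall i i', `|X i - X i'| < n%:Z.
Hypothesis sumX : \sum_i X i = 1.
Hypothesis nF : F *+ n + eps *+ n = g.

Let o : 'I_n := Ordinal n0.

Lemma generates_phiF : generates (phi eps) (phi F).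
Proof.
have [t _ et] := mulrz_natU e1 (X o - (x o)%:Z).
have e2E : e2 = phi F + e1 *+ t.
  have := phif o; rewrite fX raddfD raddfMz -/e1 => e.
  rewrite -et mulrzBr -pmulrn addrA e; zmodule.
move=> q; have [i [j ->]] := gab q; exists (i + t * j)%N, j.
by rewrite e2E mulrnDl mulrnDr mulrnA; zmodule.
Qed.

Lemma block_coordinates B (j : 'I_n) : B \in Bs -> exists zc : nat * int,
  [/\ (zc.1 < n)%N, nth 0 B j = F *+ zc.1 + eps *~ zc.2, zc.1 = 0%N -> zc.2 = 1
    & forall I : {set 'I_n}, #|I| = zc.1 -> 0 <= zc.2 - \sum_(i in I) X i <= n%:Z - 1].
Proof.
move=> BB; have [sB _] := hB BB.
have [|y [z [zn eh z0]]] := @block_element B (nth 0 B j) BB; first by rewrite mem_nth // sB.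
have [ez|z1] := posnP z.
  exists (0%N, 1); split=> //=; first by rewrite mulr0n add0r mulr1z; exact: z0.
  by move=> I /cards0_eq ->; rewrite big_set0; clear - n1; lia.
have hz : (0 < z < n)%N by rewrite z1.
have [C [e h]] := element_coordinate n1 eps_dvd eps_n fX spread (ltnW zn) (block_element_rep BB hz eh).
by exists (z, C); split=> //= ez; rewrite ez in z1.
Qed.

Lemma block_structure B : B \in Bs -> exists z : 'I_n -> nat,
  [/\ forall j : 'I_n, (z j < n)%N, forall j : 'I_n, nth 0 B j = F *+ z j + eps,
      (n %| \sum_j z j)%N, forall j : 'I_n, (1 < z j)%N -> eps *+ n = g
    & forall (j : 'I_n) (I : {set 'I_n}), #|I| = z j -> 0 <= 1 - \sum_(i in I) X i <= n%:Z - 1].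
Proof.
move=> BB; have [sB zB] := hB BB.
have [zc hzc] := fin_all_exists (fun j => block_coordinates j BB).
pose z j := (zc j).1; pose C j := (zc j).2.
have zn j : (z j < n)%N by have [] := hzc j.
have hE (j : 'I_n) : nth 0 B j = F *+ z j + eps *~ C j by have [] := hzc j.
have z0 j : z j = 0%N -> C j = 1 by have [] := hzc j.
have single j (I : {set 'I_n}) : #|I| = z j -> 0 <= C j - \sum_(i in I) X i <= n%:Z - 1.
  by have [_ _ _] := hzc j; apply.
have sumh (J : {set 'I_n}) :
    \sum_(j in J) nth 0 B j = F *+ (\sum_(j in J) z j) + eps *~ (\sum_(j in J) C j).
  rewrite (eq_bigr (fun j => F *+ z j + eps *~ C j)) => [|j _]; last exact: hE.
  by rewrite big_split /= -sumrMnr -mulrz_sumr.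
have tot : sg B = F *+ (\sum_j z j) + eps *~ (\sum_j C j).
  have -> : sg B = \sum_j nth 0 B (j : 'I_n).
    by rewrite [in LHS](list_ord sB) big_map big_enum.
  rewrite (eq_bigr (fun j => F *+ z j + eps *~ C j)) => [|j _]; last exact: hE.
  by rewrite big_split /= -sumrMnr -mulrz_sumr.
have [tz tC] : (n %| \sum_j z j)%N /\ (n%:Z %| \sum_j C j)%Z.
  have [t dv et] := mulrz_natU e1 (\sum_j C j).
  have [|d1 d2] := indep generates_phiF (i := t) (j := (\sum_j z j)%N).
    by rewrite -zB tot (raddfD phi) (raddfMn phi) (raddfMz phi) addrC -et.
  by split=> //; rewrite -[X in (_ %| X)%Z](subrK t%:Z) rpredD.
have exch (J I : {set 'I_n}) : J != set0 -> J != setT ->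
    #|I| = ((\sum_(j in J) z j) %% n)%N ->
    exists2 r : nat, (r < n)%N &
    (n%:Z %| \sum_(j in J) C j - \sum_(i in I) X i - r%:Z)%Z /\
    F *+ (\sum_(j in J) z j) + eps *~ (\sum_(j in J) C j) =
    F *+ #|I| + eps *~ (\sum_(i in I) X i) + eps *+ r.
  move=> J0 JT cI; pose c := \sum_(j in J) C j - \sum_(i in I) X i.
  have nz : n%:Z != 0 by rewrite -lt0n.
  have c0 : 0 <= (c %% n%:Z)%Z by rewrite modz_ge0.
  pose r := `|(c %% n%:Z)%Z|%N.
  have er : r%:Z = (c %% n%:Z)%Z by rewrite /r gez0_abs.
  have rn : (r < n)%N by rewrite -ltz_nat er ltz_pmod // ltz_nat.
  have dv : (n%:Z %| c - r%:Z)%Z by rewrite er {1}(divz_eq c n%:Z) addrK dvdz_mull.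
  exists r => //; split=> //.
  rewrite -sumh -(sum_f fX); apply: exchange_eps => //.
    have : (#|J| < n)%N.
      by rewrite -[X in (_ < X)%N](card_ord n) -cardsT proper_card // properEneq JT subsetT.
    by clear; lia.
  rewrite sumh (sum_f fX) !raddfD !raddfMn !raddfMz -/e1 -addrA; congr (_ + _).
    by apply: (mulrn_modU red); rewrite cI modn_mod.
  rewrite pmulrn -mulrzDr; apply: mulrz_eqU.
  by rewrite opprD addrA.
have g0 := gen_neq0 red gg.
have C1 := coordinates_eq1 n1 eps_dvd eps_n g0 sumX nF zn z0 single exch tz tC.
exists z; split=> //.
- by move=> j; rewrite hE C1 mulr1z.
- exact: (eps_mulrn_gen n1 eps_dvd eps_n g0 sumX nF zn single exch tz).
- by move=> j I cI; have := single j I cI; rewrite C1.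
Qed.

(** As [1 < z], [sum_bounded_up] bounds the sums over [n - 1] indices by [1], so every [X i] is
    nonnegative. Having total [1], they are [0] except for a single [1]. Then [F] serves as [e1] and
    [eps] as [e2]. *)
Lemma large_coordinate_form2a z : (1 < z < n)%N -> eps *+ n = g ->
  (forall I : {set 'I_n}, #|I| = z -> \sum_(i in I) X i <= 1) -> altA m n (form2a n m) S.
Proof.
move=> hz eg hX; case: (hd) => pS sBs _ _ _.
have nF0 : F *+ n = 0 by apply: (addIr (eps *+ n)); rewrite nF add0r.
have sumXC i : X i + \sum_(j in ~: [set i]) X j = 1.
  by rewrite -[RHS]sumX [in RHS](bigD1 i) //=; congr (_ + _); apply: eq_bigl => l; rewrite !inE.
have cC (i : 'I_n) : #|~: [set i]| = n.-1.
  by have := cardsC [set i]; rewrite cards1 card_ord => /(congr1 predn).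
have X0 i : 0 <= X i.
  have z1 : 1 < z%:Z by case/andP: hz.
  have := sum_bounded_up (c := 1) isT z1 hX (I := ~: [set i]); rewrite cC => h.
  have := h _; have := sumXC i; move: (\sum_(j in _) X j) => s e.
  by move=> /(_ _) h'; have : s <= 1; [apply: h'; clear - hz; lia | move: e; clear; lia].
have [i0 Xi0|all0] := pickP (fun i => X i != 0); last first.
  by move: sumX; rewrite big1 // => i _; apply/eqP; have := all0 i => /negbFE.
have s0 : 0 <= \sum_(j in ~: [set i0]) X j by apply: sumr_ge0.
have s1 : \sum_(j in ~: [set i0]) X j = 0.
  by have := sumXC i0; have := X0 i0; move: Xi0 s0; move: (\sum_(j in _) X j); clear; lia.
have X1 : X i0 = 1 by have := sumXC i0; rewrite s1 addr0.
have Xi i : i != i0 -> X i = 0.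
  by move=> ni; apply: (psumr_eq0P _ s1); rewrite ?inE.
have gF := generatesC generates_phiF.
have [bs od] := basis_lift red gg gF nF0 eg.
exists F, eps; split=> //; case: (hS) => szS zS.
have pF := perm_pick [set i0] sF.
have e1F : pick_seq WF [set i0] = [:: F + eps].
  by rewrite /pick_seq enum_set1 /= -/(f i0) fX X1 mulr1z.
have e2F : pick_seq WF (~: [set i0]) = nseq n.-1 F.
  apply: nseq_of_all; first by rewrite size_pick cC.
  move=> l /mapP [i]; rewrite mem_enum !inE => ni ->.
  by rewrite -/(f i) fX Xi // mulr0z addr0.
rewrite e1F e2F in pF.
apply: (@form2a_of_power _ n m F eps S ((F + eps) :: nseq n.-1 eps ++ flatten Bs) eps 0%N) => //.
- move=> t e; have [] := indep gF (i := t) (j := 0%N); last by [].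
  by rewrite mulr0n addr0 -raddfMn e raddf0.
- by move: (pS) (pW) (pF); move: (flatten Bs); clear => ? ? ? ?; perm_count.
- rewrite /= size_cat size_nseq (@size_flatten_const _ n) => [|D /hB []//].
  rewrite sBs -addSn prednK // -mulnS (prednK (ltnW m1)) mulnC.
  by [].
- by move: zS; have -> : (m * n + n - 1 - 1 = m * n + n - 2)%N by clear; lia.
- exact: sum_S.
- by rewrite in_cons mem_cat mem_nseq eqxx andbT; apply/orP; right; apply/orP; left; clear - n1; lia.
- by rewrite mulr0n add0r.
Qed.

Lemma gather_nseq2 (a b : V) (Cs : seq (seq V)) :
  (forall B, B \in Cs -> B = nseq n a \/ B = nseq n b) ->
  exists a1 a2, [/\ (a1 + a2 = size Cs)%N,
    perm_eq (flatten Cs) (nseq (n * a1) a ++ nseq (n * a2) b),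
    (0 < a1)%N -> nseq n a \in Cs & nseq n b \in Cs -> nseq n a != nseq n b -> (0 < a2)%N].
Proof.
elim: Cs => [|B Cs IH] h; first by exists 0%N, 0%N; rewrite muln0.
have [|a1 [a2 [sz p h1 h2]]] := IH; first by move=> D DC; apply: h; rewrite in_cons DC orbT.
have [eB|eB] := h B (mem_head _ _).
  exists a1.+1, a2; split.
  - by rewrite addSn sz.
  - by rewrite /= eB mulnS nseqD -catA perm_cat2l.
  - by rewrite eB mem_head.
  - by rewrite in_cons eB eq_sym => /orP[->//|]; exact: h2.
exists a1, a2.+1; split.
- by rewrite addnS sz.
- by rewrite /= eB mulnS nseqD perm_sym perm_catCA perm_cat2l perm_sym.
- by move=> /h1; rewrite in_cons => ->; rewrite orbT.
- by [].
Qed.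

(** Take [g1 = eps], [g2 = F] and [x_i = - X i]; an index with [X i = 1] supplies the odd copy of
    [g1 + g2]. Without blocks [eps^n] this is (d); with one, [n eps = g] gives [n F = 0] and this is
    (c). *)
Lemma small_coordinate_form2cd B0 : (forall B, B \in Bs -> B = nseq n eps \/ B = nseq n (F + eps)) ->
  B0 \in Bs -> B0 = nseq n (F + eps) -> F != 0 -> (forall i, 0 <= 1 - X i <= n%:Z - 1) ->
  altG m n (fun g1 g2 T => form2c n m g1 g2 T \/ form2d n m g1 g2 T) S.
Proof.
move=> hBs B0B eB0 F0 hX; case: (hd) => pS sBs _ _ _.
have [a1 [a2 [sz p h1 h2]]] := gather_nseq2 hBs.
have a20 : (0 < a2)%N.
  apply: h2; first by rewrite -eB0.
  apply: contraNneq F0 => e; apply/eqP; apply: (addIr eps); rewrite add0r.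
  by have := congr1 (head 0) e; case: (n) n0 => //= n' _ ->.
have [gn od] := gen_lift red gg generates_phiF (etrans (mulrnDl _ _ _) (etrans (addrC _ _) nF)).
exists eps, F; split=> //.
have [i0 Xi0|all0] := pickP (fun i => 0 < X i); last first.
  have : \sum_i X i <= 0 by apply: sumr_le0 => i _; rewrite leNgt all0.
  by rewrite sumX.
have X1 : X i0 = 1 by have := hX i0; move: Xi0; clear; lia.
have pF := perm_pick [set i0] sF.
have e1F : pick_seq WF [set i0] = [:: F + eps].
  by rewrite /pick_seq enum_set1 /= -/(f i0) fX X1 mulr1z.
pose ys := [seq - X i | i <- enum (~: [set i0])].
have e2F : pick_seq WF (~: [set i0]) = [seq eps *~ (- y) + F | y <- ys].
  by rewrite /ys -map_comp; apply: eq_map => i /=; rewrite -/(f i) fX opprK addrC.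
rewrite e1F e2F in pF.
have sy : size ys = n.-1.
  by rewrite size_map -cardE; have := cardsC [set i0]; rewrite cards1 card_ord => /(congr1 predn).
have ay : all (fun xi => (-1 <= xi) && (xi <= n%:Z - 2)) ys.
  by apply/allP => y /mapP [i _ ->]; have := hX i; clear; lia.
have ty : \sum_(xi <- ys) xi = 0.
  rewrite big_map big_enum /= sumrN; apply/eqP; rewrite oppr_eq0; apply/eqP.
  apply: (addrI (X i0)); rewrite addr0 {2}X1 -sumX [in RHS](bigD1 i0) //=; congr (_ + _).
  by apply: eq_bigl => l; rewrite !inE.
have pT : perm_eq S (nseq (n.-1 + n * a1) eps ++ nseq (n * a2 + 1) (eps + F)
                     ++ [seq eps *~ (- y) + F | y <- ys]).
  have -> : eps + F = F + eps by rewrite addrC.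
  move: (pS) (pW) (pF) (p); move: (flatten Bs) [seq _ | _ <- ys].
  rewrite !nseqD; move: (nseq n.-1 eps) (nseq (n * a1) eps) (nseq (n * a2) (F + eps)).
  by rewrite [nseq 1 _]/=; clear => ? ? ? ? ? ? ? ? ?; perm_count.
rewrite sBs in sz.
have [a10|a10] := posnP a1.
  right; exists ys; split=> //; move: pT; rewrite a10 muln0 addn0.
  by have -> : ((m - 1) * n = n * a2)%N by rewrite mulnC; congr (_ * _)%N; clear - sz a10; lia.
left; exists a1.+1, ys; split; first by clear - sz a20; lia.
split=> //.
  have := gB (h1 a10); rewrite sg_nseq => eg.
  by apply: (addIr (eps *+ n)); rewrite nF add0r.
move: pT.
have -> : ((a1.+1 * n).-1 = n.-1 + n * a1)%N by rewrite mulSn mulnC; clear - n0; lia.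
by have -> : ((m - a1.+1) * n = n * a2)%N by rewrite mulnC; congr (_ * _)%N; clear - sz; lia.
Qed.

(** A block with some [z j > 1] leads to form (a). Otherwise [n] divides a sum of [n] numbers
    [z j <= 1], so these are all [0] or all [1] and the block is constant. *)
Lemma coordinatised_form B0 h0 : B0 \in Bs -> h0 \in B0 -> h0 != eps ->
  altA m n (form2a n m) S \/
  altG m n (fun g1 g2 T => form2c n m g1 g2 T \/ form2d n m g1 g2 T) S.
Proof.
move=> B0B h0B h0e.
have Fn0 : F != 0.
  apply/eqP => e; have [] := indep generates_phiF (i := 0%N) (j := 1%N).
    by rewrite e raddf0 mul0rn addr0.
  by rewrite dvdn1; clear - n1; lia.
have block B : B \in Bs -> (B = nseq n eps \/ B = nseq n (F + eps) /\
    forall i, 0 <= 1 - X i <= n%:Z - 1) \/ altA m n (form2a n m) S.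
  move=> BB; have [z [zn hE tz zbig hX]] := block_structure BB; have [sB _] := hB BB.
  have const c v : (forall j, z j = c) -> v = F *+ c + eps -> B = nseq n v.
    move=> zc ->; apply: nseq_of_all => // y /(nthP 0) [j]; rewrite sB => lj <-.
    by have := hE (Ordinal lj); rewrite /= zc.
  have [j zj|small] := pickP (fun j => (1 < z j)%N).
    right; apply: (@large_coordinate_form2a (z j)); rewrite ?zj ?zn //; first exact: zbig zj.
    by move=> I cI; have := hX j I cI; move: (\sum_(i in I) X i); clear; lia.
  left; have z1 j : (z j <= 1)%N by rewrite leqNgt small.
  have tot : (\sum_j z j + \sum_j (1 - z j) = n)%N.
    rewrite -big_split /= (eq_bigr (fun=> 1%N)) => [|j _]; last by rewrite subnKC.
    by rewrite sum1_card card_ord.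
  have [e0|e0] := posnP (\sum_j z j).
    left; apply: (const 0%N); last by rewrite mulr0n add0r.
    by move=> j; move/eqP: e0; rewrite sum_nat_eq0 => /forallP /(_ j) /eqP.
  have r0 : (\sum_j (1 - z j) = 0)%N.
    by have := dvdn_leq e0 tz; move: tot; clear; lia.
  have z1E j : z j = 1%N.
    move/eqP: r0; rewrite sum_nat_eq0 => /forallP /(_ j) /eqP; have := z1 j; clear; lia.
  right; split=> [|i]; first by apply: (const 1%N).
  by have := hX o [set i]; rewrite cards1 z1E big_set1; apply.
have [hBs|] := in_seq_or block; last by left.
right; have [e0|[e0 hX]] := hBs B0 B0B.
  by move: h0e; rewrite e0 mem_nseq in h0B *; case/andP: h0B => _ ->.
apply: (@small_coordinate_form2cd B0) => // B /hBs [|[]]; auto.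
Qed.

End Coordinatised.
End Nontorsion.

Lemma block_form2 : altA m n (fun e1 e2 T => form2a n m e1 e2 T \/ form2b n m e1 e2 T) S \/
  altG m n (fun g1 g2 T => form2c n m g1 g2 T \/ form2d n m g1 g2 T) S.
Proof.
have [/allP all_eps|/allPn [B BB /allPn [h hin /= he]]] :=
    boolP (all (fun B : seq V => all (pred1 eps) B) Bs).
  have [|a [b [ba ob fb]]] := all_eps_form2b.
    by move=> B h BB hin; apply/eqP; exact: (allP (all_eps B BB)) hin.
  by left; exists a, b; split=> //; right.
have [y [z [zn eh z0]]] := block_element BB hin.
have [sB _] := hB BB.
have [j lj ej] : exists2 j, (j < n)%N & nth 0 B j = h by have /(nthP 0) [j] := hin; rewrite sB; exists j.
have hz : (0 < z < n)%N.
  by rewrite zn andbT lt0n; apply: contraNneq he => /z0 ->.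
have ehj : phi (nth 0 B (Ordinal lj)) = e1 *+ y + e2 *+ z by rewrite /= ej.
have to2a : altA m n (form2a n m) S ->
    altA m n (fun e1 e2 T => form2a n m e1 e2 T \/ form2b n m e1 e2 T) S.
  by case=> a [b [ba ob fb]]; exists a, b; split=> //; left.
have [ne|ne] := eqVneq (eps *+ n) 0.
  by left; apply: to2a; apply: eps_torsion_form2a BB hz ehj.
have [X [F [fX sp sumX nF]]] := normal_coordinates (elimN eqP ne) BB hz ehj.
by have [|] := coordinatised_form (elimN eqP ne) fX sp sumX nF BB hin he; [left; apply: to2a | right].
Qed.

End DavenportMain.

Section Item2.
Variables (V U : zmodType) (phi : {additive V -> U}) (n m : nat) (w : V).
Hypothesis red : reduction phi n m w.
Hypothesis U_bound : forall s : seq U, zsfree (2 * n - 1 - 1) s -> (size s < 2 * n - 1 + 1)%N.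
Hypothesis H_line : forall s : seq U, size s = (2 * n - 2 + 1)%N ->
  zsfree (2 * n - 1 - 1) s -> line_form n s.

Lemma item2_main (S : seq V) : extremal n m 1 S ->
  altA m n (fun e1 e2 T => form2a n m e1 e2 T \/ form2b n m e1 e2 T) S \/
  altG m n (fun g1 g2 T => form2c n m g1 g2 T \/ form2d n m g1 g2 T) S.
Proof.
move=> hS; have hk : (0 < 1 < n)%N by exact: (red_n red).
have [W [Bs hd]] := dec_exists red hk U_bound hS.
have [eps [e2 [WF [xs [pW gab sx tx eF]]]]] := line_normal_form red U_bound H_line hS hd.
have m1 := red_m red.
have [B BB] : exists B, B \in Bs.
  case: (hd) => _ sBs _ _ _.
  by case: (Bs) sBs => [|B Bs'] /= hs; [exfalso; clear - hs m1; lia | exists B; rewrite mem_head].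
apply: (block_form2 red U_bound hS hd pW gab sx tx eF (dec_gen red hk hS hd BB)).
by move=> B' BB'; apply: (dec_sum_eq red hk hS hd).
Qed.

End Item2.

(** * The concrete reduction and the theorem *)

Lemma Zp_mulrn_eq0 N (u : 'Z_N) : (1 < N)%N -> u *+ N = 0.
Proof.
by move=> N1; rewrite -mulr_natr; have /eqP -> : (N%:R == 0 :> 'Z_N); rewrite ?Zp_natr_eq0 // mulr0.
Qed.

Section Grp.
Variables (n m : nat).

Lemma sum_fst (s : seq (grp n m)) : (sg s).1 = \sum_(v <- s) v.1.
Proof. by elim: s => [|v s IH]; rewrite ?big_nil // !big_cons -IH. Qed.

Lemma sum_snd (s : seq (grp n m)) : (sg s).2 = \sum_(v <- s) v.2.
Proof. by elim: s => [|v s IH]; rewrite ?big_nil // !big_cons -IH. Qed.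

Lemma grp_mulrn (v : grp n m) i : v *+ i = (v.1 *+ i, v.2 *+ i).
Proof. by elim: i => [|i IH]; rewrite ?mulr0n // !mulrS IH. Qed.

End Grp.

Section GrpSquare.
Variable n : nat.
Hypothesis n1 : (1 < n)%N.
Local Notation U := (grp n 1).

Let N1 : (1 < 1 * n)%N.
Proof. by rewrite mul1n. Qed.

Lemma grp_exp (u : U) : u *+ n = 0.
Proof.
rewrite grp_mulrn Zp_mulrn_eq0 //; congr (_, _).
by have := Zp_mulrn_eq0 u.2 N1; rewrite [X in _ *+ X]mul1n.
Qed.

Lemma zs2_sum0 (T : seq U) : zs2 (fun u : U => u.1 : nat) (fun u : U => u.2 : nat) n T ->
  sg T = 0.
Proof.
case=> _ d1 d2; rewrite [LHS]surjective_pairing sum_fst sum_snd; congr (_, _).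
  apply/eqP; rewrite (eq_bigr (fun u : U => (u.1 : nat)%:R)) => [|u _]; last by rewrite natr_Zp.
  by rewrite -natr_sum Zp_natr_eq0.
apply/eqP; rewrite (eq_bigr (fun u : U => (u.2 : nat)%:R)) => [|u _]; last by rewrite natr_Zp.
by rewrite -natr_sum Zp_natr_eq0 // [X in (X %| _)%N]mul1n.
Qed.

Lemma grp_eta (s : seq U) : (3 * n - 2 <= size s)%N ->
  exists T R, [/\ perm_eq s (T ++ R), (0 < size T <= n)%N & sg T = 0].
Proof.
move=> le.
have [T [R [p z sT]]] :=
  eta_rank2 (fun u : U => u.1 : nat) (fun u : U => u.2 : nat) (ltnW n1) le.
exists T, R; split=> //; last exact: zs2_sum0.
by case: z => -> _ _.
Qed.

Lemma grp_davenport (s : seq U) : (2 * n - 1 <= size s)%N ->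
  exists T R, [/\ perm_eq s (T ++ R), (0 < size T)%N & sg T = 0].
Proof.
move=> le.
have [T [R [p z]]] :=
  davenport_rank2 (fun u : U => u.1 : nat) (fun u : U => u.2 : nat) (ltnW n1) le.
exists T, R; split=> //; last exact: zs2_sum0.
by case: z.
Qed.

(* [C_n x C_n -> U] is onto between sets of the same cardinality. *)
Lemma grp_indep (a b : U) : generates a b ->
  forall i j, a *+ i + b *+ j = 0 -> (n %| i)%N /\ (n %| j)%N.
Proof.
move=> gab i j e; have n0 := ltnW n1.
have um (u : U) l : u *+ l = u *+ (l %% n).
  by rewrite {1}(divn_eq l n) mulrnDr mulnC mulrnA grp_exp mul0rn add0r.
pose h (p : 'I_n * 'I_n) : 'Z_n * 'Z_(1 * n) := a *+ p.1 + b *+ p.2.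
have cU : #|{: 'Z_n * 'Z_(1 * n)}| = #|{: 'I_n * 'I_n}|.
  by rewrite !card_prod !card_ord !Zp_cast // mul1n.
have surj u : exists p, u = h p.
  have [l [q ->]] := gab u.
  exists (Ordinal (ltn_pmod l n0), Ordinal (ltn_pmod q n0)).
  by rewrite /h /= -!um.
have hi : injective h.
  apply/injectiveP; apply/card_uniqP; rewrite -/(codom h) size_codom -cU.
  by apply: eq_card => u; rewrite inE; have [p ->] := surj u; rewrite codom_f.
have := hi (Ordinal (ltn_pmod i n0), Ordinal (ltn_pmod j n0)) (Ordinal n0, Ordinal n0).
rewrite /h /= -!um e !mulr0n addr0 => /(_ erefl) [ei ej].
by rewrite /dvdn ei ej.
Qed.

End GrpSquare.

Lemma reduction_exists n m : (1 < n)%N -> (1 < m)%N ->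
  exists (phi : {additive grp n m -> grp n 1}) (w : grp n m), reduction phi n m w.
Proof.
move=> n1 m1; have m0 := ltnW m1; have n0 := ltnW n1.
have N1 : (1 < m * n)%N by clear - n1 m0; nia.
have M1 : (1 < 1 * n)%N by rewrite mul1n.
pose r (v : grp n m) : grp n 1 := (v.1, (v.2 : nat)%:R).
have rnat (b : 'Z_n) l : r (b, l%:R) = (b, l%:R).
  rewrite /r /=; congr (_, _); apply: Zp_natr_mod => //.
  by rewrite val_Zp_nat // modn_dvdm // mul1n dvdn_mull.
have snatE (v : grp n m) : v = (v.1, (v.2 : nat)%:R) by rewrite natr_Zp -surjective_pairing.
have rD (u v : grp n m) : r (u + v) = r u + r v.
  have -> : u + v = (u.1 + v.1, ((u.2 : nat) + (v.2 : nat))%:R).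
    by rewrite {1}(snatE u) {1}(snatE v) natrD.
  by rewrite rnat natrD.
have rB : zmod_morphism r.
  by move=> u v; apply: (addIr (r v)); rewrite -rD !subrK.
pose phi : {additive grp n m -> grp n 1} := HB.pack r (GRing.isZmodMorphism.Build _ _ r rB).
have phiE v : phi v = r v by [].
pose w : grp n m := (0, n%:R).
have wi i : w *+ i = (0, (n * i)%:R).
  by rewrite grp_mulrn /= mul0rn mulrnA.
have w0 i : (w *+ i == 0) = (m %| i)%N.
  have e : ((n * i)%:R == 0 :> 'Z_(m * n)) = (m %| i)%N.
    by rewrite Zp_natr_eq0 // [(n * i)%N]mulnC dvdn_pmul2r.
  by rewrite wi -e; apply/eqP/eqP => [/(congr1 snd)|->].
exists phi, w; split=> //.
- rewrite phiE rnat; congr (_, _); apply/eqP.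
  by rewrite Zp_natr_eq0 // mul1n.
- move=> v; rewrite phiE => -[e1 /eqP]; rewrite Zp_natr_eq0 // mul1n => /dvdnP [i ei].
  by exists i; rewrite wi (snatE v) e1 ei [(i * n)%N]mulnC.
- exact: grp_exp.
- exact: grp_indep.
- exact: grp_eta.
Qed.

(** * Consequences of P(n,1,k) over [C_n + C_n] *)

Section Base.
Variables (n k : nat).
Hypothesis n1 : (1 < n)%N.
Hypothesis P1 : StructuralProperty n 1 k.

Let base (s : seq (grp n 1)) : size s = (2 * n - 2 + k)%N -> zsfree (2 * n - 1 - k) s ->
  [/\ k = 0%N -> item2 n 1 (rcons s (- sg s)), k = 1%N -> item2 n 1 s,
      (2 <= k <= n - 2)%N -> item3 n 1 k s & k = n.-1 -> item4 n 1 s].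
Proof.
move=> sz zs; apply: P1; first by rewrite sz mul1n; clear; lia.
by apply/zsfreeP; move: zs; rewrite mul1n mul2n -addnn.
Qed.

Lemma base_tri (s : seq (grp n 1)) : (0 < k < n)%N -> (1 < k)%N \/ k = n.-1 ->
  size s = (2 * n - 2 + k)%N -> zsfree (2 * n - 1 - k) s -> tri_form n k s.
Proof.
move=> hk hk2 sz zs; have [_ _ h3 h4] := base sz zs.
have [ek|nk] := eqVneq k n.-1.
  have [_ /(_ erefl) [a [b [[gab _] _ [s0 [x [s1 hx cx p]]]]]]] := h4 ek.
  exists a, b, x; split=> //; first by clear - hx n1; lia.
    by rewrite ek ltnn.
  move: p; have -> : s0 = 1%N by clear - s1; lia.
  by rewrite subnn mul0n add0n mul1n /tri ek.
have h : (2 <= k <= n - 2)%N by move/eqP: nk; case: hk2; clear - hk; lia.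
have [_ /(_ erefl) [a [b [[gab _] _ [s0 [s1 p]]]]]] := h3 h.
exists a, b, 1%N; split=> //; first by rewrite coprime1n.
move: p; have -> : s0 = 1%N by clear - s1; lia.
by rewrite subnn mul0n add0n mul1n.
Qed.

Let line_of_item2 (s : seq (grp n 1)) : item2 n 1 s -> line_form n s.
Proof.
case=> _ /(_ erefl) [a [b [[gab _] _ [xs [sx _ tx p]]]]].
by exists a, b, xs; split=> //; rewrite sx mul1n.
Qed.

Lemma base_line (s : seq (grp n 1)) : (k <= 1)%N ->
  size s = (2 * n - 2 + 1)%N -> zsfree (2 * n - 1 - 1) s -> line_form n s.
Proof.
move=> k1 sz zs; have [k0|kn0] := posnP k; last first.
  have ek : k = 1%N by clear - k1 kn0; lia.
  have [||_ h2 _ _] := base (s := s); rewrite ?ek //.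
  by apply: line_of_item2; exact: h2.
(* For [k = 0], the Davenport bound makes [s] itself a zero-sum. Removing one [v] gives a sequence
   to which P(n,1,0) applies, and the negated sum appended there is [v] again. *)
have [|T [R [p T0 zT]]] := grp_davenport n1 (s := s); first by rewrite sz; clear - n1; lia.
have R0 : size R = 0%N.
  apply/eqP; rewrite -leqn0 leqNgt; apply/negP => R0; apply: (zs T R p) => //.
  by have := perm_size p; rewrite sz size_cat; clear - T0 R0; lia.
have s0 : sg s = 0 by rewrite (sg_perm p) (size0nil R0) cats0.
case: s sz zs s0 {p} => [|v s] sz zs s0; first by move: sz => /=; clear - n1; lia.
have ev : - sg s = v by move/eqP: s0; rewrite sg_cons addr_eq0 => /eqP.
have szs : size s = (2 * n - 2 + k)%N by move: sz; rewrite k0 /=; clear; lia.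
have [|h _ _ _] := base szs.
  move=> T' R' p' T0' zT'; apply: (zs T' (v :: R')) => //; first by perm_count.
  by have := perm_size p'; rewrite size_cat szs k0; move: T0'; clear - n1; lia.
have [a [b [xs [h1 h2 h3 h4]]]] := line_of_item2 (h k0).
exists a, b, xs; split=> //; move: h4; rewrite ev perm_rcons.
by [].
Qed.

End Base.

Lemma grp_bound n (s : seq (grp n 1)) : (1 < n)%N ->
  zsfree (2 * n - 1 - 1) s -> (size s < 2 * n - 1 + 1)%N.
Proof.
move=> n1 zs; have := davenport_bound n1 (grp_exp n1) (grp_davenport n1) (s := s).
rewrite subn1 addn1 prednK; last by clear - n1; lia.
by apply; move: zs; rewrite -subnDA.
Qed.

(** A zero-sum [T] through the added element has a zero-sum complement inside [S], nonempty because
    [T] has at most [m n + n - 2] of the [m n + n - 1] elements. *)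
Lemma extremal_rcons (V : zmodType) n m (S : seq V) : (1 < n)%N -> (0 < m)%N ->
  size S = (m * n + n - 2)%N -> zsfree (m * n + n - 1) S -> extremal n m 1 (rcons S (- sg S)).
Proof.
move=> n1 m0 sz zs; set v := - sg S; split; first by rewrite size_rcons sz addn1.
move=> T R p hT zT.
have pr : perm_eq (v :: S) (T ++ R) by rewrite -(perm_rcons v S).
have szp := perm_size pr; rewrite /= size_cat sz in szp.
have : v \in T ++ R by rewrite -(perm_mem pr) mem_head.
rewrite mem_cat => /orP[] /mem_perm_cons [Q pQ].
  have zR : sg R = 0.
    by have := sg_perm pr; rewrite sg_cat zT add0r sg_cons /v addNr => <-.
  apply: (zs R Q) => //; first by clear p; perm_count.
  by have := perm_size pQ; move: hT szp; clear; move=> /=; lia.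
apply: (zs T Q) => //; first by clear p; perm_count.
by move: hT szp; clear; lia.
Qed.

Theorem theorem1p2 (n m k : nat) :
  (2 <= m)%N -> (2 <= n)%N -> (k <= n - 1)%N ->
  StructuralProperty n 1 k -> StructuralProperty n m k.
Proof.
move=> m1 n1 hk P1 S sz /zsfreeP zS.
have [phi [w red]] := reduction_exists n1 m1.
have mne : m = 1%N -> False by move=> e; rewrite e in m1.
have hS : extremal n m k S by [].
have hk' : k <> 0%N -> (0 < k < n)%N by clear - hk n1; lia.
have bound : k <> 0%N -> (1 < k)%N \/ k = n.-1 ->
    forall s : seq (grp n 1), zsfree (2 * n - 1 - k) s -> (size s < 2 * n - 1 + k)%N.
  move=> k0 kk s; have [k2|k1] := ltnP 1 k.
    apply: (tri_bound red (hk' k0) k2) => s'.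
    exact: (base_tri n1 P1 (hk' k0) kk).
  have -> : k = 1%N by clear - k0 k1; lia.
  exact: grp_bound.
have tri_k k0 kk s := @base_tri n k n1 P1 s (hk' k0) kk.
have line2 : (k <= 1)%N -> forall T : seq (grp n m), extremal n m 1 T -> item2 n m T.
  move=> k1 T hT; split=> [|/mne //].
  by apply: (item2_main red (fun s => grp_bound n1 (s := s)) (fun s => base_line n1 P1 (s := s) k1)).
split=> ek.
- apply: line2; first by rewrite ek.
  by rewrite ek in sz zS; apply: extremal_rcons => //; [exact: ltnW | rewrite sz addn0 | rewrite -[X in zsfree X]subn0].
- by apply: line2; [rewrite ek | move: hS; rewrite ek].
- split=> [|/mne //]; have k0 : k <> 0%N by clear - ek; lia.
  have kk : (1 < k)%N \/ k = n.-1 by left; case/andP: ek.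
  apply: (item3_main red (hk' k0) (bound k0 kk) (tri_k k0 kk)) => //.
  by clear - ek; lia.
- split=> [|/mne //]; have k0 : k <> 0%N by clear - ek n1; lia.
  have kk : (1 < k)%N \/ k = n.-1 by right.
  exact: (item4_main red (hk' k0) (bound k0 kk) (tri_k k0 kk)).
Qed.
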